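(* For every complex $w$ with $\operatorname{Re}(w)>0$, \begin{align*} 4\sum_{m=1}^{\infty}\int_{0}^{\infty}\frac{u\cos(u)\log(u/w)}{u^2+(2\pi mw)^2}\, du &=\psi_1(iw)-\frac{1}{2}\log^{2}(iw)+\psi_1(-iw)-\frac{1}{2}\log^{2}(-iw)+\frac{\pi}{2w}\\ &\quad+\gamma\left(\psi(iw)+\psi(-iw)-2\log(w)\right). \end{align*}
   Context: $\log$ is the principal branch of the logarithm, $\gamma$ is Euler's constant, and $\psi=\Gamma'/\Gamma$ is the digamma function. $\gamma_1=\lim_{n\to\infty}\left(\sum_{j=1}^{n}\frac{\log(j)}{j}-\frac{\log^{2}(n)}{2}\right)$ is the first Stieltjes constant, and for $z\in\mathbb{C}\setminus(-\infty,0]$, $\psi_1(z)=-\gamma_1-\frac{\log(z)}{z}-\sum_{n=1}^{\infty}\left(\frac{\log(n+z)}{n+z}-\frac{\log(n)}{n}\right)$. The integrals are improper (convergent) integrals at $\infty$. *)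

(* Defs.v *)
(* Stdlib reals with Coquelicot. *)
From Stdlib Require Export Reals Factorial.
From Coquelicot Require Export Coquelicot.
Open Scope R_scope.
Open Scope C_scope.

(** Limits of complex sequences and sums of complex series; as for [Lim_seq]
    and [Series], the value is only meaningful in case of convergence. *)
Definition CLim_seq (u : nat -> C) : C :=
  (real (Lim_seq (fun n => Re (u n))), real (Lim_seq (fun n => Im (u n)))).

Definition CSeries (a : nat -> C) : C :=
  (Series (fun n => Re (a n)), Series (fun n => Im (a n))).

Definition Cexp (z : C) : C :=
  (exp (Re z) * cos (Im z), exp (Re z) * sin (Im z))%R.

(** Principal argument, in (-PI, PI]; it is PI on the negative real axis. *)
Definition Carg (z : C) : R :=
  if Rlt_dec (Im z) 0 then (- acos (Re z / Cmod z))%R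
  else acos (Re z / Cmod z).

(** Principal branch. The value at [0] is a dummy finite one. *)
Definition Clog (z : C) : C := (ln (Cmod z), Carg z).

(** Product of [f 0, ..., f n], hence [n + 1] factors. *)
Fixpoint Cprod (f : nat -> C) (n : nat) : C :=
  match n with
  | O => f O
  | S p => Cprod f p * f (S p)
  end.

(** Euler's limit formula
    Gamma(z) = lim n! n^z / (z (z + 1) ... (z + n)),
    valid for every z except the poles 0, -1, -2, ... *)
Definition CGamma (z : C) : C :=
  CLim_seq (fun n =>
    INR (fact n) * Cexp (z * ln (INR n)) / Cprod (fun k => z + INR k) n).

Definition digamma (z : C) : C := C_derive CGamma z / CGamma z.

Definition euler_gamma : R :=
  real (Lim_seq (fun n => sum_n_m (fun j => / INR j) 1 n - ln (INR n)))%R.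

Definition stieltjes1 : R :=
  real (Lim_seq (fun n =>
    sum_n_m (fun j => ln (INR j) / INR j) 1 n - ln (INR n) ^ 2 / 2))%R.

(** [CSeries] starts at index 0, whence the shifted [S k]. *)
Definition psi1 (z : C) : C :=
  - stieltjes1 - Clog z / z
  - CSeries (fun k => Clog (INR (S k) + z) / (INR (S k) + z)
                      - ln (INR (S k)) / INR (S k)).

(** At [u = 0] the factor [u] makes this 0, which is its limit there. *)
Definition integrand (w : C) (m : nat) (u : R) : C :=
  u * cos u * Clog (u / w) / (u ^ 2 + (2 * PI * INR m * w) ^ 2).

(** Complex-valued functions of a real variable are integrated over the real
    normed space underlying [C]. *)
Definition ex_improper_int (f : R -> C) : Prop :=
  @ex_RInt_gen C_R_NormedModule f (at_point 0) (Rbar_locally p_infty).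

Definition improper_int (f : R -> C) : C :=
  @RInt_gen C_R_CompleteNormedModule f (at_point 0) (Rbar_locally p_infty).

(* Main.v *)
(** Put [h z = (Clog z + gamma) / z] and [H x = h (x + i w) + h (x - i w)].
    Since [int_0^oo e^(-p u) log u du = - h p] for [Re p > 0], taking
    [p = x / w + i] and [p = x / w - i] gives
    [H x = - (2 / w) int_0^oo e^(-x u / w) cos u log (u / w) du], and integrating
    this against [cos (2 pi m x)] shows that the [m]-th integral of the theorem is
    [- 1/2 int_0^oo H x cos (2 pi m x) dx]; no continuation in [w] is needed
    because [e^(-x u / w)] decays for every [w] with [Re w > 0]. Poisson summation
    on the half-line then turns the sum over [m] into the Euler-Maclaurin constant
    of [H], which is a combination of [psi1] and [digamma] at [i w] and [- i w]. *)

Require Import Defs.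
From Stdlib Require Import Psatz.
From Stdlib Require Import ssreflect.
Open Scope R_scope.

(** * Calculus of complex-valued functions of a real variable *)

(** The obstacle is conditional convergence on both sides: the integrands decay only like cos u log
    u / u, and [H] only like log x / x, so the double integral cannot be exchanged by absolute
    convergence. Both variables are therefore truncated, [u] at [U] and [x] at an integer [k]. At an
    integer the cosine has completed a period, so stopping there merely multiplies the integrand in
    [u] by 1 - e^(-k u / w). The part over u > U has a closed form in terms of the exponential
    integral, valid down to x = 0 where p = i or p = -i lies on the imaginary axis; it is O(log U /
    U) uniformly in [m] and [k]. Letting [k] and then [U] tend to infinity yields the convergence of
    the moments and of the improper integrals together. The sum over [m] is handled by the same
    device: on [0, k] the error of Poisson summation after M cosines is O(M^(-1/2)) uniformly in
    [k], so that [k] can go to infinity before M. Logarithms are bounded by square roots throughout,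
    which makes all majorants telescope. *)

Lemma C_eq (z z' : C) : Re z = Re z' -> Im z = Im z' -> z = z'.
Proof. destruct z, z'; simpl; intros -> ->; reflexivity. Qed.

Lemma Cmod_sqr (z : C) : Cmod z * Cmod z = Re z * Re z + Im z * Im z.
Proof. generalize (Cmod2_alt z); simpl; intros H; nra. Qed.

Lemma im_le_Cmod (z : C) : Rabs (Im z) <= Cmod z.
Proof. eapply Rle_trans; [apply Rmax_r | apply (Rmax_Cmod z)]. Qed.

Lemma Cmod_le_sum (z : C) : Cmod z <= Rabs (Re z) + Rabs (Im z).
Proof.
  apply Rsqr_incr_0_var; unfold Rsqr.
  - rewrite Cmod_sqr. split_Rabs; nra.
  - generalize (Rabs_pos (Re z)) (Rabs_pos (Im z)); lra.
Qed.

Lemma Cmod_minus_le (z z' : C) : Cmod (z - z') <= Cmod z + Cmod z'.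
Proof. eapply Rle_trans; [apply Cmod_triangle|]. rewrite Cmod_opp. lra. Qed.

Lemma Cmod_minus_ge (z z' : C) : Cmod z - Cmod z' <= Cmod (z + z').
Proof.
  generalize (Cmod_minus_le (z + z') z').
  replace (z + z' - z')%C with z by ring. lra.
Qed.

Lemma Cmod_minus_sym (z z' : C) : Cmod (z - z') = Cmod (z' - z).
Proof. rewrite <- Cmod_opp. f_equal; ring. Qed.

(* Componentwise, because Coquelicot has product and chain rules only for
   scalar-valued functions. *)
Definition cderiv (f : R -> C) (x : R) (l : C) : Prop :=
  is_derive (fun t => Re (f t)) x (Re l) /\
  is_derive (fun t => Im (f t)) x (Im l).

Definition ccont (f : R -> C) (x : R) : Prop :=
  continuous (fun t => Re (f t)) x /\ continuous (fun t => Im (f t)) x.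

Definition is_CInt (f : R -> C) (a b : R) (l : C) : Prop :=
  is_RInt (fun t => Re (f t)) a b (Re l) /\
  is_RInt (fun t => Im (f t)) a b (Im l).

Definition CInt (f : R -> C) (a b : R) : C :=
  (RInt (fun t => Re (f t)) a b, RInt (fun t => Im (f t)) a b).

Lemma cderiv_ext (f g : R -> C) (x : R) (l : C) :
  (forall t, f t = g t) -> cderiv f x l -> cderiv g x l.
Proof.
  intros E [H1 H2]; split; eapply is_derive_ext; eauto;
    intros t; simpl; now rewrite E.
Qed.

Lemma cderiv_ext_loc (f g : R -> C) (x : R) (l : C) :
  locally x (fun t => f t = g t) -> cderiv f x l -> cderiv g x l.
Proof.
  intros E [H1 H2]; split; eapply is_derive_ext_loc; eauto;
    eapply filter_imp; [|exact E| |exact E]; intros t ->; reflexivity.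
Qed.

Lemma cderiv_eq (f : R -> C) (x : R) (l l' : C) :
  l = l' -> cderiv f x l -> cderiv f x l'.
Proof. now intros ->. Qed.

Lemma is_derive_eq (f : R -> R) (x l l' : R) :
  l = l' -> is_derive f x l -> is_derive f x l'.
Proof. now intros ->. Qed.

Lemma is_derive_Rmult (f g : R -> R) (x l m : R) :
  is_derive f x l -> is_derive g x m ->
  is_derive (fun t => f t * g t) x (l * g x + f x * m).
Proof.
  intros Hf Hg; auto_derive.
  - repeat split; eexists; eassumption.
  - rewrite (is_derive_unique _ _ _ Hf) (is_derive_unique _ _ _ Hg); ring.
Qed.

Lemma is_derive_Rplus (f g : R -> R) (x l m : R) :
  is_derive f x l -> is_derive g x m -> is_derive (fun t => f t + g t) x (l + m).
Proof. intros; now apply @is_derive_plus. Qed.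

Lemma is_derive_Ropp (f : R -> R) (x l : R) :
  is_derive f x l -> is_derive (fun t => - f t) x (- l).
Proof. intros; now apply @is_derive_opp. Qed.

Lemma is_derive_Rminus (f g : R -> R) (x l m : R) :
  is_derive f x l -> is_derive g x m -> is_derive (fun t => f t - g t) x (l - m).
Proof. intros; now apply @is_derive_minus. Qed.

Lemma is_derive_Rcomp (f g : R -> R) (x l m : R) :
  is_derive f (g x) l -> is_derive g x m -> is_derive (fun t => f (g t)) x (l * m).
Proof.
  intros Hf Hg. eapply is_derive_eq; [|apply (is_derive_comp f g x _ _ Hf Hg)].
  apply Rmult_comm.
Qed.

Lemma is_derive_cst (c x : R) : is_derive (fun _ : R => c) x 0.
Proof. auto_derive; auto. Qed.

Lemma cderiv_const (c : C) (x : R) : cderiv (fun _ => c) x 0.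
Proof. split; simpl; apply is_derive_cst. Qed.

Lemma cderiv_RtoC (f : R -> R) (x l : R) :
  is_derive f x l -> cderiv (fun t => RtoC (f t)) x l.
Proof. intros H; split; simpl; [exact H | apply is_derive_cst]. Qed.

Lemma cderiv_id (x : R) : cderiv RtoC x 1.
Proof. apply cderiv_RtoC. auto_derive; auto. Qed.

Lemma cderiv_plus (f g : R -> C) (x : R) (l m : C) :
  cderiv f x l -> cderiv g x m -> cderiv (fun t => f t + g t)%C x (l + m).
Proof. intros [H1 H2] [H3 H4]; split; now apply is_derive_Rplus. Qed.

Lemma cderiv_opp (f : R -> C) (x : R) (l : C) :
  cderiv f x l -> cderiv (fun t => - f t)%C x (- l).
Proof. intros [H1 H2]; split; now apply is_derive_Ropp. Qed.

Lemma cderiv_minus (f g : R -> C) (x : R) (l m : C) :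
  cderiv f x l -> cderiv g x m -> cderiv (fun t => f t - g t)%C x (l - m).
Proof. intros; apply cderiv_plus; [|apply cderiv_opp]; assumption. Qed.

Lemma cderiv_mult (f g : R -> C) (x : R) (l m : C) :
  cderiv f x l -> cderiv g x m ->
  cderiv (fun t => f t * g t)%C x (l * g x + f x * m).
Proof.
  intros [H1 H2] [H3 H4]; split.
  - eapply is_derive_eq; [|exact (is_derive_Rminus _ _ _ _ _
      (is_derive_Rmult _ _ _ _ _ H1 H3) (is_derive_Rmult _ _ _ _ _ H2 H4))].
    rewrite re_plus !re_mult; ring.
  - eapply is_derive_eq; [|exact (is_derive_Rplus _ _ _ _ _
      (is_derive_Rmult _ _ _ _ _ H1 H4) (is_derive_Rmult _ _ _ _ _ H2 H3))].
    rewrite im_plus !im_mult; ring.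
Qed.

Lemma cderiv_scal (c : C) (f : R -> C) (x : R) (l : C) :
  cderiv f x l -> cderiv (fun t => c * f t)%C x (c * l).
Proof.
  intros H; eapply cderiv_eq; [|apply cderiv_mult; [apply cderiv_const | exact H]].
  cbv beta; ring.
Qed.

Lemma C_neq_0_sqr (z : C) : z <> 0%C -> 0 < Re z * Re z + Im z * Im z.
Proof. intros H; rewrite <- Cmod_sqr. apply Cmod_gt_0 in H. nra. Qed.

Lemma cderiv_inv (f : R -> C) (x : R) (l : C) :
  f x <> 0%C -> cderiv f x l -> cderiv (fun t => / f t)%C x (- l / (f x * f x)).
Proof.
  intros N [H1 H2]. assert (N' := C_neq_0_sqr _ N).
  set (u := fun t => Re (f t)) in *. set (v := fun t => Im (f t)) in *.
  assert (Nz : u x * (u x * 1) + v x * (v x * 1) <> 0) by (unfold u, v; lra).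
  assert (Nf : fst (f x * f x)%C ^ 2 + snd (f x * f x)%C ^ 2 <> 0).
  { change (fst (f x * f x)%C) with (u x * u x - v x * v x).
    change (snd (f x * f x)%C) with (u x * v x + v x * u x).
    replace (_ + _) with ((u x * (u x * 1) + v x * (v x * 1)) ^ 2) by ring.
    now apply pow_nonzero. }
  split.
  - apply (is_derive_ext (fun t => u t / (u t ^ 2 + v t ^ 2))); [reflexivity|].
    auto_derive; [repeat split; try (eexists; eassumption); assumption|].
    rewrite (is_derive_unique _ _ _ H1) (is_derive_unique _ _ _ H2).
    unfold Cdiv, Cinv, Cmult, Copp, Re, Im in *; simpl in *.
    change (fst (f x)) with (u x) in *; change (snd (f x)) with (v x) in *.
    field; split; intros E0; [apply Nf | apply Nz]; rewrite <- E0; ring.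
  - apply (is_derive_ext (fun t => - v t / (u t ^ 2 + v t ^ 2))); [reflexivity|].
    auto_derive; [repeat split; try (eexists; eassumption); assumption|].
    rewrite (is_derive_unique _ _ _ H1) (is_derive_unique _ _ _ H2).
    unfold Cdiv, Cinv, Cmult, Copp, Re, Im in *; simpl in *.
    change (fst (f x)) with (u x) in *; change (snd (f x)) with (v x) in *.
    field; split; intros E0; [apply Nf | apply Nz]; rewrite <- E0; ring.
Qed.

Lemma cderiv_div (f g : R -> C) (x : R) (l m : C) :
  g x <> 0%C -> cderiv f x l -> cderiv g x m ->
  cderiv (fun t => f t / g t)%C x ((l * g x - f x * m) / (g x * g x)).
Proof.
  intros N Hf Hg; eapply cderiv_eq;
    [|apply cderiv_mult; [exact Hf | apply cderiv_inv; [exact N | exact Hg]]].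
  cbv beta; field; exact N.
Qed.

Lemma cderiv_Cexp (f : R -> C) (x : R) (l : C) :
  cderiv f x l -> cderiv (fun t => Cexp (f t)) x (l * Cexp (f x)).
Proof.
  intros [H1 H2].
  set (u := fun t => Re (f t)) in *. set (v := fun t => Im (f t)) in *.
  split.
  - apply (is_derive_ext (fun t => exp (u t) * cos (v t))); [reflexivity|].
    auto_derive; [repeat split; try (eexists; eassumption)|].
    rewrite (is_derive_unique _ _ _ H1) (is_derive_unique _ _ _ H2).
    rewrite re_mult; simpl; unfold u, v; ring.
  - apply (is_derive_ext (fun t => exp (u t) * sin (v t))); [reflexivity|].
    auto_derive; [repeat split; try (eexists; eassumption)|].
    rewrite (is_derive_unique _ _ _ H1) (is_derive_unique _ _ _ H2).
    rewrite im_mult; simpl; unfold u, v; ring.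
Qed.

Lemma cderiv_ccont (f : R -> C) (x : R) (l : C) : cderiv f x l -> ccont f x.
Proof.
  intros [H1 H2]; split; apply @ex_derive_continuous; eexists; eassumption.
Qed.

Lemma ccont_ex_CInt (f : R -> C) (a b : R) :
  a <= b -> (forall t, a <= t <= b -> ccont f t) -> is_CInt f a b (CInt f a b).
Proof.
  intros Hab H; split; apply @RInt_correct; apply @ex_RInt_continuous;
    intros z; rewrite Rmin_left // Rmax_right // => Hz; now apply H.
Qed.

Lemma is_CInt_unique (f : R -> C) (a b : R) (l : C) :
  is_CInt f a b l -> CInt f a b = l.
Proof. intros [H1 H2]; apply C_eq; simpl; now apply @is_RInt_unique. Qed.

Lemma is_CInt_eq (f : R -> C) (a b : R) (l l' : C) :
  l = l' -> is_CInt f a b l -> is_CInt f a b l'.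
Proof. now intros ->. Qed.

Lemma is_CInt_ext (f g : R -> C) (a b : R) (l : C) :
  a <= b -> (forall t, a < t < b -> f t = g t) -> is_CInt f a b l -> is_CInt g a b l.
Proof.
  intros Hab E [H1 H2]; split; eapply is_RInt_ext; eauto; simpl;
    intros z; rewrite Rmin_left // Rmax_right // => Hz; now rewrite E.
Qed.

Lemma is_CInt_plus (f g : R -> C) (a b : R) (l m : C) :
  is_CInt f a b l -> is_CInt g a b m -> is_CInt (fun t => f t + g t)%C a b (l + m).
Proof. intros [H1 H2] [H3 H4]; split; now apply @is_RInt_plus. Qed.

Lemma is_CInt_opp (f : R -> C) (a b : R) (l : C) :
  is_CInt f a b l -> is_CInt (fun t => - f t)%C a b (- l).
Proof. intros [H1 H2]; split; now apply @is_RInt_opp. Qed.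

Lemma is_CInt_minus (f g : R -> C) (a b : R) (l m : C) :
  is_CInt f a b l -> is_CInt g a b m -> is_CInt (fun t => f t - g t)%C a b (l - m).
Proof. intros; apply is_CInt_plus; [|apply is_CInt_opp]; assumption. Qed.

Lemma is_CInt_scal (c : C) (f : R -> C) (a b : R) (l : C) :
  is_CInt f a b l -> is_CInt (fun t => c * f t)%C a b (c * l).
Proof.
  intros [H1 H2]; split.
  - apply (@is_RInt_minus R_NormedModule); apply @is_RInt_scal; assumption.
  - apply (@is_RInt_plus R_NormedModule); apply @is_RInt_scal; assumption.
Qed.

Lemma is_CInt_Chasles (f : R -> C) (a b c : R) (l m : C) :
  is_CInt f a b l -> is_CInt f b c m -> is_CInt f a c (l + m).
Proof. intros [H1 H2] [H3 H4]; split; eapply @is_RInt_Chasles; eassumption. Qed.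

Lemma is_CInt_FTC (F f : R -> C) (a b : R) :
  a <= b -> (forall t, a <= t <= b -> cderiv F t (f t)) ->
  (forall t, a <= t <= b -> ccont f t) -> is_CInt f a b (F b - F a).
Proof.
  intros Hab HF Hf; split.
  - apply (@is_RInt_derive R_CompleteNormedModule (fun t => Re (F t)));
    intros z; rewrite Rmin_left // Rmax_right // => Hz; [now apply HF | now apply Hf].
  - apply (@is_RInt_derive R_CompleteNormedModule (fun t => Im (F t)));
    intros z; rewrite Rmin_left // Rmax_right // => Hz; [now apply HF | now apply Hf].
Qed.

(** * Mean value inequalities and differentiation under the integral sign *)

Lemma Re_conj_mult_le (z z' : C) : Re z * Re z' + Im z * Im z' <= Cmod z * Cmod z'.
Proof.
  rewrite <- (Cmod_conj z), <- Cmod_mult.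
  eapply Rle_trans; [|apply re_le_Cmod]. eapply Rle_trans; [|apply Rle_abs].
  rewrite re_mult re_conj im_conj; lra.
Qed.

Lemma MVT_le (f df : R -> R) (a b : R) :
  a <= b -> (forall t, a <= t <= b -> is_derive f t (df t)) ->
  (forall t, a <= t <= b -> 0 <= df t) -> f a <= f b.
Proof.
  intros Hab Hd Hp.
  destruct (MVT_gen f a b df) as [c [Hc E]].
  - intros x; rewrite Rmin_left // Rmax_right // => Hx; apply Hd; lra.
  - intros x; rewrite Rmin_left // Rmax_right // => Hx.
    apply continuity_pt_filterlim, @ex_derive_continuous; eexists; now apply Hd.
  - rewrite Rmin_left // Rmax_right // in Hc. generalize (Hp c Hc); nra.
Qed.

(* Projecting [f] on the direction of its total increment reduces this to real
   monotonicity. *)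
Lemma cderiv_increment_le (f f' : R -> C) (b b' : R -> R) (x y : R) :
  x <= y ->
  (forall t, x <= t <= y -> cderiv f t (f' t)) ->
  (forall t, x <= t <= y -> is_derive b t (b' t)) ->
  (forall t, x <= t <= y -> Cmod (f' t) <= b' t) ->
  Cmod (f y - f x) <= b y - b x.
Proof.
  intros Hxy Hf Hb Hle.
  set (d := (f y - f x)%C).
  destruct (Req_dec (Cmod d) 0) as [E|N].
  - assert (H := MVT_le b b' x y Hxy Hb).
    assert (b x <= b y); [|lra].
    apply H; intros t Ht. generalize (Hle t Ht) (Cmod_ge_0 (f' t)); lra.
  - assert (P : 0 < Cmod d) by (generalize (Cmod_ge_0 d); lra).
    pose (phi := fun t => Cmod d * b t - (Re d * Re (f t) + Im d * Im (f t))).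
    assert (H : phi x <= phi y).
    { apply (MVT_le phi (fun t => Cmod d * b' t - (Re d * Re (f' t) + Im d * Im (f' t)))
              x y Hxy).
      - intros t Ht. destruct (Hf t Ht) as [H1 H2].
        apply is_derive_Rminus;
          [apply @is_derive_scal; now apply Hb|apply is_derive_Rplus;
           apply @is_derive_scal; assumption].
      - intros t Ht. generalize (Re_conj_mult_le d (f' t)) (Hle t Ht); nra. }
    unfold phi in H.
    assert (E1 : Re d = Re (f y) - Re (f x)) by reflexivity.
    assert (E2 : Im d = Im (f y) - Im (f x)) by reflexivity.
    assert (E3 := Cmod_sqr d).
    assert (Cmod d * Cmod d <= Cmod d * (b y - b x)).
    { rewrite E3 {2}E1 {2}E2; lra. }
    nra.
Qed.

(** The integrand is paired with the value [l] of its own integral: the scalar inequality under the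
    integral sign gives |l|^2 <= |l| m. *)
Lemma is_CInt_norm_le (f : R -> C) (g : R -> R) (a b : R) (l : C) (m : R) :
  a <= b -> is_CInt f a b l -> is_RInt g a b m ->
  (forall t, a < t < b -> Cmod (f t) <= g t) -> Cmod l <= m.
Proof.
  intros Hab [H1 H2] Hg Hle.
  destruct (Req_dec (Cmod l) 0) as [E|N].
  - rewrite E; apply (is_RInt_ge_0 g a b m Hab Hg).
    intros t Ht; eapply Rle_trans; [apply Cmod_ge_0 | now apply Hle].
  - assert (P : 0 < Cmod l) by (generalize (Cmod_ge_0 l); lra).
    assert (K : Re l * Re l + Im l * Im l <= Cmod l * m).
    { apply (is_RInt_le (fun t => Re l * Re (f t) + Im l * Im (f t))
               (fun t => Cmod l * g t) a b _ _ Hab).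
      - apply (@is_RInt_plus R_NormedModule); apply @is_RInt_scal; assumption.
      - apply @is_RInt_scal; assumption.
      - intros t Ht. generalize (Re_conj_mult_le l (f t)) (Hle t Ht); nra. }
    rewrite <- Cmod_sqr in K. nra.
Qed.

Lemma is_derive_quadratic (f : R -> R) (x l d K : R) :
  0 < d -> (forall h, Rabs h < d -> Rabs (f (x + h) - f x - h * l) <= K * (h * h)) ->
  is_derive f x l.
Proof.
  intros Hd H. apply is_derive_Reals. intros eps Heps.
  assert (HK : 0 < Rabs K + 1) by (generalize (Rabs_pos K); lra).
  assert (Hm : 0 < Rmin d (eps / (Rabs K + 1))).
  { apply Rmin_pos; [assumption|now apply Rdiv_lt_0_compat]. }
  exists (mkposreal _ Hm). intros h Hh0 Hh; simpl in Hh.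
  assert (Hh1 : Rabs h < d) by (eapply Rlt_le_trans; [exact Hh|apply Rmin_l]).
  assert (Hh2 : Rabs h < eps / (Rabs K + 1)) by (eapply Rlt_le_trans; [exact Hh|apply Rmin_r]).
  replace ((f (x + h) - f x) / h - l) with ((f (x + h) - f x - h * l) / h) by (field; assumption).
  unfold Rdiv; rewrite Rabs_mult Rabs_inv.
  assert (Ph : 0 < Rabs h) by now apply Rabs_pos_lt.
  apply (Rmult_lt_reg_r (Rabs h) _ _ Ph).
  rewrite Rmult_assoc Rinv_l; [|lra]. rewrite Rmult_1_r.
  eapply Rle_lt_trans; [apply H; assumption|].
  apply (Rmult_lt_compat_r (Rabs K + 1)) in Hh2; [|assumption].
  replace (eps / (Rabs K + 1) * (Rabs K + 1)) with eps in Hh2 by (field; lra).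
  replace (h * h) with (Rabs h * Rabs h) by (rewrite <- Rabs_mult; apply Rabs_pos_eq; nra).
  generalize (Rle_abs K); nra.
Qed.

(** A quadratic remainder is a form of differentiability that survives integration and passage to
    the limit. Parameter integrals, [Ein] and the limit of [log_gamma_seq] are all differentiated
    through it. *)
Lemma cderiv_quadratic (f : R -> C) (x : R) (l : C) (d K : R) :
  0 < d -> (forall h : R, Rabs h < d -> Cmod (f (x + h) - f x - h * l) <= K * (h * h)) ->
  cderiv f x l.
Proof.
  intros Hd H; split; eapply is_derive_quadratic; try exact Hd; intros h Hh;
    (eapply Rle_trans; [|apply H; exact Hh]).
  - eapply Rle_trans; [|apply re_le_Cmod]. right; f_equal.
    simpl; unfold Re; ring.
  - eapply Rle_trans; [|apply im_le_Cmod]. right; f_equal.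
    simpl; unfold Im; ring.
Qed.

Lemma cderiv_taylor2 (f f' : R -> C) (x h L : R) :
  (forall t, Rabs (t - x) <= Rabs h -> cderiv f t (f' t)) ->
  (forall t, Rabs (t - x) <= Rabs h -> Cmod (f' t - f' x) <= L * Rabs (t - x)) ->
  Cmod (f (x + h) - f x - h * f' x) <= L * (h * h).
Proof.
  intros Hd HL.
  (* The increment of [g] over [0, 1] is the Taylor remainder. Its derivative at [s] is O(s), but
     the factor [s] is bounded by 1, hence the constant [L] and not [L / 2]. *)
  pose (g := fun s : R => (f (x + s * h)%R - s * (h * f' x))%C).
  assert (H : Cmod (g 1 - g 0) <= L * (h * h) * 1 - L * (h * h) * 0).
  { apply (cderiv_increment_le g (fun s => h * (f' (x + s * h)%R - f' x))%C
             (fun s => L * (h * h) * s) (fun s => L * (h * h))); [lra| | |].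
    - intros s Hs.
      assert (Hs' : Rabs (x + s * h - x) <= Rabs h).
      { replace (x + s * h - x) with (s * h) by ring. rewrite Rabs_mult.
        rewrite (Rabs_pos_eq s); [|lra]. generalize (Rabs_pos h); nra. }
      destruct (Hd _ Hs') as [D1 D2].
      apply (cderiv_eq _ _ (h * f' (x + s * h)%R - h * f' x)%C); [ring|].
      apply cderiv_minus.
      + split.
        * apply (is_derive_eq _ _ (Re (f' (x + s * h)) * h)); [rewrite re_scal_l; ring|].
          apply (is_derive_Rcomp (fun t => Re (f t)) (fun s => x + s * h)); [exact D1|].
          auto_derive; auto; ring.
        * apply (is_derive_eq _ _ (Im (f' (x + s * h)) * h)); [rewrite im_scal_l; ring|].
          apply (is_derive_Rcomp (fun t => Im (f t)) (fun s => x + s * h)); [exact D2|].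
          auto_derive; auto; ring.
      + eapply cderiv_eq; [|apply cderiv_mult; [apply cderiv_id | apply cderiv_const]].
        cbv beta; ring.
    - intros s _; auto_derive; auto; ring.
    - intros s Hs.
      assert (Es : Rabs (x + s * h - x) = s * Rabs h).
      { replace (x + s * h - x) with (s * h) by ring. rewrite Rabs_mult.
        rewrite (Rabs_pos_eq s); lra. }
      rewrite Cmod_mult Cmod_R.
      assert (Hs' : Rabs (x + s * h - x) <= Rabs h).
      { rewrite Es. generalize (Rabs_pos h); nra. }
      generalize (HL _ Hs'). rewrite Es. intros HL'.
      replace (L * (h * h)) with (Rabs h * (L * Rabs h)).
      2:{ replace (h * h) with (Rabs h * Rabs h)
            by (rewrite <- Rabs_mult; apply Rabs_pos_eq; nra). ring. }
      apply Rmult_le_compat_l; [apply Rabs_pos|].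
      eapply Rle_trans; [exact HL'|].
      destruct (Req_dec h 0) as [->|Nh]; [rewrite Rabs_R0; lra|].
      assert (0 < Rabs h) by now apply Rabs_pos_lt.
      assert (0 <= L).
      { assert (Hh : Rabs (x + 1 * h - x) <= Rabs h).
        { right; f_equal; ring. }
        generalize (HL _ Hh) (Cmod_ge_0 (f' (x + 1 * h) - f' x)).
        replace (x + 1 * h - x) with h by ring. nra. }
      assert (0 <= L * Rabs h) by nra. nra. }
  unfold g in H.
  replace (x + 1 * h) with (x + h) in H by ring.
  replace (x + 0 * h) with x in H by ring.
  replace (f (x + h)%R - f x - h * f' x)%C
    with (f (x + h)%R - 1 * (h * f' x) - (f x - 0 * (h * f' x)))%C by ring.
  lra.
Qed.

(** The Lipschitz bound on [G] makes the pointwise Taylor remainder of [F] uniform in [x];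
    integrating it leaves a quadratic remainder for the integral. *)
Lemma cderiv_CInt_param (F G : R -> R -> C) (a b U d L : R) :
  a <= b -> 0 < d ->
  (forall V x, Rabs (V - U) < d -> a <= x <= b -> cderiv (fun u => F u x) V (G V x)) ->
  (forall V x, Rabs (V - U) < d -> a <= x <= b ->
     Cmod (G V x - G U x) <= L * Rabs (V - U)) ->
  (forall V x, Rabs (V - U) < d -> a <= x <= b -> ccont (F V) x) ->
  (forall x, a <= x <= b -> ccont (G U) x) ->
  cderiv (fun V => CInt (F V) a b) U (CInt (G U) a b).
Proof.
  intros Hab Hd HF HL HcF HcG.
  apply (cderiv_quadratic _ _ _ d (L * (b - a)) Hd).
  intros h Hh.
  apply (is_CInt_norm_le (fun x => F (U + h)%R x - F U x - h * G U x)%C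
           (fun x => L * (h * h)) a b); [assumption| | |].
  - apply is_CInt_minus; [apply is_CInt_minus|apply is_CInt_scal];
      apply ccont_ex_CInt; try assumption; intros x Hx; apply HcF; try assumption.
    + now replace (U + h - U) with h by ring.
    + now rewrite Rminus_diag Rabs_R0.
  - eapply (is_RInt_ext (fun _ => L * (h * h))); [reflexivity|].
    replace (L * (b - a) * (h * h)) with (scal (b - a) (L * (h * h)))
      by (unfold scal; simpl; unfold mult; simpl; ring).
    apply @is_RInt_const.
  - intros x Hx.
    apply (cderiv_taylor2 (fun u => F u x) (fun u => G u x) U h L);
      intros t Ht; [apply HF | apply HL]; lra.
Qed.

(** * Exponential and principal logarithm *)

Lemma Cexp_plus (a b : C) : Cexp (a + b) = (Cexp a * Cexp b)%C.
Proof.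
  destruct a as [a1 a2], b as [b1 b2]; apply C_eq; simpl;
    rewrite exp_plus ?cos_plus ?sin_plus; ring.
Qed.

Lemma Cexp_RtoC (x : R) : Cexp x = RtoC (exp x).
Proof. apply C_eq; simpl; rewrite ?cos_0 ?sin_0; ring. Qed.

Lemma Cexp_0 : Cexp 0 = 1%C.
Proof. now rewrite Cexp_RtoC exp_0. Qed.

Lemma Cmod_Cexp (z : C) : Cmod (Cexp z) = exp (Re z).
Proof.
  apply Rsqr_inj; [apply Cmod_ge_0|left; apply exp_pos|].
  unfold Rsqr; rewrite Cmod_sqr; simpl. generalize (sin2_cos2 (snd z)); unfold Rsqr, Re, Im; nra.
Qed.

Lemma Cexp_neq_0 (z : C) : Cexp z <> 0%C.
Proof. apply Cmod_gt_0; rewrite Cmod_Cexp; apply exp_pos. Qed.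

Lemma Cexp_opp (z : C) : Cexp (- z) = (/ Cexp z)%C.
Proof.
  assert (E : (Cexp z * Cexp (- z) = 1)%C).
  { rewrite <- Cexp_plus, <- Cexp_0; f_equal; ring. }
  generalize (Cexp_neq_0 z); intros N.
  replace (Cexp (- z)) with (/ Cexp z * (Cexp z * Cexp (- z)))%C by (field; exact N).
  rewrite E; ring.
Qed.

Lemma Carg_ratio_bound (z : C) : z <> 0%C -> -1 <= Re z / Cmod z <= 1.
Proof.
  intros N; apply Cmod_gt_0 in N. generalize (re_le_Cmod z); intros H.
  apply Rabs_le_between in H.
  split; [apply Rle_div_r|apply Rle_div_l]; lra.
Qed.

Lemma cos_Carg (z : C) : z <> 0%C -> cos (Carg z) = Re z / Cmod z.
Proof.
  intros N; assert (B := Carg_ratio_bound z N).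
  unfold Carg; destruct (Rlt_dec _ _); rewrite ?cos_neg; now apply cos_acos.
Qed.

Lemma sin_Carg (z : C) : z <> 0%C -> sin (Carg z) = Im z / Cmod z.
Proof.
  intros N; assert (B := Carg_ratio_bound z N).
  assert (P := N); apply Cmod_gt_0 in P.
  assert (E : sin (acos (Re z / Cmod z)) = Rabs (Im z) / Cmod z).
  { rewrite sin_acos //.
    replace (1 - (Re z / Cmod z)²) with ((Rabs (Im z) / Cmod z)²).
    - apply sqrt_Rsqr. apply Rle_div_r; [lra|]. generalize (Rabs_pos (Im z)); lra.
    - unfold Rsqr. apply (Rmult_eq_reg_r (Cmod z * Cmod z)); [|nra].
      transitivity (Rabs (Im z) * Rabs (Im z)); [field; lra|].
      transitivity (Cmod z * Cmod z - Re z * Re z); [|field; lra].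
      rewrite Cmod_sqr. rewrite <- Rabs_mult, Rabs_pos_eq; nra. }
  unfold Carg; destruct (Rlt_dec _ _); rewrite ?sin_neg E.
  - rewrite Rabs_left //; field; lra.
  - rewrite Rabs_pos_eq //; lra.
Qed.

Lemma Cexp_Clog (z : C) : z <> 0%C -> Cexp (Clog z) = z.
Proof.
  intros N; assert (P := N); apply Cmod_gt_0 in P.
  apply C_eq; simpl; rewrite exp_ln //.
  - rewrite cos_Carg //; field; lra.
  - rewrite sin_Carg //; field; lra.
Qed.

Lemma Carg_neg (z : C) : Im z < 0 -> - PI < Carg z < 0.
Proof.
  intros H. assert (N : z <> 0%C) by (intros ->; simpl in H; lra).
  assert (S := sin_Carg z N). assert (P := N); apply Cmod_gt_0 in P.
  assert (S' : sin (Carg z) < 0).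
  { rewrite S. apply Rlt_div_l; lra. }
  revert S'. unfold Carg; destruct (Rlt_dec _ _) as [L|L]; [|easy].
  assert (B := acos_bound (Re z / Cmod z)). rewrite sin_neg. intros S'.
  split.
  - destruct (Req_dec (acos (Re z / Cmod z)) PI) as [E|E]; [|lra].
    rewrite E sin_PI in S'; lra.
  - destruct (Req_dec (acos (Re z / Cmod z)) 0) as [E|E]; [|lra].
    rewrite E sin_0 in S'; lra.
Qed.

Lemma Carg_bound (z : C) : - PI < Carg z <= PI.
Proof.
  destruct (Rlt_dec (Im z) 0) as [H|H].
  - generalize (Carg_neg z H) PI_RGT_0; lra.
  - unfold Carg; destruct (Rlt_dec _ _); [lra|].
    generalize (acos_bound (Re z / Cmod z)) PI_RGT_0; lra.
Qed.

Lemma Carg_right (z : C) : 0 < Re z -> - (PI / 2) < Carg z < PI / 2.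
Proof.
  intros H. assert (N : z <> 0%C) by (intros ->; simpl in H; lra).
  assert (S := cos_Carg z N). assert (P := N); apply Cmod_gt_0 in P.
  assert (S' : 0 < cos (Carg z)) by (rewrite S; now apply Rdiv_lt_0_compat).
  assert (B := Carg_bound z).
  split.
  - destruct (Rlt_or_le (- (PI / 2)) (Carg z)) as [|L]; [assumption|].
    rewrite <- cos_neg in S'.
    generalize (cos_le_0 (- Carg z)); lra.
  - destruct (Rlt_or_le (Carg z) (PI / 2)) as [|L]; [assumption|].
    generalize (cos_le_0 (Carg z)); lra.
Qed.

Lemma Carg_right0 (z : C) : 0 <= Re z -> z <> 0%C -> - (PI / 2) <= Carg z <= PI / 2.
Proof.
  intros H N.
  assert (S := cos_Carg z N). assert (P := N); apply Cmod_gt_0 in P.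
  assert (S' : 0 <= cos (Carg z)).
  { rewrite S; apply Rle_div_r; lra. }
  assert (B := Carg_bound z).
  split.
  - destruct (Rle_or_lt (- (PI / 2)) (Carg z)) as [|L]; [assumption|].
    rewrite <- cos_neg in S'.
    generalize (cos_lt_0 (- Carg z)); lra.
  - destruct (Rle_or_lt (Carg z) (PI / 2)) as [|L]; [assumption|].
    generalize (cos_lt_0 (Carg z)); lra.
Qed.

(** The hypotheses give cos (a - b) = 1, hence sin ((a - b) / 2) = 0, and the half-difference lies
    strictly between -PI and PI, where the sine vanishes only at 0. *)
Lemma angle_unique (a b : R) :
  - PI < a <= PI -> - PI < b <= PI -> cos a = cos b -> sin a = sin b -> a = b.
Proof.
  intros Ha Hb Hc Hs.
  assert (C1 : cos (a - b) = 1).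
  { rewrite cos_minus Hc Hs. generalize (sin2_cos2 b); unfold Rsqr; lra. }
  assert (S2 : sin ((a - b) / 2) = 0).
  { replace (a - b) with (2 * ((a - b) / 2)) in C1 by field.
    rewrite cos_2a_sin in C1. nra. }
  destruct (Rtotal_order ((a - b) / 2) 0) as [L|[E|L]]; [|lra|].
  - assert (0 < sin (- ((a - b) / 2))) by (apply sin_gt_0; lra).
    rewrite sin_neg in H; lra.
  - assert (0 < sin ((a - b) / 2)) by (apply sin_gt_0; lra). lra.
Qed.

(** The basic identities for [Clog] are derived from this characterization, which reduces each
    question of branches to a bound on an imaginary part. *)
Lemma Clog_unique (v z : C) : Cexp v = z -> - PI < Im v <= PI -> Clog z = v.
Proof.
  intros E B. assert (N : z <> 0%C) by (rewrite <- E; apply Cexp_neq_0).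
  assert (M : Cmod z = exp (Re v)) by (rewrite <- E; apply Cmod_Cexp).
  assert (P := exp_pos (Re v)).
  apply C_eq; simpl.
  - rewrite M; apply ln_exp.
  - apply angle_unique; [apply Carg_bound|exact B| |].
    + rewrite cos_Carg // M -E; simpl; unfold Re, Im; field; unfold Re in P; lra.
    + rewrite sin_Carg // M -E; simpl; unfold Re, Im; field; unfold Re in P; lra.
Qed.

Lemma Clog_mult (a b : C) : a <> 0%C -> b <> 0%C -> - PI < Carg a + Carg b <= PI ->
  Clog (a * b) = (Clog a + Clog b)%C.
Proof.
  intros Na Nb B. apply Clog_unique; [|exact B].
  rewrite Cexp_plus !Cexp_Clog //.
Qed.

Lemma Clog_RtoC (x : R) : 0 < x -> Clog x = RtoC (ln x).
Proof.
  intros H; apply Clog_unique.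
  - now rewrite Cexp_RtoC exp_ln.
  - simpl; generalize PI_RGT_0; lra.
Qed.

Lemma Clog_inv (z : C) : 0 < Re z -> Clog (/ z) = (- Clog z)%C.
Proof.
  intros H. assert (N : z <> 0%C) by (intros ->; simpl in H; lra).
  apply Clog_unique.
  - rewrite Cexp_opp Cexp_Clog //.
  - simpl; generalize (Carg_right z H) PI_RGT_0; lra.
Qed.

Lemma Cmod_Clog (z : C) : Cmod (Clog z) <= Rabs (ln (Cmod z)) + PI.
Proof.
  eapply Rle_trans; [apply Cmod_le_sum|]. simpl.
  generalize (Carg_bound z) PI_RGT_0; intros. apply Rplus_le_compat_l, Rabs_le; lra.
Qed.

(** The plane cut along (-oo, 0], the domain on which [Clog] is differentiable. *)
Definition slit (z : C) : Prop := 0 < Re z \/ Im z <> 0.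

Lemma slit_neq_0 (z : C) : slit z -> z <> 0%C.
Proof. intros [H|H] ->; simpl in H; lra. Qed.

(** [Carg] is defined by cases through [acos], whose derivative blows up where the positive real
    axis is crossed. On the right half-plane the arctangent of the slope is a smooth expression for
    it. *)
Lemma Clog_atan (z : C) : 0 < Re z -> Clog z = (ln (Cmod z), atan (Im z / Re z)).
Proof.
  intros H. assert (N : z <> 0%C) by (intros ->; simpl in H; lra).
  assert (P := N); apply Cmod_gt_0 in P.
  assert (E : sqrt (1 + (Im z / Re z)²) = Cmod z / Re z).
  { replace (1 + (Im z / Re z)²) with ((Cmod z / Re z)²).
    - apply sqrt_Rsqr. left; now apply Rdiv_lt_0_compat.
    - unfold Rsqr. transitivity ((Cmod z * Cmod z) / (Re z * Re z)); [field; lra|].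
      rewrite Cmod_sqr; field; lra. }
  apply Clog_unique; simpl.
  - apply C_eq; simpl; rewrite exp_ln // ?cos_atan ?sin_atan E; field;
      unfold Re in *; lra.
  - generalize (atan_bound (Im z / Re z)) PI_RGT_0; simpl; lra.
Qed.

Lemma Ci_sqr : (Ci * Ci)%C = (- (1))%C.
Proof. apply C_eq; simpl; ring. Qed.

(** A right-angle rotation carries the upper half-plane to the right one. With the mirror lemma
    below it extends differentiability from the right half-plane to [slit], and it evaluates [Clog]
    at i w and - i w at the end. *)
Lemma Clog_rot_up (z : C) : 0 < Im z -> Clog z = (Clog (- Ci * z) + (0, (PI / 2)%R))%C.
Proof.
  intros H. assert (P := PI_RGT_0).
  assert (H' : 0 < Re (- Ci * z)) by (rewrite re_mult; simpl; lra).
  assert (N : (- Ci * z)%C <> 0%C) by exact (slit_neq_0 _ (or_introl H')).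
  apply Clog_unique.
  - rewrite Cexp_plus Cexp_Clog //.
    replace (Cexp (0, (PI / 2)%R)) with Ci
      by (apply C_eq; simpl; rewrite exp_0 ?cos_PI2 ?sin_PI2; ring).
    transitivity (- (Ci * Ci) * z)%C; [ring|rewrite Ci_sqr; ring].
  - simpl. generalize (Carg_right _ H'); unfold Cmult, Copp, Ci; simpl; lra.
Qed.

Lemma Clog_rot_down (z : C) : Im z < 0 -> Clog z = (Clog (Ci * z) + (0, (- (PI / 2))%R))%C.
Proof.
  intros H. assert (P := PI_RGT_0).
  assert (H' : 0 < Re (Ci * z)) by (rewrite re_mult; simpl; lra).
  assert (N : (Ci * z)%C <> 0%C) by exact (slit_neq_0 _ (or_introl H')).
  apply Clog_unique.
  - rewrite Cexp_plus Cexp_Clog //.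
    replace (Cexp (0, (- (PI / 2))%R)) with (- Ci)%C
      by (apply C_eq; simpl; rewrite exp_0 ?cos_neg ?sin_neg ?cos_PI2 ?sin_PI2; ring).
    transitivity (- (Ci * Ci) * z)%C; [ring|rewrite Ci_sqr; ring].
  - simpl. generalize (Carg_right _ H'); unfold Cmult, Copp, Ci; simpl; lra.
Qed.

Lemma locally_pos (f : R -> R) (x l : R) :
  is_derive f x l -> 0 < f x -> locally x (fun t => 0 < f t).
Proof.
  intros Hd Hp.
  assert (K : continuous f x) by (apply @ex_derive_continuous; eexists; eassumption).
  apply (K (fun y => 0 < y)). now apply (open_gt 0).
Qed.

Lemma cderiv_Clog_right (f : R -> C) (x : R) (l : C) :
  0 < Re (f x) -> cderiv f x l -> cderiv (fun t => Clog (f t)) x (l / f x).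
Proof.
  intros P D. destruct (D) as [H1 H2].
  assert (L := locally_pos _ _ _ H1 P).
  apply (cderiv_ext_loc (fun t => (ln (Cmod (f t)), atan (Im (f t) / Re (f t))))).
  { eapply filter_imp; [|exact L]. intros t Ht; cbv beta. symmetry; now apply Clog_atan. }
  assert (N : Re (f x) * Re (f x) + Im (f x) * Im (f x) <> 0) by nra.
  assert (S0 : 0 < Re (f x) * (Re (f x) * 1) + Im (f x) * (Im (f x) * 1)) by nra.
  set (u := fun t => Re (f t)) in *. set (v := fun t => Im (f t)) in *.
  change (Re (f x)) with (u x) in *. change (Im (f x)) with (v x) in *.
  split.
  - apply (is_derive_ext (fun t => ln (sqrt (u t ^ 2 + v t ^ 2)))); [reflexivity|].
    auto_derive.
    + repeat split; try (eexists; eassumption); [exact S0|].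
      apply sqrt_lt_R0; exact S0.
    + rewrite (is_derive_unique _ _ _ H1) (is_derive_unique _ _ _ H2).
      assert (Q : sqrt (u x * (u x * 1) + v x * (v x * 1)) * sqrt (u x * (u x * 1) + v x * (v x *
        1)) = u x * (u x * 1) + v x * (v x * 1)) by (apply sqrt_sqrt; lra).
      assert (Q0 : 0 < sqrt (u x * (u x * 1) + v x * (v x * 1))) by now apply sqrt_lt_R0.
      unfold Cdiv; rewrite re_mult; unfold Cinv; simpl Re; simpl Im.
      change (fst (f x)) with (u x); change (snd (f x)) with (v x).
      match goal with |- ?a = ?b => replace a with ((2 * u x * Re l + 2 * v x * Im l) / (2 * (sqrt
        (u x * (u x * 1) + v x * (v x * 1)) * sqrt (u x * (u x * 1) + v x * (v x * 1))))) by
        (simpl; unfold Re, Im; field; lra) end.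
      rewrite Q. simpl; unfold Re, Im. field. intros E0; lra.
  - apply (is_derive_ext (fun t => atan (v t / u t))); [reflexivity|].
    auto_derive.
    + repeat split; try (eexists; eassumption); lra.
    + rewrite (is_derive_unique _ _ _ H1) (is_derive_unique _ _ _ H2).
      unfold Cdiv; rewrite im_mult; unfold Cinv; simpl Re; simpl Im.
      change (fst (f x)) with (u x); change (snd (f x)) with (v x).
      simpl; unfold Re, Im. field. repeat split; intros E0; nra.
Qed.

Lemma cderiv_Clog (f : R -> C) (x : R) (l : C) :
  slit (f x) -> cderiv f x l -> cderiv (fun t => Clog (f t)) x (l / f x).
Proof.
  intros S D. assert (N := slit_neq_0 _ S).
  assert (NCi := Ci_nz).
  destruct S as [P|I]; [now apply cderiv_Clog_right|].
  destruct (Rlt_or_le (Im (f x)) 0) as [H|H].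
  - assert (L : locally x (fun t => 0 < - Im (f t))).
    { eapply locally_pos; [apply is_derive_Ropp, (proj2 D)|lra]. }
    apply (cderiv_ext_loc (fun t => (Clog (Ci * f t) + (0, (- (PI / 2))%R))%C)).
    { eapply filter_imp; [|exact L]. intros t Ht; cbv beta in *.
      symmetry; apply Clog_rot_down; lra. }
    eapply cderiv_eq; [|apply cderiv_plus; [apply cderiv_Clog_right;
      [rewrite re_mult; simpl; lra|apply cderiv_scal; exact D]
      |apply cderiv_const]].
    cbv beta; field; auto.
  - assert (L : locally x (fun t => 0 < Im (f t))).
    { eapply locally_pos; [apply (proj2 D)|lra]. }
    apply (cderiv_ext_loc (fun t => (Clog (- Ci * f t) + (0, (PI / 2)%R))%C)).
    { eapply filter_imp; [|exact L]. intros t Ht; cbv beta in *.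
      symmetry; apply Clog_rot_up; lra. }
    eapply cderiv_eq; [|apply cderiv_plus; [apply cderiv_Clog_right;
      [rewrite re_mult; simpl; lra|apply cderiv_scal; exact D]
      |apply cderiv_const]].
    cbv beta; field; split; auto.
Qed.

(** * Limits and finite sums *)

(** Encoded through the modulus of the error, so that limits are obtained by squeezing under
    explicit real bounds. *)
Definition clim (u : nat -> C) (l : C) : Prop :=
  is_lim_seq (fun n => Cmod (u n - l)) 0.

Lemma is_lim_seq_squeeze_0 (u v : nat -> R) :
  (forall n, 0 <= u n <= v n) -> is_lim_seq v 0 -> is_lim_seq u 0.
Proof.
  intros H Hv. apply (is_lim_seq_le_le (fun _ => 0) _ v); auto.
  apply is_lim_seq_const.
Qed.

Lemma clim_squeeze (u : nat -> C) (l : C) (v : nat -> R) :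
  (forall n, Cmod (u n - l) <= v n) -> is_lim_seq v 0 -> clim u l.
Proof.
  intros H Hv; apply (is_lim_seq_squeeze_0 _ v); auto.
  intros n; split; [apply Cmod_ge_0 | apply H].
Qed.

Lemma clim_ext (u v : nat -> C) (l : C) :
  (forall n, u n = v n) -> clim u l -> clim v l.
Proof.
  intros E; apply is_lim_seq_ext; intros n; now rewrite E.
Qed.

Lemma clim_eq (u : nat -> C) (l l' : C) : l = l' -> clim u l -> clim u l'.
Proof. now intros ->. Qed.

Lemma is_lim_seq_plus_0 (u v : nat -> R) :
  is_lim_seq u 0 -> is_lim_seq v 0 -> is_lim_seq (fun n => u n + v n) 0.
Proof.
  intros Hu Hv. generalize (is_lim_seq_plus' _ _ _ _ Hu Hv). now rewrite Rplus_0_r.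
Qed.

Lemma is_lim_seq_scal_0 (c : R) (u : nat -> R) :
  is_lim_seq u 0 -> is_lim_seq (fun n => c * u n) 0.
Proof.
  intros Hu. generalize (is_lim_seq_scal_l _ c _ Hu). simpl. now rewrite Rmult_0_r.
Qed.

Lemma clim_const (c : C) : clim (fun _ => c) c.
Proof.
  apply (is_lim_seq_ext (fun _ => 0)); [|apply is_lim_seq_const].
  intros _. replace (c - c)%C with (RtoC 0) by ring. now rewrite Cmod_0.
Qed.

Lemma clim_plus (u v : nat -> C) (l m : C) :
  clim u l -> clim v m -> clim (fun n => u n + v n)%C (l + m).
Proof.
  intros Hu Hv. eapply clim_squeeze; [|apply (is_lim_seq_plus_0 _ _ Hu Hv)].
  intros n; cbv beta. eapply Rle_trans; [|apply Cmod_triangle].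
  right; f_equal; ring.
Qed.

Lemma clim_scal (c : C) (u : nat -> C) (l : C) :
  clim u l -> clim (fun n => c * u n)%C (c * l).
Proof.
  intros Hu. eapply clim_squeeze; [|apply (is_lim_seq_scal_0 (Cmod c) _ Hu)].
  intros n; cbv beta. rewrite <- Cmod_mult. right; f_equal; ring.
Qed.

Lemma clim_opp (u : nat -> C) (l : C) : clim u l -> clim (fun n => - u n)%C (- l).
Proof.
  intros Hu. eapply clim_eq; [|eapply clim_ext; [|apply (clim_scal (- (1)) _ _ Hu)]].
  - ring.
  - intros n; cbv beta; ring.
Qed.

Lemma clim_minus (u v : nat -> C) (l m : C) :
  clim u l -> clim v m -> clim (fun n => u n - v n)%C (l - m).
Proof. intros; apply clim_plus; [|apply clim_opp]; assumption. Qed.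

Lemma clim_Re (u : nat -> C) (l : C) : clim u l -> is_lim_seq (fun n => Re (u n)) (Re l).
Proof.
  intros H. apply (is_lim_seq_ext (fun n => (Re (u n - l)%C) + Re l)).
  - intros n; simpl; unfold Re; ring.
  - replace (Finite (Re l)) with (Finite (0 + Re l)) by (f_equal; ring).
    apply is_lim_seq_plus'; [|apply is_lim_seq_const].
    apply is_lim_seq_abs_0, (is_lim_seq_squeeze_0 _ _ (fun n => conj (Rabs_pos _) (re_le_Cmod _))
      H).
Qed.

Lemma clim_Im (u : nat -> C) (l : C) : clim u l -> is_lim_seq (fun n => Im (u n)) (Im l).
Proof.
  intros H. apply (is_lim_seq_ext (fun n => (Im (u n - l)%C) + Im l)).
  - intros n; simpl; unfold Im; ring.
  - replace (Finite (Im l)) with (Finite (0 + Im l)) by (f_equal; ring).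
    apply is_lim_seq_plus'; [|apply is_lim_seq_const].
    apply is_lim_seq_abs_0, (is_lim_seq_squeeze_0 _ _ (fun n => conj (Rabs_pos _) (im_le_Cmod _))
      H).
Qed.

Lemma clim_Re_Im (u : nat -> C) (l : C) :
  is_lim_seq (fun n => Re (u n)) (Re l) -> is_lim_seq (fun n => Im (u n)) (Im l) ->
  clim u l.
Proof.
  intros H1 H2.
  assert (K : forall (v : nat -> R) (a : R), is_lim_seq v a -> is_lim_seq (fun n => Rabs (v n -
    a)) 0).
  { intros v a Hv. apply -> is_lim_seq_abs_0.
    replace (Finite 0) with (Finite (a - a)) by (f_equal; ring).
    apply is_lim_seq_minus'; [exact Hv|apply is_lim_seq_const]. }
  eapply clim_squeeze; [|apply (is_lim_seq_plus_0 _ _ (K _ _ H1) (K _ _ H2))].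
  intros n. apply (Cmod_le_sum (u n - l)).
Qed.

Lemma clim_CLim_seq (u : nat -> C) (l : C) : clim u l -> CLim_seq u = l.
Proof.
  intros H; apply C_eq; unfold CLim_seq; simpl.
  - now rewrite (is_lim_seq_unique _ _ (clim_Re _ _ H)).
  - now rewrite (is_lim_seq_unique _ _ (clim_Im _ _ H)).
Qed.

Lemma clim_shift (u : nat -> C) (l : C) : clim u l -> clim (fun n => u (S n)) l.
Proof. exact (proj1 (is_lim_seq_incr_1 (fun n => Cmod (u n - l)) 0)). Qed.

Lemma clim_unshift (u : nat -> C) (l : C) : clim (fun n => u (S n)) l -> clim u l.
Proof. exact (proj2 (is_lim_seq_incr_1 (fun n => Cmod (u n - l)) 0)). Qed.

Lemma clim_Cmod_le (u : nat -> C) (l : C) (B : R) :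
  clim u l -> (forall n, Cmod (u n) <= B) -> Cmod l <= B.
Proof.
  intros H HB.
  assert (K : Rbar_le (Cmod l) (B + 0)).
  { eapply (is_lim_seq_le (fun _ => Cmod l) (fun n => B + Cmod (u n - l))).
    - intros n. generalize (HB n) (Cmod_minus_le (u n) (u n - l)).
      replace (u n - (u n - l))%C with l by ring. lra.
    - apply is_lim_seq_const.
    - apply is_lim_seq_plus'; [apply is_lim_seq_const|exact H]. }
  simpl in K; lra.
Qed.

Lemma clim_Cexp (u : nat -> C) (l : C) : clim u l -> clim (fun n => Cexp (u n)) (Cexp l).
Proof.
  intros Hu.
  assert (Ru := clim_Re _ _ Hu). assert (Iu := clim_Im _ _ Hu).
  assert (E : is_lim_seq (fun n => exp (Re (u n))) (exp (Re l))).
  { apply is_lim_seq_continuous; [apply derivable_continuous_pt, derivable_pt_exp|exact Ru]. }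
  apply clim_Re_Im; simpl; apply is_lim_seq_mult'; try exact E;
    apply is_lim_seq_continuous; try exact Iu.
  - apply continuity_cos.
  - apply continuity_sin.
Qed.

Lemma clim_cauchy (u : nat -> C) :
  (forall e : posreal, exists N, forall n p, (N <= n)%nat -> (N <= p)%nat -> Cmod (u n - u p) < e)
    ->
  exists l, clim u l.
Proof.
  intros Hu.
  assert (K : forall v : nat -> R, (forall n p, Rabs (v n - v p) <= Cmod (u n - u p)) ->
                ex_finite_lim_seq v).
  { intros v Hv. apply ex_lim_seq_cauchy_corr. intros e. destruct (Hu e) as [N HN].
    exists N. intros n p Hn Hp. eapply Rle_lt_trans; [apply Hv|now apply HN]. }
  destruct (K (fun n => Re (u n))) as [l1 H1]; [intros n p; apply (re_le_Cmod (u n - u p))|].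
  destruct (K (fun n => Im (u n))) as [l2 H2]; [intros n p; apply (im_le_Cmod (u n - u p))|].
  exists (l1, l2). now apply clim_Re_Im.
Qed.

(** Summing the hypothesis gives |u m - u n| <= b n - b m for n <= m, which makes the sequence
    Cauchy. It replaces comparison with a convergent series, the majorants below being written as
    differences. *)
Lemma clim_telescope (u : nat -> C) (b : nat -> R) :
  is_lim_seq b 0 -> (forall n, 0 <= b n) ->
  (forall n, Cmod (u (S n) - u n) <= b n - b (S n)) -> exists l, clim u l.
Proof.
  intros Hb Pb Hu.
  assert (K : forall n m, (n <= m)%nat -> Cmod (u m - u n) <= b n - b m).
  { intros n m Hnm. induction Hnm as [|m Hnm IH].
    - replace (u n - u n)%C with (RtoC 0) by ring. rewrite Cmod_0; lra.
    - replace (u (S m) - u n)%C with ((u (S m) - u m) + (u m - u n))%C by ring.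
      generalize (Cmod_triangle (u (S m) - u m) (u m - u n)) (Hu m); lra. }
  apply clim_cauchy. intros e.
  apply is_lim_seq_spec in Hb. destruct (Hb (pos_div_2 e)) as [N HN].
  exists N. intros n p Hn Hp.
  replace (u n - u p)%C with ((u n - u N) - (u p - u N))%C by ring.
  eapply Rle_lt_trans; [apply Cmod_minus_le|].
  generalize (K N n Hn) (K N p Hp) (Pb n) (Pb p) (HN N (le_n _)) (Rle_abs (b N - 0)). simpl. lra.
Qed.

(* [n] terms, whereas [sum_n f n] has [n + 1]. *)
Fixpoint csum (f : nat -> C) (n : nat) : C :=
  match n with O => 0%C | S p => (csum f p + f p)%C end.

Lemma csum_ext (f g : nat -> C) (n : nat) :
  (forall j, (j < n)%nat -> f j = g j) -> csum f n = csum g n.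
Proof.
  induction n as [|n IH]; intros H; [reflexivity|].
  simpl. rewrite IH; [|intros; apply H; lia]. rewrite H //.
Qed.

Lemma csum_plus (f g : nat -> C) (n : nat) :
  csum (fun j => f j + g j)%C n = (csum f n + csum g n)%C.
Proof. induction n as [|n IH]; simpl; [ring|rewrite IH; ring]. Qed.

Lemma csum_scal (c : C) (f : nat -> C) (n : nat) :
  csum (fun j => c * f j)%C n = (c * csum f n)%C.
Proof. induction n as [|n IH]; simpl; [ring|rewrite IH; ring]. Qed.

Lemma csum_minus (f g : nat -> C) (n : nat) :
  csum (fun j => f j - g j)%C n = (csum f n - csum g n)%C.
Proof. induction n as [|n IH]; simpl; [ring|rewrite IH; ring]. Qed.

Lemma csum_S_l (f : nat -> C) (n : nat) :
  csum f (S n) = (f O + csum (fun j => f (S j)) n)%C.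
Proof.
  induction n as [|n IH]; [simpl; ring|].
  change (csum f (S (S n))) with (csum f (S n) + f (S n))%C. rewrite IH. simpl; ring.
Qed.

Lemma csum_norm_le (f : nat -> C) (b : nat -> R) (n : nat) :
  (forall j, (j < n)%nat -> Cmod (f j) <= b j - b (S j)) -> Cmod (csum f n) <= b O - b n.
Proof.
  induction n as [|n IH]; intros H; simpl.
  - rewrite Cmod_0; lra.
  - eapply Rle_trans; [apply Cmod_triangle|].
    assert (IH' : Cmod (csum f n) <= b O - b n) by (apply IH; intros; apply H; lia).
    generalize (H n (Nat.lt_succ_diag_r n)); lra.
Qed.

Lemma csum_clim (f : nat -> nat -> C) (l : nat -> C) (M : nat) :
  (forall j, (j < M)%nat -> clim (f j) (l j)) ->
  clim (fun k => csum (fun j => f j k) M) (csum l M).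
Proof.
  induction M as [|M IH]; intros H; simpl; [apply clim_const|].
  apply clim_plus; [apply IH; intros; apply H; lia|apply H; lia].
Qed.

Lemma Re_csum (f : nat -> C) (n : nat) : Re (csum f (S n)) = sum_n (fun j => Re (f j)) n.
Proof.
  induction n as [|n IH].
  - rewrite sum_O; simpl. unfold Re; ring.
  - rewrite sum_Sn -IH. change (csum f (S (S n))) with (csum f (S n) + f (S n))%C.
    now rewrite re_plus.
Qed.

Lemma Im_csum (f : nat -> C) (n : nat) : Im (csum f (S n)) = sum_n (fun j => Im (f j)) n.
Proof.
  induction n as [|n IH].
  - rewrite sum_O; simpl. unfold Im; ring.
  - rewrite sum_Sn -IH. change (csum f (S (S n))) with (csum f (S n) + f (S n))%C.
    now rewrite im_plus.
Qed.

Lemma csum_sum_n (f : nat -> C) (n : nat) :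
  csum f (S n) = @sum_n C_NormedModule f n.
Proof.
  induction n as [|n IH].
  - rewrite sum_O; simpl; ring.
  - rewrite sum_Sn -IH. reflexivity.
Qed.

Lemma clim_CSeries (f : nat -> C) (l : C) : clim (csum f) l -> CSeries f = l.
Proof.
  intros H; apply clim_shift in H. apply C_eq; unfold CSeries; simpl.
  - apply is_series_unique. exact (is_lim_seq_ext _ _ _ (Re_csum f) (clim_Re _ _ H)).
  - apply is_series_unique. exact (is_lim_seq_ext _ _ _ (Im_csum f) (clim_Im _ _ H)).
Qed.

Lemma clim_ex_series (f : nat -> C) (l : C) :
  clim (csum f) l -> @ex_series C_AbsRing C_NormedModule f.
Proof.
  intros H; apply clim_shift in H. exists l.
  intros P [eps HP].
  apply is_lim_seq_spec in H. destruct (H eps) as [N HN].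
  exists N. intros n Hn. apply HP. rewrite -csum_sum_n.
  apply C_NormedModule_mixin_compat1. generalize (HN n Hn).
  rewrite Rminus_0_r Rabs_pos_eq; [|apply Cmod_ge_0]. exact (fun x => x).
Qed.

(** * Sums compared with a primitive *)

(** The rate x^(-3/2) is what remains of log x / x^2 once the logarithm is bounded by a square root;
    here it receives a telescoping majorant. *)
Lemma inv_sqrt_telescope (x : R) : 1 <= x ->
  / (x * sqrt x) <= 4 / sqrt x - 4 / sqrt (x + 1).
Proof.
  intros Hx.
  assert (Sx : sqrt x * sqrt x = x) by (apply sqrt_sqrt; lra).
  assert (Sy : sqrt (x + 1) * sqrt (x + 1) = x + 1) by (apply sqrt_sqrt; lra).
  assert (Px : 0 < sqrt x) by (apply sqrt_lt_R0; lra).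
  assert (Py : 0 < sqrt (x + 1)) by (apply sqrt_lt_R0; lra).
  set (a := sqrt x) in *. set (b := sqrt (x + 1)) in *. rewrite -Sx.
  (* The right-hand side equals 4 / (a b (a + b)). This bound gives a b (a + b) <= (15 / 4) a^3, so
     the constant 4 suffices. *)
  assert (Hb : b <= 3 / 2 * a) by nra.
  assert (E : (b - a) * (b + a) = 1) by nra.
  assert (a <= b) by nra.
  replace (4 / a - 4 / b) with (4 * (b - a) / (a * b)) by (field; lra).
  apply Rle_div_r; [nra|].
  replace (/ (a * a * a) * (a * b)) with (b / (a * a)) by (field; lra).
  apply Rle_div_l; [nra|].
  assert (4 * (a * a) >= b * (b + a)) by nra.
  apply (Rmult_le_reg_r (b + a)); [lra|]. nra.
Qed.

Lemma is_lim_seq_inv_sqrt (K : R) : is_lim_seq (fun n => K / sqrt (INR n + 1)) 0.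
Proof.
  apply (is_lim_seq_ext (fun n => K * / sqrt (INR n + 1))); [reflexivity|].
  apply is_lim_seq_scal_0.
  apply (is_lim_seq_inv _ p_infty); [|easy].
  apply (filterlim_comp _ _ _ (fun n => INR n + 1) sqrt eventually (Rbar_locally p_infty)).
  - eapply is_lim_seq_plus; [apply is_lim_seq_INR|apply is_lim_seq_const|reflexivity].
  - apply filterlim_sqrt_p.
Qed.

(** Freezes the decay rate on a unit interval, with a constant that telescopes in [n]. Both the
    comparison of sums with primitives and Poisson summation consume the decay in this form. *)
Lemma decay_on_period (f : R -> C) (K : R) (n : nat) : 0 <= K ->
  (forall t, 0 <= t -> Cmod (f t) <= K / ((t + 1) * sqrt (t + 1))) ->
  exists B, 0 <= B /\ (forall t, INR n <= t <= INR n + 1 -> Cmod (f t) <= B) /\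
    B <= K * (4 / sqrt (INR n + 1) - 4 / sqrt (INR n + 1 + 1)).
Proof.
  intros HK Hb. assert (Pn := pos_INR n).
  exists (K * / ((INR n + 1) * sqrt (INR n + 1))). split; [|split].
  - apply Rmult_le_pos; [exact HK|].
    left; apply Rinv_0_lt_compat, Rmult_lt_0_compat; [lra|apply sqrt_lt_R0; lra].
  - intros t Ht. eapply Rle_trans; [apply Hb; lra|].
    apply Rmult_le_compat_l; [assumption|].
    apply Rinv_le_contravar; [apply Rmult_lt_0_compat; [lra|apply sqrt_lt_R0; lra]|].
    apply Rmult_le_compat; [lra|apply sqrt_pos|lra|apply sqrt_le_1; lra].
  - apply Rmult_le_compat_l; [exact HK|]. apply inv_sqrt_telescope; lra.
Qed.

(** Euler-Maclaurin at lowest order: each unit interval contributes f(n) minus the integral of f,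
    which is at most the supremum of |f'| there. *)
Lemma csum_minus_primitive_converges (F f f' : R -> C) (K : R) :
  0 <= K ->
  (forall t, 0 <= t -> cderiv F t (f t)) ->
  (forall t, 0 <= t -> cderiv f t (f' t)) ->
  (forall t, 0 <= t -> Cmod (f' t) <= K / ((t + 1) * sqrt (t + 1))) ->
  exists l, clim (fun n => csum (fun j => f (INR j)) n - F (INR n))%C l.
Proof.
  intros HK HF Hf Hb.
  apply (clim_telescope _ (fun n => (4 * K) / sqrt (INR n + 1))).
  - apply is_lim_seq_inv_sqrt.
  - intros n. assert (0 < sqrt (INR n + 1)) by (apply sqrt_lt_R0; generalize (pos_INR n); lra).
    apply Rle_div_r; lra.
  - intros n. assert (Pn := pos_INR n).
    destruct (decay_on_period f' K n HK Hb) as [B [PB [D Q]]].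
    (* The increment of [g] over [n, n + 1] is exactly that contribution, and its derivative f(n) -
       f(t) is controlled by a second use of the mean value inequality. *)
    pose (g := fun t : R => (t * f (INR n) - F t)%C).
    assert (H : Cmod (g (INR n + 1) - g (INR n)) <= B * (INR n + 1) - B * INR n).
    { apply (cderiv_increment_le g (fun t => f (INR n) - f t)%C (fun t => B * t) (fun _ => B)).
      - lra.
      - intros t Ht. eapply cderiv_eq; [|apply cderiv_minus;
          [apply cderiv_mult; [apply cderiv_id|apply cderiv_const]|apply HF; lra]].
        cbv beta; ring.
      - intros t Ht; auto_derive; auto; ring.
      - intros t Ht. rewrite Cmod_minus_sym.
        eapply Rle_trans; [apply (cderiv_increment_le f f' (fun s => B * s) (fun _ => B))|].
        + lra.
        + intros s Hs; apply Hf; lra.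
        + intros s Hs; auto_derive; auto; ring.
        + intros s Hs; apply D; lra.
        + nra. }
    simpl csum. rewrite S_INR.
    replace (csum (fun j : nat => f (INR j)) n + f (INR n) - F (INR n + 1)%R -
      (csum (fun j : nat => f (INR j)) n - F (INR n)))%C with (g (INR n + 1)%R - g (INR n))%C.
    2:{ unfold g. rewrite RtoC_plus. ring. }
    eapply Rle_trans; [exact H|].
    unfold Rdiv in *; lra.
Qed.

(** * Growth of the logarithm, Euler and Stieltjes constants *)

Lemma slit_cone (z : C) (t s : R) : slit z -> 0 <= t -> 0 <= s -> 0 < t + s -> slit (t + s * z).
Proof.
  unfold slit; rewrite re_plus im_plus re_scal_l im_scal_l re_RtoC im_RtoC.
  intros [H|H] Ht Hs Hts.
  - left. destruct (Req_dec s 0); nra.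
  - destruct (Req_dec s 0) as [->|N]; [left; lra|right]. rewrite Rplus_0_l.
    now apply Rmult_integral_contrapositive.
Qed.

Lemma slit_add (z : C) (t : R) : slit z -> 0 <= t -> slit (t + z).
Proof.
  intros H Ht. replace (t + z)%C with (t + 1 * z)%C by ring. apply slit_cone; auto; lra.
Qed.

(** Makes [t + z] comparable with [1 + t] along the whole horizontal ray; the decay estimates on
    such rays rest on it. *)
Lemma slit_add_lower (z : C) : slit z ->
  exists c, 0 < c <= 1 /\ forall t, 0 <= t -> c * (1 + t) <= Cmod (t + z).
Proof.
  intros [H|H].
  - exists (Rmin 1 (Re z)). split; [split; [apply Rmin_pos; lra|apply Rmin_l]|].
    intros t Ht. assert (A := re_le_Cmod (t + z)).
    rewrite re_plus re_RtoC in A. generalize (Rle_abs (t + Re z)) (Rmin_l 1 (Re z)) (Rmin_r 1 (Re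
      z)).
    assert (0 < Rmin 1 (Re z)) by (apply Rmin_pos; lra). nra.
  - assert (P : 0 < Rabs (Im z)) by now apply Rabs_pos_lt.
    assert (Q := Cmod_ge_0 z).
    (* Up to t = 2 |z| + 1 the modulus is at least |Im z| while 1 + t <= 2 |z| + 2, whence the
       second entry. Beyond, the triangle inequality gives t - |z| >= (1 + t) / 4. *)
    exists (Rmin (1 / 4) (Rabs (Im z) / (2 * Cmod z + 2))).
    assert (P2 : 0 < Rabs (Im z) / (2 * Cmod z + 2)) by (apply Rdiv_lt_0_compat; lra).
    assert (L1 := Rmin_l (1 / 4) (Rabs (Im z) / (2 * Cmod z + 2))).
    assert (L2 := Rmin_r (1 / 4) (Rabs (Im z) / (2 * Cmod z + 2))).
    split; [split; [apply Rmin_pos; lra|lra]|].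
    intros t Ht. destruct (Rle_or_lt t (2 * Cmod z + 1)) as [L|L].
    + assert (A := im_le_Cmod (t + z)). rewrite im_plus im_RtoC Rplus_0_l in A.
      apply Rle_trans with (Rabs (Im z)); [|exact A].
      apply Rle_trans with (Rabs (Im z) / (2 * Cmod z + 2) * (2 * Cmod z + 2)).
      * apply Rmult_le_compat; try lra. apply Rmin_glb; lra.
      * right; field; lra.
    + assert (A := Cmod_minus_ge t z). rewrite Cmod_R Rabs_pos_eq in A; [|lra]. nra.
Qed.

Lemma slit_cone_lower (z : C) : slit z ->
  exists c, 0 < c <= 1 /\ forall t s, 0 <= t -> 0 <= s -> c * (s + t) <= Cmod (t + s * z).
Proof.
  intros H. destruct (slit_add_lower z H) as [c [Hc B]]. exists c; split; [exact Hc|].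
  intros t s Ht Hs. destruct (Req_dec s 0) as [->|N].
  - replace (t + 0 * z)%C with (RtoC t) by ring. rewrite Cmod_R Rabs_pos_eq //. nra.
  - assert (0 < s) by lra.
    assert (NC : RtoC s <> 0%C) by (intros E; apply N; now apply RtoC_inj).
    replace (t + s * z)%C with (s * ((t / s)%R + z))%C by (rewrite RtoC_div //; field; exact NC).
    rewrite Cmod_mult Cmod_R (Rabs_pos_eq s) //.
    replace (c * (s + t)) with (s * (c * (1 + t / s))) by (field; lra).
    apply Rmult_le_compat_l; [lra|]. apply B. apply Rle_div_r; lra.
Qed.

(** From [ln x = 2 * ln (sqrt x)] and ln y <= y - 1. Bounding logarithms by square roots keeps every
    later majorant a power. *)
Lemma ln_le_sqrt (x : R) : 1 <= x -> 0 <= ln x <= 2 * sqrt x.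
Proof.
  intros Hx. assert (P : 0 < sqrt x) by (apply sqrt_lt_R0; lra).
  assert (S : sqrt x * sqrt x = x) by (apply sqrt_sqrt; lra).
  split; [rewrite -ln_1; apply ln_le; lra|].
  rewrite -{1}S ln_mult //.
  generalize (exp_ineq1_le (ln (sqrt x))). rewrite exp_ln //. lra.
Qed.

Lemma one_le_sqrt (x : R) : 1 <= x -> 1 <= sqrt x.
Proof. intros H; rewrite -sqrt_1; now apply sqrt_le_1_alt. Qed.

Lemma Clog_growth (z : C) : slit z ->
  exists K, 0 <= K /\ forall t, 0 <= t -> Cmod (Clog (t + z)) <= K * sqrt (t + 1).
Proof.
  intros H. destruct (slit_add_lower z H) as [c [[Hc1 Hc2] B]].
  assert (Q := Cmod_ge_0 z). assert (P := PI_RGT_0).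
  exists (2 + Rabs (ln c) + ln (1 + Cmod z) + PI).
  assert (0 <= ln (1 + Cmod z)) by (rewrite -ln_1; apply ln_le; lra).
  split; [generalize (Rabs_pos (ln c)); lra|].
  intros t Ht. eapply Rle_trans; [apply Cmod_Clog|].
  assert (U : Cmod (t + z) <= (1 + Cmod z) * (1 + t)).
  { eapply Rle_trans; [apply Cmod_triangle|]. rewrite Cmod_R Rabs_pos_eq //. nra. }
  assert (L := B t Ht). assert (Pz : 0 < c * (1 + t)) by nra.
  assert (lnU : ln (Cmod (t + z)) <= ln (1 + Cmod z) + ln (1 + t)).
  { rewrite -ln_mult; [|lra|lra]. apply ln_le; lra. }
  assert (lnL : ln c + ln (1 + t) <= ln (Cmod (t + z))).
  { rewrite -ln_mult; [|lra|lra]. apply ln_le; lra. }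
  destruct (ln_le_sqrt (1 + t)) as [l1 l2]; [lra|].
  assert (s1 := one_le_sqrt (1 + t) ltac:(lra)).
  rewrite (Rplus_comm t 1).
  assert (Rabs (ln (Cmod (t + z))) <= Rabs (ln c) + ln (1 + Cmod z) + ln (1 + t)).
  { apply Rabs_le. generalize (Rle_abs (ln c)) (Rle_abs (- ln c)). rewrite Rabs_Ropp.
    intros; split; lra. }
  assert (W := Rabs_pos (ln c)).
  assert (0 <= (Rabs (ln c) + ln (1 + Cmod z) + PI) * (sqrt (1 + t) - 1)) by (apply Rmult_le_pos;
    lra).
  lra.
Qed.

(** The derivative z / (t + s z) is integrated along the segment from [t] to [t + z], which stays in
    the slit plane, so that no jump of the branch intervenes. *)
Lemma Clog_shift (z : C) : slit z ->
  exists K, 0 <= K /\ forall t, 1 <= t -> Cmod (Clog (t + z) - ln t) <= K / t.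
Proof.
  intros H. destruct (slit_cone_lower z H) as [c [[Hc1 Hc2] B]].
  assert (Q := Cmod_ge_0 z).
  exists (Cmod z / c). split; [apply Rle_div_r; lra|].
  intros t Ht.
  assert (N : forall s, 0 <= s -> slit (t + s * z)) by (intros; apply slit_cone; auto; lra).
  pose (g := fun s : R => Clog (t + s * z)).
  assert (E : Cmod (g 1 - g 0) <= Cmod z / c / t * 1 - Cmod z / c / t * 0).
  { apply (cderiv_increment_le g (fun s => z / (t + s * z))%C
             (fun s => Cmod z / c / t * s) (fun _ => Cmod z / c / t)); [lra| | |].
    - intros s Hs. apply cderiv_Clog; [apply N; lra|].
      eapply cderiv_eq; [|apply cderiv_plus; [apply cderiv_const|
        apply cderiv_mult; [apply cderiv_id|apply cderiv_const]]]. cbv beta; ring.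
    - intros s _; auto_derive; auto; ring.
    - intros s Hs. rewrite Cmod_div; [|apply slit_neq_0, N; lra].
      assert (L := B t s ltac:(lra) ltac:(lra)). unfold Rdiv. rewrite Rmult_assoc.
      apply Rmult_le_compat_l; [lra|]. rewrite -Rinv_mult.
      apply Rinv_le_contravar; nra. }
  unfold g in E.
  replace (t + 1 * z)%C with (t + z)%C in E by ring.
  replace (t + 0 * z)%C with (RtoC t) in E by ring.
  rewrite (Clog_RtoC t) in E; [|lra]. lra.
Qed.

Lemma cderiv_shift (z : C) (t : R) : cderiv (fun t => t + z)%C t 1.
Proof.
  eapply cderiv_eq; [|apply cderiv_plus; [apply cderiv_id|apply cderiv_const]]. ring.
Qed.

Lemma cderiv_Clog_add (z : C) (t : R) : slit (t + z) ->
  cderiv (fun t => Clog (t + z)) t (/ (t + z)).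
Proof.
  intros H. eapply cderiv_eq; [|apply cderiv_Clog; [exact H|apply cderiv_shift]].
  cbv beta; field; now apply slit_neq_0.
Qed.

Lemma cderiv_inv_add (z : C) (t : R) : slit (t + z) ->
  cderiv (fun t => / (t + z))%C t (- (1) / ((t + z) * (t + z))).
Proof.
  intros H. apply (cderiv_inv (fun t => t + z)%C); [now apply slit_neq_0|apply cderiv_shift].
Qed.

Lemma cderiv_Clog_div_add (z : C) (t : R) : slit (t + z) ->
  cderiv (fun t => Clog (t + z) / (t + z))%C t ((1 - Clog (t + z)) / ((t + z) * (t + z))).
Proof.
  intros H. assert (N := slit_neq_0 _ H).
  eapply cderiv_eq; [|apply cderiv_div; [exact N|now apply cderiv_Clog_add|apply cderiv_shift]].
  cbv beta; field; exact N.
Qed.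

Lemma cderiv_Clog_sqr_add (z : C) (t : R) : slit (t + z) ->
  cderiv (fun t => 1 / 2 * (Clog (t + z) * Clog (t + z)))%C t (Clog (t + z) / (t + z)).
Proof.
  intros H. assert (N := slit_neq_0 _ H).
  eapply cderiv_eq; [|apply cderiv_scal, cderiv_mult; now apply cderiv_Clog_add].
  cbv beta; field; auto.
Qed.

(** The two quotients are the derivatives of 1 / (t + z) and of log(t + z) / (t + z), in the form
    asked for by [csum_minus_primitive_converges]. *)
Lemma inv_add_decay (z : C) : slit z ->
  exists K, 0 <= K /\ forall t, 0 <= t ->
    Cmod (- (1) / ((t + z) * (t + z))) <= K / ((t + 1) * sqrt (t + 1)) /\
    Cmod ((1 - Clog (t + z)) / ((t + z) * (t + z))) <= K / ((t + 1) * sqrt (t + 1)).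
Proof.
  intros H. destruct (slit_add_lower z H) as [c [[Hc1 Hc2] B]].
  destruct (Clog_growth z H) as [K [HK G]].
  exists ((1 + K) / (c * c)). split; [apply Rle_div_r; nra|].
  intros t Ht. assert (N := slit_neq_0 _ (slit_add z t H Ht)).
  assert (s1 := one_le_sqrt (t + 1) ltac:(lra)).
  assert (Sx : sqrt (t + 1) * sqrt (t + 1) = t + 1) by (apply sqrt_sqrt; lra).
  assert (M : forall v : C, Cmod v <= (1 + K) * sqrt (t + 1) ->
    Cmod (v / ((t + z) * (t + z))) <= (1 + K) / (c * c) / ((t + 1) * sqrt (t + 1))).
  { intros v Hv. rewrite Cmod_div ?Cmod_mult; [|now apply Cmult_neq_0].
    assert (L := B t Ht).
    apply Rle_trans with ((1 + K) * sqrt (t + 1) / ((c * (1 + t)) * (c * (1 + t)))).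
    - assert (P : 0 < c * (1 + t)) by nra.
      apply Rmult_le_compat; [apply Cmod_ge_0|left; apply Rinv_0_lt_compat; nra|exact Hv|].
      apply Rinv_le_contravar; [nra|]. apply Rmult_le_compat; lra.
    - right. rewrite (Rplus_comm 1 t).
      set (s := sqrt (t + 1)) in *. rewrite -Sx. field; split; lra. }
  split; apply M.
  - rewrite Cmod_opp Cmod_1. nra.
  - eapply Rle_trans; [apply Cmod_minus_le|]. rewrite Cmod_1. generalize (G t Ht); lra.
Qed.

Lemma harmonic_add_converges (z : C) : slit z ->
  exists l, clim (fun n => csum (fun j => / (INR j + z))%C n - Clog (INR n + z))%C l.
Proof.
  intros H. destruct (inv_add_decay z H) as [K [HK D]].
  apply (csum_minus_primitive_converges (fun t => Clog (t + z)) (fun t => / (t + z))%C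
    (fun t => - (1) / ((t + z) * (t + z)))%C K HK).
  - intros t Ht; now apply cderiv_Clog_add, slit_add.
  - intros t Ht; now apply cderiv_inv_add, slit_add.
  - intros t Ht; now apply D.
Qed.

Lemma log_harmonic_add_converges (z : C) : slit z ->
  exists l, clim (fun n => csum (fun j => Clog (INR j + z) / (INR j + z))%C n
                 - 1 / 2 * (Clog (INR n + z) * Clog (INR n + z)))%C l.
Proof.
  intros H. destruct (inv_add_decay z H) as [K [HK D]].
  apply (csum_minus_primitive_converges (fun t => 1 / 2 * (Clog (t + z) * Clog (t + z)))%C
    (fun t => Clog (t + z) / (t + z))%C
    (fun t => (1 - Clog (t + z)) / ((t + z) * (t + z)))%C K HK).
  - intros t Ht; now apply cderiv_Clog_sqr_add, slit_add.
  - intros t Ht; now apply cderiv_Clog_div_add, slit_add.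
  - intros t Ht; now apply D.
Qed.

Lemma is_lim_seq_inv_S (K : R) : is_lim_seq (fun n => K / (INR (S n))) 0.
Proof.
  apply is_lim_seq_scal_0.
  apply (is_lim_seq_inv (fun n => INR (S n)) p_infty); [|easy].
  apply -> (is_lim_seq_incr_1 INR). apply is_lim_seq_INR.
Qed.

Lemma Clog_add_asymp (z : C) : slit z ->
  clim (fun n => Clog (INR n + z) - ln (INR n))%C 0.
Proof.
  intros H. destruct (Clog_shift z H) as [K [HK G]].
  apply clim_unshift. eapply clim_squeeze; [|apply (is_lim_seq_inv_S K)].
  intros n; cbv beta.
  replace (Clog (INR (S n) + z) - ln (INR (S n)) - 0)%C
    with (Clog (INR (S n) + z) - ln (INR (S n)))%C by ring.
  apply G. rewrite S_INR; generalize (pos_INR n); lra.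
Qed.

Lemma Clog_add_sqr_asymp (z : C) : slit z ->
  clim (fun n => 1 / 2 * (Clog (INR n + z) * Clog (INR n + z)) - ln (INR n) ^ 2 / 2)%C 0.
Proof.
  intros H. destruct (Clog_shift z H) as [K [HK G]].
  destruct (Clog_growth z H) as [K' [HK' G']].
  apply clim_unshift. eapply clim_squeeze; [|apply (is_lim_seq_inv_sqrt (K * (K' * 2 + 2)))].
  intros n; cbv beta. rewrite S_INR. set (t := INR n + 1).
  assert (Ht : 1 <= t) by (unfold t; generalize (pos_INR n); lra).
  (* A difference of squares: the first factor is O(1 / t) by [Clog_shift], the second O(sqrt t), so
     the product still tends to 0. *)
  replace (1 / 2 * (Clog (t + z) * Clog (t + z)) - ln t ^ 2 / 2 - 0)%C
    with ((1 / 2)%R * ((Clog (t + z) - ln t) * (Clog (t + z) + ln t)))%C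
    by (rewrite RtoC_div; [field|lra]).
  rewrite !Cmod_mult Cmod_R Rabs_pos_eq; [|lra].
  assert (A := G t Ht). assert (A' := G' t ltac:(lra)).
  assert (A2 : Cmod (Clog (t + z) + ln t) <= (K' * 2 + 2) * sqrt t).
  { eapply Rle_trans; [apply Cmod_triangle|]. rewrite Cmod_R.
    destruct (ln_le_sqrt t Ht) as [l1 l2]. rewrite Rabs_pos_eq //.
    assert (sqrt (t + 1) <= 2 * sqrt t).
    { replace 2 with (sqrt 4) by (replace 4 with (2 * 2) by ring; apply sqrt_square; lra).
      rewrite -sqrt_mult; [|lra|lra]. apply sqrt_le_1_alt; lra. }
    nra. }
  assert (s1 := one_le_sqrt t Ht). assert (Sx : sqrt t * sqrt t = t) by (apply sqrt_sqrt; lra).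
  assert (B : Cmod (Clog (t + z) - ln t) * Cmod (Clog (t + z) + ln t) <= K / t * ((K' * 2 + 2) *
    sqrt t)).
  { apply Rmult_le_compat; try apply Cmod_ge_0; assumption. }
  replace (K / t * ((K' * 2 + 2) * sqrt t)) with (K * (K' * 2 + 2) / sqrt t) in B.
  2:{ rewrite -{2}Sx. field; lra. }
  assert (0 <= Cmod (Clog (t + z) - ln t) * Cmod (Clog (t + z) + ln t)).
  { apply Rmult_le_pos; apply Cmod_ge_0. }
  unfold t in *; lra.
Qed.

Lemma RtoC_sum_n_m (f : nat -> R) (n : nat) :
  RtoC (sum_n_m f 1 n) = csum (fun j => RtoC (f (S j))) n.
Proof.
  induction n as [|n IH].
  - rewrite sum_n_m_zero //.
  - rewrite sum_n_Sm; [|lia]. simpl csum. rewrite -IH -RtoC_plus. reflexivity.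
Qed.

Lemma clim_real_Lim_seq (v : nat -> R) (l : C) :
  clim (fun n => RtoC (v n)) l -> l = RtoC (real (Lim_seq v)).
Proof.
  intros H. apply C_eq.
  - simpl. now rewrite (is_lim_seq_unique _ _ (clim_Re _ _ H)).
  - assert (A := is_lim_seq_unique _ _ (clim_Im _ _ H)). simpl in A.
    rewrite Lim_seq_const in A. simpl. now injection A.
Qed.

Lemma slit_1 : slit 1.
Proof. left; simpl; lra. Qed.

Lemma euler_gamma_clim :
  clim (fun n => csum (fun j => / (INR j + 1))%C n - ln (INR n))%C euler_gamma.
Proof.
  destruct (harmonic_add_converges 1 slit_1) as [l Hl].
  assert (H : clim (fun n => csum (fun j => / (INR j + 1))%C n - ln (INR n))%C l).
  { eapply clim_eq; [|eapply clim_ext; [|apply (clim_plus _ _ _ _ Hl (Clog_add_asymp 1 slit_1))]].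
    - ring.
    - intros n; cbv beta; ring. }
  eapply clim_eq; [|exact H]. apply clim_real_Lim_seq.
  eapply clim_ext; [|exact H]. intros n; cbv beta.
  rewrite RtoC_minus RtoC_sum_n_m. f_equal. apply csum_ext. intros j _.
  rewrite RtoC_inv; [|apply not_0_INR; lia]. now rewrite S_INR RtoC_plus.
Qed.

Lemma stieltjes1_clim :
  clim (fun n => csum (fun j => ln (INR (S j)) / INR (S j))%C n - ln (INR n) ^ 2 / 2)%C stieltjes1.
Proof.
  destruct (log_harmonic_add_converges 1 slit_1) as [l Hl].
  assert (H : clim (fun n => csum (fun j => ln (INR (S j)) / INR (S j))%C n - ln (INR n) ^ 2 /
    2)%C l).
  { eapply clim_eq; [|eapply clim_ext; [|apply (clim_plus _ _ _ _ Hl (Clog_add_sqr_asymp 1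
      slit_1))]].
    - ring.
    - intros n; cbv beta.
      rewrite (csum_ext (fun j => Clog (INR j + 1) / (INR j + 1))%C (fun j => ln (INR (S j)) / INR
        (S j))%C).
      + ring.
      + intros j _. rewrite -RtoC_plus -S_INR Clog_RtoC //. apply lt_0_INR; lia. }
  eapply clim_eq; [|exact H]. apply clim_real_Lim_seq.
  eapply clim_ext; [|exact H]. intros n; cbv beta.
  rewrite RtoC_minus RtoC_sum_n_m RtoC_div; [|lra]. rewrite RtoC_pow.
  f_equal. apply csum_ext. intros j _.
  rewrite RtoC_div //. apply not_0_INR; lia.
Qed.

(** In the definition of [psi1] the Stieltjes constant cancels the terms log(n) / n of the series.
    What is left is a sum minus its primitive: [- psi1 z] is the Euler-Maclaurin constant of log(t +
    z) / (t + z). *)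
Lemma psi1_clim (z : C) : slit z ->
  clim (fun n => csum (fun j => Clog (INR j + z) / (INR j + z))%C n
                 - 1 / 2 * (Clog (INR n + z) * Clog (INR n + z)))%C (- psi1 z).
Proof.
  intros H. destruct (log_harmonic_add_converges z H) as [l Hl].
  eapply clim_eq; [|exact Hl]. unfold psi1.
  assert (N := slit_neq_0 _ H).
  rewrite (clim_CSeries _ (l - Clog z / z - stieltjes1)%C).
  - ring.
  - assert (G := clim_minus _ _ _ _ (clim_plus _ _ _ _ Hl (Clog_add_sqr_asymp z H))
      stieltjes1_clim).
    assert (G2 : clim (fun n => csum (fun j => Clog (INR j + z) / (INR j + z)) n
        - csum (fun j => ln (INR (S j)) / INR (S j)) n)%C (l - stieltjes1)).
    { eapply clim_eq; [|eapply clim_ext; [|exact G]]; [ring|]. intros n; cbv beta; ring. }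
    (* The series of [psi1] starts at n = 1 and the sum here at 0. Apart from the term [Clog z / z],
       the shift costs this last term. *)
    assert (D : clim (fun n => Clog (INR n + z) / (INR n + z))%C 0).
    { destruct (Clog_growth z H) as [K [HK B]]. destruct (slit_add_lower z H) as [c [[Hc1 Hc2] L]].
      eapply clim_squeeze; [|apply (is_lim_seq_inv_sqrt (K / c))]. intros n; cbv beta.
      assert (Pn := pos_INR n).
      replace (Clog (INR n + z) / (INR n + z) - 0)%C with (Clog (INR n + z) / (INR n + z))%C by
        ring.
      rewrite Cmod_div; [|now apply slit_neq_0, slit_add].
      assert (s1 := one_le_sqrt (INR n + 1) ltac:(lra)).
      assert (Sx : sqrt (INR n + 1) * sqrt (INR n + 1) = INR n + 1) by (apply sqrt_sqrt; lra).
      apply Rle_trans with (K * sqrt (INR n + 1) / (c * (1 + INR n))).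
      - apply Rmult_le_compat; [apply Cmod_ge_0| |now apply B|].
        + left; apply Rinv_0_lt_compat. generalize (L _ Pn); nra.
        + apply Rinv_le_contravar; [nra|now apply L].
      - right. rewrite (Rplus_comm 1) -{2}Sx. field; lra. }
    eapply clim_ext; [|eapply clim_eq; [|apply (clim_minus _ _ _ _ (clim_plus _ _ _ _ G2 D)
      (clim_const (Clog z / z)%C))]].
    + intros n; cbv beta. rewrite csum_minus.
      transitivity (csum (fun j => Clog (INR j + z) / (INR j + z)) (S n) - Clog z / z
        - csum (fun j => ln (INR (S j)) / INR (S j)) n)%C; [simpl csum; ring|].
      rewrite csum_S_l. simpl (INR 0). replace (0 + z)%C with z by ring. ring.
    + ring.
Qed.

(** * The exponential integral *)

Lemma continuous_right_at_0 (f : R -> R) (l K : R) :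
  0 <= K -> (forall t, 0 < t <= 1 -> Rabs (f t - l) <= K * sqrt t) ->
  continuous (fun t => match Rle_dec t 0 with left _ => l | right _ => f t end) 0.
Proof.
  intros HK HB. apply (continuity_pt_filterlim (fun t => match Rle_dec t 0 with left _ => l |
    right _ => f t end) 0).
  intros eps Heps.
  assert (P : 0 < Rmin 1 ((eps / (K + 1)) * (eps / (K + 1)))).
  { apply Rmin_pos; [lra|]. apply Rmult_lt_0_compat; apply Rdiv_lt_0_compat; lra. }
  exists (Rmin 1 ((eps / (K + 1)) * (eps / (K + 1)))). split; [exact P|].
  intros x [_ Hx]. simpl in *. unfold R_dist in *. rewrite Rminus_0_r in Hx.
  destruct (Rle_dec 0 0) as [_|N]; [|lra].
  destruct (Rle_dec x 0) as [L|L]; [rewrite Rminus_diag Rabs_R0; lra|].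
  rewrite Rabs_pos_eq in Hx; [|lra].
  assert (x < 1) by (eapply Rlt_le_trans; [exact Hx|apply Rmin_l]).
  assert (H2 : x < (eps / (K + 1)) * (eps / (K + 1))) by (eapply Rlt_le_trans; [exact Hx|apply
    Rmin_r]).
  assert (Pe : 0 < eps / (K + 1)) by (apply Rdiv_lt_0_compat; lra).
  assert (S : sqrt x < eps / (K + 1)).
  { rewrite -(sqrt_square (eps / (K + 1))); [|lra]. apply sqrt_lt_1; lra. }
  eapply Rle_lt_trans; [apply HB; lra|].
  assert (sqrt x * (K + 1) < eps) by (apply Rlt_div_r in S; lra).
  generalize (sqrt_pos x); nra.
Qed.

(** The integral ignores the endpoint, so a junk value at 0 can be replaced by the limit. The
    modulus of continuity [sqrt t] is weak enough to include u log u. *)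
Lemma ex_RInt_right_limit (f : R -> R) (b l K : R) :
  0 <= b -> 0 <= K -> (forall t, 0 < t -> continuous f t) ->
  (forall t, 0 < t <= 1 -> Rabs (f t - l) <= K * sqrt t) -> ex_RInt f 0 b.
Proof.
  intros Hb HK Hf HB.
  apply (ex_RInt_ext (fun t => match Rle_dec t 0 with left _ => l | right _ => f t end)).
  { rewrite Rmin_left // Rmax_right //. intros x Hx. destruct (Rle_dec x 0); [lra|reflexivity]. }
  apply @ex_RInt_continuous. rewrite Rmin_left // Rmax_right //. intros z Hz.
  destruct (Req_dec z 0) as [->|N]; [now apply (continuous_right_at_0 f l K)|].
  apply (continuous_ext_loc _ f).
  - eapply filter_imp; [|apply (open_gt 0 z); lra].
    intros y Hy; cbv beta in *. destruct (Rle_dec y 0); [lra|reflexivity].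
  - apply Hf; lra.
Qed.

Lemma is_CInt_right_limit (f : R -> C) (b : R) (l : C) (K : R) :
  0 <= b -> 0 <= K -> (forall t, 0 < t -> ccont f t) ->
  (forall t, 0 < t <= 1 -> Cmod (f t - l) <= K * sqrt t) -> is_CInt f 0 b (CInt f 0 b).
Proof.
  intros Hb HK Hf HB; split; apply @RInt_correct.
  - apply (ex_RInt_right_limit (fun t => Re (f t)) b (Re l) K); auto; [intros t Ht; exact (proj1
      (Hf t Ht))|].
    intros t Ht; eapply Rle_trans; [|now apply HB]. apply (re_le_Cmod (f t - l)).
  - apply (ex_RInt_right_limit (fun t => Im (f t)) b (Im l) K); auto; [intros t Ht; exact (proj2
      (Hf t Ht))|].
    intros t Ht; eapply Rle_trans; [|now apply HB]. apply (im_le_Cmod (f t - l)).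
Qed.

Lemma cderiv_CInt_upper (f : R -> C) (b : R) :
  0 < b -> (forall t, 0 < t -> is_CInt f 0 t (CInt f 0 t)) -> ccont f b ->
  cderiv (fun t => CInt f 0 t) b (f b).
Proof.
  intros Hb HI [C1 C2].
  assert (L : locally b (fun t => 0 < t)) by (apply (open_gt 0 b); exact Hb).
  split.
  - apply (is_derive_RInt (fun t => Re (f t)) (fun t => Re (CInt f 0 t)) 0); [|exact C1].
    eapply filter_imp; [|exact L]. intros t Ht; exact (proj1 (HI t Ht)).
  - apply (is_derive_RInt (fun t => Im (f t)) (fun t => Im (CInt f 0 t)) 0); [|exact C2].
    eapply filter_imp; [|exact L]. intros t Ht; exact (proj2 (HI t Ht)).
Qed.

(** * The exponential near 0 and the entire function [Ein] *)

Lemma exp_le_compat (x y : R) : x <= y -> exp x <= exp y.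
Proof. intros [H| ->]; [left; now apply exp_increasing|lra]. Qed.

Lemma cderiv_Cexp_ray (h : C) (s : R) :
  cderiv (fun s => Cexp (s * h)) s (h * Cexp (s * h)).
Proof.
  eapply cderiv_eq; [|apply cderiv_Cexp, cderiv_mult; [apply cderiv_id|apply cderiv_const]].
  cbv beta; ring.
Qed.

Lemma Cexp_minus_1_le (h : C) : Cmod (Cexp h - 1) <= Cmod h * exp (Rmax 0 (Re h)).
Proof.
  assert (M := Rmax_l 0 (Re h)). assert (M2 := Rmax_r 0 (Re h)).
  pose (g := fun s : R => Cexp (s * h)).
  assert (E : Cmod (g 1 - g 0) <= Cmod h * exp (Rmax 0 (Re h)) * 1 - Cmod h * exp (Rmax 0 (Re h))
    * 0).
  { apply (cderiv_increment_le g (fun s => h * Cexp (s * h))%C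
      (fun s => Cmod h * exp (Rmax 0 (Re h)) * s) (fun _ => Cmod h * exp (Rmax 0 (Re h)))); [lra|
        | |].
    - intros s _; apply cderiv_Cexp_ray.
    - intros s _; auto_derive; auto; ring.
    - intros s Hs. rewrite Cmod_mult Cmod_Cexp re_scal_l.
      apply Rmult_le_compat_l; [apply Cmod_ge_0|]. apply exp_le_compat. nra. }
  unfold g in E. replace (1 * h)%C with h in E by ring.
  replace (0 * h)%C with (RtoC 0) in E by ring. rewrite Cexp_0 in E. lra.
Qed.

Lemma Cexp_minus_1_le_left (h : C) : Re h <= 0 -> Cmod (Cexp h - 1) <= Cmod h.
Proof.
  intros H. generalize (Cexp_minus_1_le h). rewrite Rmax_left // exp_0. lra.
Qed.

Lemma Cexp_taylor (h : C) :
  Cmod (Cexp h - 1 - h) <= Cmod h * Cmod h * exp (Cmod h).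
Proof.
  pose (g := fun s : R => (Cexp (s * h) - s * h)%C).
  set (B := Cmod h * Cmod h * exp (Cmod h)).
  assert (E : Cmod (g 1 - g 0) <= B * 1 - B * 0).
  { apply (cderiv_increment_le g (fun s => h * (Cexp (s * h) - 1))%C
      (fun s => B * s) (fun _ => B)); [lra| | |].
    - intros s _. eapply cderiv_eq; [|apply cderiv_minus; [apply cderiv_Cexp_ray|
        apply cderiv_mult; [apply cderiv_id|apply cderiv_const]]]. cbv beta; ring.
    - intros s _; auto_derive; auto; ring.
    - intros s Hs. rewrite Cmod_mult. unfold B. rewrite Rmult_assoc.
      apply Rmult_le_compat_l; [apply Cmod_ge_0|].
      eapply Rle_trans; [apply Cexp_minus_1_le|].
      assert (Ph := Cmod_ge_0 h).
      rewrite Cmod_mult Cmod_R Rabs_pos_eq; [|lra].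
      apply Rmult_le_compat; [nra|left; apply exp_pos|nra|].
      apply exp_le_compat, Rmax_lub; [lra|]. rewrite re_scal_l.
      generalize (re_le_Cmod h) (Rle_abs (Re h)); nra. }
  unfold g in E. replace (1 * h)%C with h in E by ring.
  replace (0 * h)%C with (RtoC 0) in E by ring. rewrite Cexp_0 in E.
  replace (Cexp h - 1 - h)%C with (Cexp h - h - (1 - 0))%C by ring. lra.
Qed.

(* The value at [t = 0] is the junk [0 / 0 = 0]; the continuous extension is [z]. *)
Definition Ein_kernel (z : C) (t : R) : C := (1 - Cexp (- (t * z))) / t.
Definition Ein (z : C) : C := CInt (Ein_kernel z) 0 1.

Lemma le_sqrt_01 (t : R) : 0 < t <= 1 -> t <= sqrt t.
Proof.
  intros H. assert (S : sqrt t * sqrt t = t) by (apply sqrt_sqrt; lra).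
  assert (P : 0 < sqrt t) by (apply sqrt_lt_R0; lra).
  assert (sqrt t <= 1) by (rewrite -sqrt_1; apply sqrt_le_1_alt; lra). nra.
Qed.

Lemma RtoC_neq_0 (x : R) : x <> 0 -> RtoC x <> 0%C.
Proof. intros H E; apply H; now apply RtoC_inj. Qed.

Lemma cderiv_Cexp_neg (z : C) (t : R) :
  cderiv (fun t => Cexp (- (t * z))) t (- z * Cexp (- (t * z))).
Proof.
  eapply cderiv_eq; [|apply cderiv_Cexp, cderiv_opp, cderiv_mult; [apply cderiv_id|apply
    cderiv_const]].
  cbv beta; ring.
Qed.

Lemma is_CInt_Ein (z : C) : is_CInt (Ein_kernel z) 0 1 (Ein z).
Proof.
  apply (is_CInt_right_limit _ _ z (Cmod z * Cmod z * exp (Cmod z))); [lra| | |].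
  - apply Rmult_le_pos; [apply Rmult_le_pos; apply Cmod_ge_0|left; apply exp_pos].
  - intros t Ht. eapply cderiv_ccont. apply cderiv_div.
    + apply RtoC_neq_0; lra.
    + apply cderiv_minus; [apply cderiv_const|apply cderiv_Cexp_neg].
    + apply cderiv_id.
  - intros t Ht. assert (N : RtoC t <> 0%C) by (apply RtoC_neq_0; lra).
    unfold Ein_kernel.
    replace ((1 - Cexp (- (t * z))) / t - z)%C with (- (Cexp (- (t * z)) - 1 - (- (t * z))) / t)%C
      by (field; exact N).
    rewrite Cmod_div // Cmod_opp Cmod_R (Rabs_pos_eq t); [|lra].
    apply Rle_div_l; [lra|].
    eapply Rle_trans; [apply Cexp_taylor|]. rewrite Cmod_opp Cmod_mult Cmod_R (Rabs_pos_eq t);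
      [|lra].
    assert (L := le_sqrt_01 t Ht). assert (Pz := Cmod_ge_0 z).
    apply Rle_trans with (Cmod z * Cmod z * exp (Cmod z) * (t * t)).
    + replace (t * Cmod z * (t * Cmod z) * exp (t * Cmod z))
        with (Cmod z * Cmod z * (t * t) * exp (t * Cmod z)) by ring.
      replace (Cmod z * Cmod z * exp (Cmod z) * (t * t))
        with (Cmod z * Cmod z * (t * t) * exp (Cmod z)) by ring.
      apply Rmult_le_compat_l; [|apply exp_le_compat; nra].
      apply Rmult_le_pos; nra.
    + assert (0 <= Cmod z * Cmod z * exp (Cmod z)).
      { apply Rmult_le_pos; [nra|left; apply exp_pos]. }
      set (B := Cmod z * Cmod z * exp (Cmod z)) in *.
      assert (t * t <= sqrt t * t) by nra. nra.
Qed.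

Lemma is_RInt_const_01 (c : R) : is_RInt (fun _ => c) 0 1 c.
Proof.
  assert (H := @is_RInt_const R_NormedModule 0 1 c).
  change (is_RInt (fun _ : R => c) 0 1 ((1 - 0) * c)) in H.
  now replace ((1 - 0) * c) with c in H by ring.
Qed.

Lemma Ein_le (z : C) : 0 <= Re z -> Cmod (Ein z) <= Cmod z.
Proof.
  intros H. apply (is_CInt_norm_le (Ein_kernel z) (fun _ => Cmod z) 0 1); [lra|apply is_CInt_Ein|
    |].
  - apply is_RInt_const_01.
  - intros t Ht. unfold Ein_kernel. assert (N : RtoC t <> 0%C) by (apply RtoC_neq_0; lra).
    rewrite Cmod_div // Cmod_R (Rabs_pos_eq t); [|lra]. apply Rle_div_l; [lra|].
    rewrite Cmod_minus_sym. eapply Rle_trans; [apply Cexp_minus_1_le_left|].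
    + rewrite re_opp re_scal_l; nra.
    + rewrite Cmod_opp Cmod_mult Cmod_R Rabs_pos_eq; lra.
Qed.

Lemma is_CInt_Cexp_neg (z : C) : z <> 0%C ->
  is_CInt (fun t => Cexp (- (t * z))) 0 1 ((1 - Cexp (- z)) / z).
Proof.
  intros N. eapply is_CInt_eq; [|apply (is_CInt_FTC (fun t => - Cexp (- (t * z)) / z)%C)].
  - cbv beta. replace (1 * z)%C with z by ring.
    replace (- (0 * z))%C with (RtoC 0) by ring. rewrite Cexp_0. field; exact N.
  - lra.
  - intros t _. eapply cderiv_eq; [|apply cderiv_div; [exact N|apply cderiv_opp,
      cderiv_Cexp_neg|apply cderiv_const]].
    cbv beta; field; exact N.
  - intros t _. eapply cderiv_ccont, cderiv_Cexp_neg.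
Qed.

(** The linear term is the integral of [Cexp (- (t * z))], the derivative in [z] of the kernel. The
    quadratic remainder under the integral carries t^2, which absorbs the 1 / t and leaves a bound
    uniform on (0, 1). *)
Lemma Ein_taylor (z h : C) : z <> 0%C ->
  Cmod (Ein (z + h) - Ein z - h * ((1 - Cexp (- z)) / z)) <=
  Cmod h * Cmod h * exp (Cmod z + Cmod h).
Proof.
  intros N.
  apply (is_CInt_norm_le (fun t => Ein_kernel (z + h) t - Ein_kernel z t - h * Cexp (- (t * z)))%C
    (fun _ => Cmod h * Cmod h * exp (Cmod z + Cmod h)) 0 1); [lra| |apply is_RInt_const_01|].
  - apply is_CInt_minus; [apply is_CInt_minus; apply is_CInt_Ein|].
    apply is_CInt_scal, is_CInt_Cexp_neg, N.
  - intros t Ht. assert (Nt : RtoC t <> 0%C) by (apply RtoC_neq_0; lra).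
    unfold Ein_kernel.
    replace (- (t * (z + h)))%C with (- (t * z) + - (t * h))%C by ring. rewrite Cexp_plus.
    match goal with |- Cmod ?a <= _ => replace a with
     (- Cexp (- (t * z)) * (Cexp (- (t * h)) - 1 - (- (t * h))) / t)%C by (field; exact Nt) end.
    rewrite Cmod_div // Cmod_mult Cmod_opp Cmod_Cexp Cmod_R (Rabs_pos_eq t); [|lra].
    apply Rle_div_l; [lra|].
    assert (Pz := Cmod_ge_0 z). assert (Ph := Cmod_ge_0 h).
    apply Rle_trans with (exp (Cmod z) * (t * t * (Cmod h * Cmod h) * exp (Cmod h))).
    + apply Rmult_le_compat; [left; apply exp_pos|apply Cmod_ge_0| |].
      * apply exp_le_compat. rewrite re_opp re_scal_l.
        generalize (re_le_Cmod z) (Rle_abs (- Re z)). rewrite Rabs_Ropp. nra.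
      * eapply Rle_trans; [apply Cexp_taylor|].
        rewrite Cmod_opp Cmod_mult Cmod_R (Rabs_pos_eq t); [|lra].
        replace (t * Cmod h * (t * Cmod h)) with (t * t * (Cmod h * Cmod h)) by ring.
        apply Rmult_le_compat_l; [apply Rmult_le_pos; nra|]. apply exp_le_compat; nra.
    + rewrite exp_plus. set (e1 := exp (Cmod z)). set (e2 := exp (Cmod h)).
      assert (0 < e1) by apply exp_pos. assert (0 < e2) by apply exp_pos.
      replace (e1 * (t * t * (Cmod h * Cmod h) * e2)) with ((Cmod h * Cmod h * (e1 * e2)) * (t *
        t)) by ring.
      apply Rmult_le_compat_l; [|nra]. apply Rmult_le_pos; nra.
Qed.

Lemma cderiv_Ein_affine (a v : C) (s : R) : (a + s * v)%C <> 0%C ->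
  cderiv (fun s => Ein (a + s * v)) s (v * ((1 - Cexp (- (a + s * v))) / (a + s * v))).
Proof.
  intros N. set (z := (a + s * v)%C) in *.
  apply (cderiv_quadratic _ _ _ 1 (Cmod v * Cmod v * exp (Cmod z + Cmod v))); [lra|].
  intros h Hh.
  replace (a + (s + h)%R * v)%C with (z + h * v)%C by (unfold z; rewrite RtoC_plus; ring).
  fold z.
  replace (h * (v * ((1 - Cexp (- z)) / z)))%C with ((h * v) * ((1 - Cexp (- z)) / z))%C by ring.
  eapply Rle_trans; [now apply Ein_taylor|].
  assert (Pv := Cmod_ge_0 v). assert (Ph := Rabs_pos h).
  rewrite Cmod_mult Cmod_R.
  replace (Rabs h * Cmod v * (Rabs h * Cmod v)) with (Cmod v * Cmod v * (Rabs h * Rabs h)) by ring.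
  rewrite -Rabs_mult (Rabs_pos_eq (h * h)); [|nra].
  replace (Cmod v * Cmod v * exp (Cmod z + Cmod v) * (h * h))
    with (Cmod v * Cmod v * (h * h) * exp (Cmod z + Cmod v)) by ring.
  apply Rmult_le_compat_l; [apply Rmult_le_pos; nra|]. apply exp_le_compat; nra.
Qed.

(** * Harmonic numbers as integrals, and the constant in [E1] *)

Lemma csum_geom (x : C) (n : nat) : ((1 - x) * csum (fun j => x ^ j) n)%C = (1 - x ^ n)%C.
Proof.
  induction n as [|n IH]; simpl csum; [simpl; ring|].
  rewrite Cmult_plus_distr_l IH Cpow_S. ring.
Qed.

Lemma is_CInt_csum (f : nat -> R -> C) (a b : R) (l : nat -> C) (n : nat) :
  (forall j, (j < n)%nat -> is_CInt (f j) a b (l j)) ->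
  is_CInt (fun t => csum (fun j => f j t) n) a b (csum l n).
Proof.
  induction n as [|n IH]; intros H; simpl.
  - assert (H0 := @is_RInt_const R_NormedModule a b 0).
    change (is_RInt (fun _ : R => 0) a b ((b - a) * 0)) in H0.
    rewrite Rmult_0_r in H0. split; exact H0.
  - apply is_CInt_plus; [apply IH; intros; apply H; lia|apply H; lia].
Qed.

(** The integrand is a geometric sum of ratio 1 - t, integrated term by term. *)
Lemma harmonic_CInt (n : nat) :
  is_CInt (fun t => (1 - (1 - t) ^ n) / t)%C 0 1 (csum (fun j => / (INR j + 1))%C n).
Proof.
  apply (is_CInt_ext (fun t => csum (fun j => (1 - t) ^ j)%C n)); [lra| |].
  - intros t Ht. assert (Nt : RtoC t <> 0%C) by (apply RtoC_neq_0; lra).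
    rewrite -csum_geom. field; exact Nt.
  - apply is_CInt_csum. intros j _.
    assert (Nj : (INR j + 1)%C <> 0%C).
    { rewrite -RtoC_plus. apply RtoC_neq_0. generalize (pos_INR j); lra. }
    assert (D : forall t : R, cderiv (fun t => - (1 - t) ^ (S j) / (INR j + 1))%C t ((1 - t) ^
      j)%C).
    { intros t. apply (cderiv_ext (fun t => RtoC (- (1 - t) ^ (S j) / (INR j + 1)))).
      - intros u. rewrite RtoC_div; [|generalize (pos_INR j); lra].
        now rewrite RtoC_opp RtoC_pow RtoC_minus RtoC_plus.
      - eapply cderiv_eq; [|apply cderiv_RtoC; auto_derive; [auto|reflexivity]].
        rewrite -RtoC_minus -RtoC_pow. f_equal.
        change (match j with 0%nat => 1 | S _ => INR j + 1 end) with (INR (S j)).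
        rewrite ?S_INR. simpl Nat.pred. unfold Rminus. field. generalize (pos_INR j); lra. }
    eapply is_CInt_eq; [|apply (is_CInt_FTC (fun t => - (1 - t) ^ (S j) / (INR j + 1))%C)].
    + cbv beta. rewrite !Cpow_S. replace (1 - 0)%C with (RtoC 1) by ring. rewrite Cpow_1_l.
      replace (1 - 1)%C with (RtoC 0) by ring. rewrite Cmult_0_l. field; exact Nj.
    + lra.
    + intros t _; apply D.
    + intros t _. destruct j as [|j]; [apply (cderiv_ccont _ _ _ (cderiv_const 1 t))|].
      apply (cderiv_ccont _ _ (- (INR (S j) * (1 - t) ^ j))%R).
      apply (cderiv_ext (fun t => RtoC ((1 - t) ^ (S j)))).
      * intros u; now rewrite RtoC_pow RtoC_minus.
      * apply cderiv_RtoC. auto_derive; auto. simpl. unfold Rminus. ring.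
Qed.

Lemma exp_pow_INR (n : nat) (x : R) : exp (INR n * x) = exp x ^ n.
Proof.
  induction n as [|n IH]; [simpl; now rewrite Rmult_0_l exp_0|].
  rewrite S_INR Rmult_plus_distr_r exp_plus IH Rmult_1_l. simpl; ring.
Qed.

Lemma bernoulli_sub (n : nat) (x : R) : 0 <= x <= 1 -> 1 - INR n * x <= (1 - x) ^ n.
Proof.
  intros H. induction n as [|n IH]; [simpl; lra|].
  rewrite S_INR. simpl pow.
  destruct (Rle_or_lt 0 (1 - INR n * x)) as [L|L].
  - assert (P := pos_INR n). nra.
  - assert (0 <= (1 - x) ^ n) by (apply pow_le; lra). nra.
Qed.

(* Compares [int_0^1 (1 - e^(-n t)) / t dt] with the harmonic number
   [int_0^1 (1 - (1 - t)^n) / t dt]. *)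
Lemma exp_pow_bounds (n : nat) (t : R) : 0 <= t <= 1 ->
  0 <= exp (- (INR n * t)) - (1 - t) ^ n <= INR n * (t * t) * exp (- (INR n * t)).
Proof.
  intros H.
  replace (- (INR n * t)) with (INR n * (- t)) by ring. rewrite exp_pow_INR.
  assert (L := exp_ineq1_le (- t)). assert (L2 := exp_ineq1_le t).
  split.
  - assert ((1 - t) ^ n <= exp (- t) ^ n) by (apply pow_incr; lra). lra.
  - assert (E : exp (- t) * exp t = 1) by (rewrite -exp_plus -exp_0; f_equal; ring).
    assert (P := exp_pos (- t)).
    assert (A : 1 - t * t <= (1 - t) * exp t) by nra.
    assert (B := bernoulli_sub n (t * t) ltac:(nra)).
    assert (C1 : (1 - t * t) ^ n <= ((1 - t) * exp t) ^ n) by (apply pow_incr; nra).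
    assert (D : ((1 - t) * exp t) ^ n * exp (- t) ^ n = (1 - t) ^ n).
    { rewrite -Rpow_mult_distr. f_equal. nra. }
    assert (Q : 0 < exp (- t) ^ n) by now apply pow_lt.
    rewrite -D.
    assert ((1 - INR n * (t * t)) * exp (- t) ^ n <= ((1 - t) * exp t) ^ n * exp (- t) ^ n).
    { apply Rmult_le_compat_r; lra. }
    lra.
Qed.

Lemma is_RInt_gamma2_kernel (c : R) : 0 < c ->
  is_RInt (fun t => c * t * exp (- (c * t))) 0 1 (1 / c - (1 + 1 / c) * exp (- c)).
Proof.
  intros Hc. pose (F := fun t => - (t + 1 / c) * exp (- (c * t))).
  replace (1 / c - (1 + 1 / c) * exp (- c)) with (F 1 - F 0).
  2:{ unfold F. rewrite Rmult_0_r Rmult_1_r Ropp_0 exp_0. ring. }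
  apply (@is_RInt_derive R_CompleteNormedModule F).
  - intros t _. unfold F. auto_derive; auto. field; lra.
  - intros t _. apply @ex_derive_continuous. auto_derive; auto.
Qed.

(** Dividing [exp_pow_bounds] by [t] gives the majorant n t e^(-n t), whose integral over [0, 1] is
    less than 1 / n. *)
Lemma Ein_harmonic (n : nat) :
  Cmod (Ein (INR (S n)) - csum (fun j => / (INR j + 1))%C (S n)) <= 1 / INR (S n).
Proof.
  set (N := S n). assert (PN : 0 < INR N) by (apply lt_0_INR; unfold N; lia).
  apply Rle_trans with (1 / INR N - (1 + 1 / INR N) * exp (- INR N)).
  2:{ assert (0 < 1 / INR N) by (apply Rdiv_lt_0_compat; lra).
      generalize (exp_pos (- INR N)); nra. }
  apply (is_CInt_norm_le
    (fun t => Ein_kernel (INR N) t - (1 - (1 - t) ^ N) / t)%C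
    (fun t => INR N * t * exp (- (INR N * t))) 0 1); [lra| | |].
  - apply is_CInt_minus; [apply is_CInt_Ein|apply harmonic_CInt].
  - now apply is_RInt_gamma2_kernel.
  - intros t Ht. assert (Nt : RtoC t <> 0%C) by (apply RtoC_neq_0; lra).
    destruct (exp_pow_bounds N t) as [B1 B2]; [lra|].
    unfold Ein_kernel.
    replace (- (t * INR N))%C with (RtoC (- (INR N * t))) by (rewrite RtoC_opp RtoC_mult; ring).
    rewrite Cexp_RtoC.
    replace ((1 - exp (- (INR N * t))) / t - (1 - (1 - t) ^ N) / t)%C
      with (- RtoC (exp (- (INR N * t)) - (1 - t) ^ N) / t)%C
      by (rewrite RtoC_minus RtoC_pow RtoC_minus; generalize (Cpow (1 - t) N); intros q; field;
        exact Nt).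
    rewrite Cmod_div // Cmod_opp !Cmod_R !Rabs_pos_eq; [|lra|lra].
    apply Rle_div_l; [lra|]. eapply Rle_trans; [exact B2|]. right; ring.
Qed.

(* The exponential integral [int_z^oo e^-s / s ds]; that this is the right
   constant of integration is [E1_nat_clim]. *)
Definition E1 (z : C) : C := Ein z - euler_gamma - Clog z.

Lemma cderiv_E1_affine (a v : C) (s : R) : slit (a + s * v) ->
  cderiv (fun s => E1 (a + s * v)) s (- (v * Cexp (- (a + s * v)) / (a + s * v))).
Proof.
  intros H. assert (N := slit_neq_0 _ H).
  eapply cderiv_eq; [|apply cderiv_minus; [apply cderiv_minus; [now apply cderiv_Ein_affine|
    apply cderiv_const]|apply cderiv_Clog; [exact H|apply cderiv_plus; [apply cderiv_const|
    apply cderiv_mult; [apply cderiv_id|apply cderiv_const]]]]].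
  cbv beta. field; exact N.
Qed.

(** [Ein] at [n] is the harmonic number up to 1 / n, and subtracting ln n leaves Euler's constant:
    gamma is exactly what makes [E1] vanish at infinity. *)
Lemma E1_nat_clim : clim (fun n => E1 (INR (S n))) 0.
Proof.
  assert (A : clim (fun n => Ein (INR (S n)) - csum (fun j => / (INR j + 1))%C (S n))%C 0).
  { eapply clim_squeeze; [|apply (is_lim_seq_inv_S 1)].
    intros n; cbv beta.
    replace (Ein (INR (S n)) - csum (fun j => / (INR j + 1))%C (S n) - 0)%C
      with (Ein (INR (S n)) - csum (fun j => / (INR j + 1))%C (S n))%C by ring.
    apply Ein_harmonic. }
  eapply clim_ext; [|eapply clim_eq; [|apply (clim_minus _ _ _ _
    (clim_plus _ _ _ _ A (clim_shift _ _ euler_gamma_clim)) (clim_const euler_gamma))]].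
  - intros n; cbv beta. unfold E1. rewrite (Clog_RtoC (INR (S n))); [|apply lt_0_INR; lia]. ring.
  - ring.
Qed.

Lemma right_slit (z : C) : 0 <= Re z -> z <> 0%C -> slit z.
Proof.
  intros H N. destruct (Req_dec (Im z) 0) as [E|E]; [left|now right].
  destruct (Req_dec (Re z) 0) as [E'|E']; [|lra].
  exfalso; apply N, C_eq; simpl; lra.
Qed.

Lemma Cmod_add_right (z : C) (s : R) : 0 <= Re z -> 0 <= s -> Cmod z <= Cmod (z + s).
Proof.
  intros H Hs. apply Rsqr_incr_0_var; [|apply Cmod_ge_0].
  unfold Rsqr; rewrite !Cmod_sqr re_plus im_plus re_RtoC im_RtoC. nra.
Qed.

Lemma E1_shift_le (z : C) (T : R) : 0 <= Re z -> z <> 0%C -> 0 <= T ->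
  Cmod (E1 z - E1 (z + T)) <= exp (- Re z) / Cmod z.
Proof.
  intros H N HT. assert (P := N). apply Cmod_gt_0 in P.
  pose (g := fun s : R => E1 (z + s * 1)).
  set (B := exp (- Re z) / Cmod z).
  assert (PB : 0 < B) by (apply Rdiv_lt_0_compat; [apply exp_pos|exact P]).
  assert (E : Cmod (g T - g 0) <= - B * exp (- T) - - B * exp (- 0)).
  { apply (cderiv_increment_le g (fun s => - (1 * Cexp (- (z + s * 1)) / (z + s * 1)))%C
      (fun s => - B * exp (- s)) (fun s => B * exp (- s))); [lra| | |].
    - intros s Hs. apply cderiv_E1_affine. replace (z + s * 1)%C with (s + z)%C by ring.
      apply slit_add; [now apply right_slit|lra].
    - intros s Hs. auto_derive; auto; ring.
    - intros s Hs. replace (z + s * 1)%C with (z + s)%C by ring.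
      assert (L := Cmod_add_right z s H ltac:(lra)).
      assert (Ns : (z + s)%C <> 0%C) by (apply Cmod_gt_0; lra).
      rewrite Cmod_opp Cmod_div // Cmod_mult Cmod_1 Cmod_Cexp re_opp re_plus re_RtoC.
      replace (- (Re z + s)) with (- Re z + - s) by ring. rewrite exp_plus. unfold B.
      unfold Rdiv. rewrite Rmult_1_l.
      replace (exp (- Re z) * / Cmod z * exp (- s)) with (exp (- Re z) * exp (- s) * / Cmod z) by
        ring.
      apply Rmult_le_compat_l; [left; apply Rmult_lt_0_compat; apply exp_pos|].
      apply Rinv_le_contravar; assumption. }
  unfold g in E. rewrite Ropp_0 exp_0 in E.
  replace (z + 0 * 1)%C with z in E by ring. replace (z + T * 1)%C with (z + T)%C in E by ring.
  rewrite Cmod_minus_sym. generalize (exp_pos (- T)). nra.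
Qed.

Lemma E1_far_le (z : C) (T : R) : 0 <= Re z -> 1 <= T ->
  Cmod (E1 (z + T) - E1 T) <= Cmod z / T.
Proof.
  intros H HT.
  pose (g := fun s : R => E1 (T + s * z)).
  assert (L : forall s : R, 0 <= s -> T <= Cmod (T + s * z)).
  { intros s Hs. eapply Rle_trans; [|apply re_le_Cmod]. rewrite re_plus re_scal_l re_RtoC.
    eapply Rle_trans; [|apply Rle_abs]. nra. }
  assert (E : Cmod (g 1 - g 0) <= Cmod z / T * 1 - Cmod z / T * 0).
  { apply (cderiv_increment_le g (fun s => - (z * Cexp (- (T + s * z)) / (T + s * z)))%C
      (fun s => Cmod z / T * s) (fun s => Cmod z / T)); [lra| | |].
    - intros s Hs. apply cderiv_E1_affine. left. rewrite re_plus re_scal_l re_RtoC. nra.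
    - intros s Hs. auto_derive; auto; ring.
    - intros s Hs. assert (Ls := L s ltac:(lra)).
      rewrite Cmod_opp Cmod_div ?Cmod_mult ?Cmod_Cexp; [|apply Cmod_gt_0; lra].
      assert (exp (Re (- (T + s * z))) <= 1).
      { rewrite -exp_0. apply exp_le_compat. rewrite re_opp re_plus re_scal_l re_RtoC. nra. }
      apply Rmult_le_compat; [|left; apply Rinv_0_lt_compat; lra| |apply Rinv_le_contravar; lra].
      + apply Rmult_le_pos; [apply Cmod_ge_0|left; apply exp_pos].
      + generalize (Cmod_ge_0 z); nra. }
  unfold g in E. replace (T + 1 * z)%C with (z + T)%C in E by ring.
  replace (T + 0 * z)%C with (RtoC T) in E by ring. lra.
Qed.

(* Push [z] to infinity along the horizontal ray [z + n], then compare with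
   the real point [n]. *)
Lemma E1_le (z : C) : 0 <= Re z -> z <> 0%C -> Cmod (E1 z) <= exp (- Re z) / Cmod z.
Proof.
  intros H N.
  assert (K : Rbar_le (Cmod (E1 z)) (exp (- Re z) / Cmod z + 0)).
  { eapply (is_lim_seq_le (fun _ => Cmod (E1 z))
      (fun n => exp (- Re z) / Cmod z + (Cmod z / INR (S n) + Cmod (E1 (INR (S n)) - 0)))).
    - intros n. assert (P1 : 1 <= INR (S n)) by (rewrite S_INR; generalize (pos_INR n); lra).
      replace (E1 z) with ((E1 z - E1 (z + INR (S n))) + ((E1 (z + INR (S n)) - E1 (INR (S n))) +
        (E1 (INR (S n)) - 0)))%C by ring.
      eapply Rle_trans; [apply Cmod_triangle|]. apply Rplus_le_compat; [apply E1_shift_le; auto;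
        lra|].
      eapply Rle_trans; [apply Cmod_triangle|]. apply Rplus_le_compat_r. now apply E1_far_le.
    - apply is_lim_seq_const.
    - apply is_lim_seq_plus'; [apply is_lim_seq_const|].
      apply is_lim_seq_plus_0; [apply is_lim_seq_inv_S|apply E1_nat_clim]. }
  simpl in K; lra.
Qed.

(** * The truncated Laplace integral of the logarithm *)

(* Closed form of [int_U^oo e^(-p u) (ln u - Clog w) du]. *)
Definition log_tail (w p : C) (U : R) : C :=
  ((Cexp (- (U * p)) * (ln U - Clog w) + E1 (U * p)) / p)%C.

Lemma Re_mult_pos (p : C) (U : R) : 0 <= Re p -> p <> 0%C -> 0 < U ->
  0 <= Re (U * p) /\ (U * p)%C <> 0%C.
Proof.
  intros H N HU; split; [rewrite re_scal_l; nra|].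
  apply Cmult_neq_0; [apply RtoC_neq_0; lra|exact N].
Qed.

Lemma is_derive_ln (x : R) : 0 < x -> is_derive ln x (/ x).
Proof. intros H; auto_derive; [exact H|ring]. Qed.

(** The term e^(-U p) / U produced by differentiating [ln U] cancels the derivative of
    [E1 (U * p)]. *)
Lemma cderiv_log_tail (w p : C) (U : R) : 0 <= Re p -> p <> 0%C -> 0 < U ->
  cderiv (log_tail w p) U (- (Cexp (- (U * p)) * (ln U - Clog w))).
Proof.
  intros H N HU. destruct (Re_mult_pos p U H N HU) as [H1 N1].
  assert (NU : RtoC U <> 0%C) by (apply RtoC_neq_0; lra).
  unfold log_tail.
  eapply cderiv_eq; [|apply cderiv_div; [exact N| |apply cderiv_const]].
  2:{ apply cderiv_plus.
      - apply cderiv_mult; [apply cderiv_Cexp_neg|].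
        apply cderiv_minus; [apply cderiv_RtoC, is_derive_ln, HU|apply cderiv_const].
      - apply (cderiv_ext (fun U => E1 (0 + U * p))); [intros t; f_equal; ring|].
        apply cderiv_E1_affine. replace (0 + U * p)%C with (U * p)%C by ring. now apply
          right_slit. }
  cbv beta. replace (0 + U * p)%C with (U * p)%C by ring.
  rewrite RtoC_inv; [|lra]. field; auto.
Qed.

Lemma Clog_scal (U : R) (p : C) : 0 < U -> p <> 0%C -> Clog (U * p) = (ln U + Clog p)%C.
Proof.
  intros HU N. rewrite Clog_mult ?Clog_RtoC //.
  - apply RtoC_neq_0; lra.
  - assert (E : Carg U = 0).
    { generalize (f_equal Im (Clog_RtoC U HU)); simpl; tauto. }
    rewrite E Rplus_0_l; apply Carg_bound.
Qed.

(** As [U] tends to 0 the divergence of [ln U] cancels against the logarithm inside [E1]; Euler's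
    constant enters the kernel here. The closed form allows Re p = 0, where the Laplace integral is
    not absolutely convergent. *)
Lemma log_tail_at_0 (w p : C) (U : R) : 0 <= Re p -> p <> 0%C -> 0 < U ->
  Cmod (log_tail w p U - - ((Clog p + Clog w + euler_gamma) / p)) <=
  U * (Rabs (ln U) + Cmod (Clog w) + 1).
Proof.
  intros H N HU. destruct (Re_mult_pos p U H N HU) as [H1 N1].
  unfold log_tail, E1. rewrite Clog_scal //.
  replace ((Cexp (- (U * p)) * (ln U - Clog w) + (Ein (U * p) - euler_gamma - (ln U + Clog p))) /
    p -
   - ((Clog p + Clog w + euler_gamma) / p))%C
   with (((Cexp (- (U * p)) - 1) * (ln U - Clog w) + Ein (U * p)) / p)%C by (field; exact N).
  rewrite Cmod_div //. apply Cmod_gt_0 in N.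
  apply Rle_div_l; [exact N|].
  eapply Rle_trans; [apply Cmod_triangle|]. rewrite Cmod_mult.
  assert (A : Cmod (Cexp (- (U * p)) - 1) <= U * Cmod p).
  { eapply Rle_trans; [apply Cexp_minus_1_le_left; rewrite re_opp; lra|].
    rewrite Cmod_opp Cmod_mult Cmod_R Rabs_pos_eq; lra. }
  assert (B : Cmod (Ein (U * p)) <= U * Cmod p).
  { eapply Rle_trans; [apply Ein_le; exact H1|]. rewrite Cmod_mult Cmod_R Rabs_pos_eq; lra. }
  assert (D : Cmod (ln U - Clog w) <= Rabs (ln U) + Cmod (Clog w)).
  { eapply Rle_trans; [apply Cmod_minus_le|]. rewrite Cmod_R; lra. }
  assert (AD : Cmod (Cexp (- (U * p)) - 1) * Cmod (ln U - Clog w) <=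
              U * Cmod p * (Rabs (ln U) + Cmod (Clog w))).
  { apply Rmult_le_compat; auto; apply Cmod_ge_0. }
  nra.
Qed.

(** The exponential factor is retained because, integrated over [x] along the rays, it supplies the
    factor 1 / U of [tail_moment_le]. *)
Lemma log_tail_le (w p : C) (U d : R) : 0 <= Re p -> 0 < d <= Cmod p -> 1 <= U ->
  Cmod (log_tail w p U) <= exp (- (U * Re p)) * (ln U + Cmod (Clog w) + / d) / d.
Proof.
  intros H [Pd Hd] HU. assert (N : p <> 0%C) by (apply Cmod_gt_0; lra).
  destruct (Re_mult_pos p U H N ltac:(lra)) as [H1 N1].
  assert (L := ln_le_sqrt U HU).
  unfold log_tail. rewrite Cmod_div //. unfold Rdiv.
  apply Rmult_le_compat; [apply Cmod_ge_0|left; apply Rinv_0_lt_compat; lra| |apply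
    Rinv_le_contravar; lra].
  eapply Rle_trans; [apply Cmod_triangle|]. rewrite Cmod_mult Cmod_Cexp re_opp re_scal_l.
  assert (P := exp_pos (- (U * Re p))).
  assert (D : Cmod (ln U - Clog w) <= ln U + Cmod (Clog w)).
  { eapply Rle_trans; [apply Cmod_minus_le|]. rewrite Cmod_R Rabs_pos_eq; lra. }
  assert (B : Cmod (E1 (U * p)) <= exp (- (U * Re p)) * / d).
  { eapply Rle_trans; [apply E1_le; auto|]. rewrite re_scal_l. unfold Rdiv.
    apply Rmult_le_compat_l; [lra|]. apply Rinv_le_contravar; [lra|].
    rewrite Cmod_mult Cmod_R Rabs_pos_eq; [nra|lra]. }
  nra.
Qed.

(** * The kernel on the rays x / w + i and x / w - i *)

Section Kernel.

Variable w : C.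
Hypothesis hw : 0 < Re w.

Lemma w_neq_0 : w <> 0%C.
Proof. intros E; revert hw; rewrite E; simpl; lra. Qed.

Lemma Re_inv_pos : 0 < Re (/ w).
Proof.
  assert (H := C_neq_0_sqr _ w_neq_0). simpl. apply Rdiv_lt_0_compat; [exact hw|].
  unfold Re, Im in H; lra.
Qed.

Definition ray (e : C) (x : R) : C := (x / w + e)%C.

Definition unit_i (e : C) : Prop := e = Ci \/ e = (- Ci)%C.

Lemma unit_i_pos : unit_i Ci.
Proof. now left. Qed.
Lemma unit_i_neg : unit_i (- Ci).
Proof. now right. Qed.

Lemma Re_ray (e : C) (x : R) : unit_i e -> Re (ray e x) = x * Re (/ w).
Proof.
  intros H. unfold ray, Cdiv. rewrite re_plus re_scal_l.
  destruct H as [-> | ->]; simpl; ring.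
Qed.

Lemma ray_mult (e : C) (x : R) : (ray e x * w)%C = (x + e * w)%C.
Proof. unfold ray. field. apply w_neq_0. Qed.

(** Multiplied by [w], the ray becomes x + e w, whose imaginary part is Re w or - Re w for every
    [x]. *)
Lemma Cmod_ray (e : C) (x : R) : unit_i e -> Re w / Cmod w <= Cmod (ray e x).
Proof.
  intros H. assert (P := w_neq_0). apply Cmod_gt_0 in P.
  apply Rle_div_l; [exact P|]. rewrite -Cmod_mult ray_mult.
  eapply Rle_trans; [|apply im_le_Cmod].
  destruct H as [-> | ->]; rewrite im_plus im_RtoC im_mult; simpl.
  - eapply Rle_trans; [|apply Rle_abs]; lra.
  - rewrite -Rabs_Ropp. eapply Rle_trans; [|apply Rle_abs]; lra.
Qed.

Lemma ray_bound_pos : 0 < Re w / Cmod w.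
Proof. apply Rdiv_lt_0_compat; [exact hw|apply Cmod_gt_0, w_neq_0]. Qed.

Lemma ray_neq_0 (e : C) (x : R) : unit_i e -> ray e x <> 0%C.
Proof.
  intros H; apply Cmod_gt_0. generalize (Cmod_ray e x H) ray_bound_pos; lra.
Qed.

Lemma Re_ray_nonneg (e : C) (x : R) : unit_i e -> 0 <= x -> 0 <= Re (ray e x).
Proof. intros H Hx; rewrite Re_ray //. generalize Re_inv_pos; nra. Qed.

(** The ray has argument at most PI / 2 in absolute value and [w] strictly less, so the sum of the
    arguments stays inside the principal range. *)
Lemma Clog_ray (e : C) (x : R) : unit_i e -> 0 <= x ->
  (Clog (ray e x) + Clog w)%C = Clog (x + e * w).
Proof.
  intros H Hx. rewrite -ray_mult Clog_mult //; [now apply ray_neq_0|apply w_neq_0|].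
  generalize (Carg_right0 _ (Re_ray_nonneg e x H Hx) (ray_neq_0 e x H)) (Carg_right w hw). lra.
Qed.

(* For [x > 0] this is [-(2 / w) int_0^oo e^(-x u / w) cos u Clog (u / w) du]. *)
Definition kernel (x : R) : C :=
  ((Clog (x + Ci * w) + euler_gamma) / (x + Ci * w)
   + (Clog (x + - Ci * w) + euler_gamma) / (x + - Ci * w))%C.

(* The part of that integral over [u > U]. *)
Definition kernel_tail (U x : R) : C :=
  (- (/ w) * (log_tail w (ray Ci x) U + log_tail w (ray (- Ci) x) U))%C.

(** The derivative of [kernel_tail] in [U], with the two rays merged into one cosine. It depends on
    [x] only through an exponential, so its cosine moments are elementary. *)
Definition kernel_slope (U x : R) : C :=
  (2 / w * (cos U * (ln U - Clog w)) * Cexp (- (U * (x / w))))%C.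

Lemma Cexp_ray_sum (U x : R) :
  (Cexp (- (U * ray Ci x)) + Cexp (- (U * ray (- Ci) x)))%C
  = (2 * cos U * Cexp (- (U * (x / w))))%C.
Proof.
  unfold ray.
  replace (- (U * (x / w + Ci)))%C with (- (U * (x / w)) + - (U * Ci))%C by ring.
  replace (- (U * (x / w + - Ci)))%C with (- (U * (x / w)) + (U * Ci))%C by ring.
  rewrite !Cexp_plus.
  assert (E : (Cexp (- (U * Ci)) + Cexp (U * Ci))%C = (2 * cos U)%C).
  { replace (- (U * Ci))%C with ((0, - U) : C) by (apply C_eq; simpl; ring).
    replace (U * Ci)%C with ((0, U) : C) by (apply C_eq; simpl; ring).
    apply C_eq; simpl; rewrite exp_0 ?cos_neg ?sin_neg; ring. }
  transitivity (Cexp (- (U * (x / w))) * (Cexp (- (U * Ci)) + Cexp (U * Ci)))%C; [ring|].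
  rewrite E; ring.
Qed.

Lemma cderiv_kernel_tail (U x : R) : 0 < U -> 0 <= x ->
  cderiv (fun U => kernel_tail U x) U (kernel_slope U x).
Proof.
  intros HU Hx. unfold kernel_tail.
  eapply cderiv_eq; [|apply cderiv_scal, cderiv_plus; apply cderiv_log_tail;
    auto using Re_ray_nonneg, ray_neq_0, unit_i_pos, unit_i_neg].
  unfold kernel_slope.
  transitivity (/ w * (ln U - Clog w) * (Cexp (- (U * ray Ci x)) + Cexp (- (U * ray (- Ci)
    x))))%C; [ring|].
  rewrite Cexp_ray_sum. field. apply w_neq_0.
Qed.

Lemma kernel_tail_at_0 (U x : R) : 0 < U -> 0 <= x ->
  Cmod (kernel_tail U x - kernel x) <=
  / Cmod w * (2 * (U * (Rabs (ln U) + Cmod (Clog w) + 1))).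
Proof.
  intros HU Hx. assert (Nw := w_neq_0).
  assert (N1 := ray_neq_0 Ci x unit_i_pos). assert (N2 := ray_neq_0 _ x unit_i_neg).
  assert (A1 := log_tail_at_0 w _ U (Re_ray_nonneg _ _ unit_i_pos Hx) N1 HU).
  assert (A2 := log_tail_at_0 w _ U (Re_ray_nonneg _ _ unit_i_neg Hx) N2 HU).
  unfold kernel_tail, kernel.
  rewrite !Clog_ray in A1; auto using unit_i_pos. rewrite !Clog_ray in A2; auto using unit_i_neg.
  rewrite -!ray_mult in A1 A2 |- *.
  set (L1 := Clog (ray Ci x * w)) in *. set (L2 := Clog (ray (- Ci) x * w)) in *.
  match goal with |- Cmod ?a <= _ => replace a with
    (- / w * ((log_tail w (ray Ci x) U - - ((L1 + euler_gamma) / ray Ci x))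
            + (log_tail w (ray (- Ci) x) U - - ((L2 + euler_gamma) / ray (- Ci) x))))%C
    by (field; auto) end.
  rewrite Cmod_mult Cmod_opp Cmod_inv //.
  apply Rmult_le_compat_l; [left; apply Rinv_0_lt_compat; now apply Cmod_gt_0|].
  eapply Rle_trans; [apply Cmod_triangle|]. lra.
Qed.

Lemma kernel_tail_le : exists K, 0 <= K /\ forall U x, 1 <= U -> 0 <= x ->
  Cmod (kernel_tail U x) <= K * (ln U + 1) * exp (- (U * Re (/ w) * x)).
Proof.
  assert (Nw := w_neq_0). assert (Pw := Nw). apply Cmod_gt_0 in Pw.
  assert (Pd := ray_bound_pos). set (d := Re w / Cmod w) in *.
  assert (Pid : 0 < / d) by now apply Rinv_0_lt_compat.
  assert (Pl := Cmod_ge_0 (Clog w)).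
  set (B := 1 + Cmod (Clog w) + / d).
  exists (/ Cmod w * (2 * (B / d))).
  assert (PB : 0 <= B / d) by (apply Rle_div_r; unfold B; lra).
  split; [apply Rmult_le_pos; [left; now apply Rinv_0_lt_compat|lra]|].
  intros U x HU Hx. assert (L := ln_le_sqrt U HU).
  assert (A : forall e, unit_i e -> Cmod (log_tail w (ray e x) U) <=
    B / d * (ln U + 1) * exp (- (U * Re (/ w) * x))).
  { intros e He. eapply Rle_trans; [apply (log_tail_le w (ray e x) U d); auto using
      Re_ray_nonneg|].
    - split; [exact Pd|now apply Cmod_ray].
    - rewrite Re_ray //. replace (U * (x * Re (/ w))) with (U * Re (/ w) * x) by ring.
      assert (P := exp_pos (- (U * Re (/ w) * x))). set (E := exp (- (U * Re (/ w) * x))) in *.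
      replace (B / d * (ln U + 1) * E) with (E * (B * (ln U + 1)) * / d) by (unfold Rdiv; ring).
      apply Rmult_le_compat_r; [lra|]. apply Rmult_le_compat_l; [lra|]. unfold B. nra. }
  unfold kernel_tail. rewrite Cmod_mult Cmod_opp Cmod_inv // !Rmult_assoc.
  apply Rmult_le_compat_l; [left; now apply Rinv_0_lt_compat|].
  eapply Rle_trans; [apply Cmod_triangle|].
  generalize (A _ unit_i_pos) (A _ unit_i_neg). rewrite !Rmult_assoc. unfold Rdiv; rewrite
    ?Rmult_assoc. lra.
Qed.

(** Serves only to give continuity in [x], hence integrability, so the value of the derivative is
    left implicit. *)
Lemma ex_cderiv_kernel_tail (U x : R) : 0 < U -> 0 <= x ->
  exists l, cderiv (fun x => kernel_tail U x) x l.
Proof.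
  intros HU Hx. assert (Nw := w_neq_0).
  assert (A : forall e, unit_i e -> exists l, cderiv (fun x => log_tail w (ray e x) U) x l).
  { intros e He. assert (N := ray_neq_0 e x He).
    assert (Dr : cderiv (ray e) x (/ w)).
    { unfold ray. eapply cderiv_eq; [|apply cderiv_plus; [apply cderiv_div; [|apply
        cderiv_id|apply cderiv_const]|apply cderiv_const]].
      - cbv beta; field; exact Nw.
      - exact Nw. }
    eexists. unfold log_tail. apply cderiv_div; [exact N| |exact Dr].
    apply cderiv_plus.
    - apply cderiv_mult; [|apply cderiv_const].
      apply cderiv_Cexp, cderiv_opp, cderiv_scal, Dr.
    - apply (cderiv_ext (fun x => E1 (U * e + x * (U / w)))).
      + intros t; f_equal. unfold ray. field; exact Nw.
      + apply cderiv_E1_affine.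
        replace (U * e + x * (U / w))%C with (U * ray e x)%C by (unfold ray; field; exact Nw).
        destruct (Re_mult_pos (ray e x) U); auto using Re_ray_nonneg. now apply right_slit. }
  destruct (A _ unit_i_pos) as [l1 D1]. destruct (A _ unit_i_neg) as [l2 D2].
  eexists. unfold kernel_tail. apply cderiv_scal, cderiv_plus; eassumption.
Qed.

Lemma slit_pos (e : C) : unit_i e -> slit (e * w).
Proof.
  intros [-> | ->]; right; rewrite im_mult; simpl; lra.
Qed.

Lemma ex_cderiv_kernel (x : R) : 0 <= x -> exists l, cderiv kernel x l.
Proof.
  intros Hx.
  assert (A : forall e, unit_i e -> exists l,
     cderiv (fun x => (Clog (x + e * w) + euler_gamma) / (x + e * w))%C x l).
  { intros e He. assert (S := slit_add _ x (slit_pos e He) Hx).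
    eexists. apply cderiv_div; [now apply slit_neq_0| |apply cderiv_shift].
    apply cderiv_plus; [now apply cderiv_Clog_add|apply cderiv_const]. }
  destruct (A _ unit_i_pos) as [l1 D1]. destruct (A _ unit_i_neg) as [l2 D2].
  eexists. unfold kernel. apply cderiv_plus; eassumption.
Qed.

End Kernel.

(** * Cosine moments of the kernel and the improper integrals *)

Lemma cderiv_lipschitz (f f' : R -> C) (x d L y : R) :
  (forall t, Rabs (t - x) < d -> cderiv f t (f' t)) ->
  (forall t, Rabs (t - x) < d -> Cmod (f' t) <= L) ->
  Rabs (y - x) < d -> Cmod (f y - f x) <= L * Rabs (y - x).
Proof.
  intros Hd HL Hy.
  destruct (Rle_or_lt x y) as [H|H].
  - rewrite (Rabs_pos_eq (y - x)) in Hy |- *; [|lra].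
    eapply Rle_trans; [apply (cderiv_increment_le f f' (fun t => L * t) (fun _ => L)); [exact H| |
      |]|].
    + intros t Ht; apply Hd; rewrite Rabs_pos_eq; lra.
    + intros t _; auto_derive; auto; ring.
    + intros t Ht; apply HL; rewrite Rabs_pos_eq; lra.
    + right; ring.
  - rewrite (Rabs_left (y - x)) in Hy |- *; [|lra]. rewrite Cmod_minus_sym.
    eapply Rle_trans; [apply (cderiv_increment_le f f' (fun t => L * t) (fun _ => L)); [lra| |
      |]|].
    + intros t Ht; apply Hd; rewrite Rabs_left1; lra.
    + intros t _; auto_derive; auto; ring.
    + intros t Ht; apply HL; rewrite Rabs_left1; lra.
    + right; ring.
Qed.

Lemma cderiv_zero_const (f : R -> C) (a b : R) :
  a <= b -> (forall t, a <= t <= b -> cderiv f t 0) -> f b = f a.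
Proof.
  intros Hab H.
  assert (E : Cmod (f b - f a) <= 0 - 0).
  { apply (cderiv_increment_le f (fun _ => RtoC 0) (fun _ => 0) (fun _ => 0) a b Hab H).
    - intros t _; auto_derive; auto.
    - intros t _. rewrite Cmod_0; lra. }
  apply Ceq_minus, Cmod_eq_0. generalize (Cmod_ge_0 (f b - f a)); lra.
Qed.

Lemma x_ln_le_sqrt (u : R) : 0 < u <= 1 -> u * Rabs (ln u) <= 2 * sqrt u.
Proof.
  intros H. assert (P : 0 < sqrt u) by (apply sqrt_lt_R0; lra).
  assert (S : sqrt u * sqrt u = u) by (apply sqrt_sqrt; lra).
  assert (Hi : 1 <= / u) by (rewrite -Rinv_1; apply Rinv_le_contravar; lra).
  destruct (ln_le_sqrt (/ u) Hi) as [l1 l2]. rewrite ln_Rinv in l1 l2; [|lra].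
  rewrite Rabs_left1; [|lra].
  rewrite sqrt_inv in l2.
  apply Rle_trans with (u * (2 * / sqrt u)); [apply Rmult_le_compat_l; lra|].
  right. rewrite -{1}S. field; lra.
Qed.

Lemma cos_2PI_nat (n : nat) : cos (2 * PI * INR n) = 1.
Proof.
  replace (2 * PI * INR n) with (0 + 2 * INR n * PI) by ring. now rewrite cos_period cos_0.
Qed.

Lemma sin_2PI_nat (n : nat) : sin (2 * PI * INR n) = 0.
Proof.
  replace (2 * PI * INR n) with (0 + 2 * INR n * PI) by ring. now rewrite sin_period sin_0.
Qed.

Lemma cos_2PI_nat2 (m k : nat) : cos (2 * PI * INR m * INR k) = 1.
Proof.
  replace (2 * PI * INR m * INR k) with (2 * PI * INR (m * k)) by (rewrite mult_INR; ring).
  apply cos_2PI_nat.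
Qed.

Lemma sin_2PI_nat2 (m k : nat) : sin (2 * PI * INR m * INR k) = 0.
Proof.
  replace (2 * PI * INR m * INR k) with (2 * PI * INR (m * k)) by (rewrite mult_INR; ring).
  apply sin_2PI_nat.
Qed.

(** The sum of squares factors as (u + i z)(u - i z), and the factors have imaginary parts Re z and
    - Re z. *)
Lemma Cmod_sqr_plus_ge (z : C) (u : R) : 0 < Re z -> (Re z) * (Re z) <= Cmod (u ^ 2 + z ^ 2).
Proof.
  intros H.
  replace (u ^ 2 + z ^ 2)%C with ((u + Ci * z) * (u + - Ci * z))%C.
  2:{ transitivity (u * u + - (Ci * Ci) * (z * z))%C; [ring|]. rewrite Ci_sqr. ring. }
  rewrite Cmod_mult. apply Rmult_le_compat; try lra;
    (eapply Rle_trans; [|apply im_le_Cmod]); rewrite im_plus im_RtoC im_mult; simpl.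
  - eapply Rle_trans; [|apply Rle_abs]; lra.
  - rewrite -Rabs_Ropp; eapply Rle_trans; [|apply Rle_abs]; lra.
Qed.

(** After full periods the boundary value at [T] is that at 0 times e^(-T s), so truncation
    multiplies the Laplace transform of the cosine by 1 - e^(-T s). This is the reason for cutting
    the moments at integers. *)
Lemma is_CInt_exp_cos (s : C) (a T : R) :
  0 < Re s -> 0 <= T -> cos (a * T) = 1 -> sin (a * T) = 0 ->
  is_CInt (fun x => Cexp (- (x * s)) * cos (a * x))%C 0 T
    (s * (1 - Cexp (- (T * s))) / (s ^ 2 + a ^ 2)).
Proof.
  intros Hs HT HC HS.
  assert (N : (s ^ 2 + a ^ 2)%C <> 0%C).
  { apply Cmod_gt_0. assert (L := Cmod_sqr_plus_ge s a Hs).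
    replace (s ^ 2 + a ^ 2)%C with (a ^ 2 + s ^ 2)%C by ring. nra. }
  assert (Dc : forall x, cderiv (fun x => RtoC (cos (a * x))) x (RtoC (- a * sin (a * x)))).
  { intros x. apply cderiv_RtoC. auto_derive; auto; ring. }
  assert (Ds : forall x, cderiv (fun x => RtoC (sin (a * x))) x (RtoC (a * cos (a * x)))).
  { intros x. apply cderiv_RtoC. auto_derive; auto; ring. }
  pose (F := fun x : R => (Cexp (- (x * s)) * (a * sin (a * x) - s * cos (a * x)) / (s ^ 2 + a ^
    2))%C).
  eapply is_CInt_eq; [|apply (is_CInt_FTC F); [exact HT| |]].
  - unfold F. rewrite HC HS Rmult_0_r sin_0 cos_0.
    replace (- (0 * s))%C with (RtoC 0) by ring.
    rewrite Cexp_0. field. exact N.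
  - intros x _. unfold F. eapply cderiv_eq; [|apply cderiv_div; [exact N| |apply cderiv_const]].
    2:{ apply cderiv_mult; [apply cderiv_Cexp_neg|].
        apply cderiv_minus; apply cderiv_scal; [apply Ds|apply Dc]. }
    cbv beta. rewrite !RtoC_mult !RtoC_opp. field. exact N.
  - intros x _. eapply cderiv_ccont. apply cderiv_mult; [apply cderiv_Cexp_neg|apply Dc].
Qed.

Definition cosine (m : nat) (x : R) : C := RtoC (cos (2 * PI * INR m * x)).

Lemma cderiv_cosine (m : nat) (x : R) :
  cderiv (cosine m) x (RtoC (- (2 * PI * INR m) * sin (2 * PI * INR m * x))).
Proof. apply cderiv_RtoC. auto_derive; auto; ring. Qed.

Lemma Cmod_cosine_le (m : nat) (x : R) : Cmod (cosine m x) <= 1.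
Proof. unfold cosine; rewrite Cmod_R. apply Rabs_le, COS_bound. Qed.

Lemma is_RInt_Rconst (c a b : R) : is_RInt (fun _ : R => c) a b ((b - a) * c).
Proof. apply (@is_RInt_const R_NormedModule). Qed.

Lemma eq_of_small (x : C) (K : R) : 0 <= K ->
  (forall e, 0 < e <= 1 -> Cmod x <= K * e) -> x = 0%C.
Proof.
  intros HK H. apply Cmod_eq_0. apply Rle_antisym; [|apply Cmod_ge_0].
  apply le_epsilon. intros e He.
  assert (P : 0 < Rmin 1 (e / (K + 1))) by (apply Rmin_pos; [lra|apply Rdiv_lt_0_compat; lra]).
  eapply Rle_trans; [apply (H (Rmin 1 (e / (K + 1))))|].
  - split; [exact P|apply Rmin_l].
  - assert (A := Rmin_r 1 (e / (K + 1))).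
    apply Rle_div_r in A; [|lra]. nra.
Qed.

Lemma is_RInt_exp_decay (c T : R) : 0 < c ->
  is_RInt (fun x => exp (- (c * x))) 0 T ((1 - exp (- (c * T))) / c).
Proof.
  intros Hc. pose (F := fun x => - exp (- (c * x)) / c).
  replace ((1 - exp (- (c * T))) / c) with (F T - F 0).
  2:{ unfold F. rewrite Rmult_0_r Ropp_0 exp_0. field; lra. }
  apply (@is_RInt_derive R_CompleteNormedModule F).
  - intros x _. unfold F. auto_derive; [lra|]. field; lra.
  - intros x _. apply @ex_derive_continuous. auto_derive; auto.
Qed.

Lemma exp_decay_integral_le (c T : R) : 0 < c -> (1 - exp (- (c * T))) / c <= / c.
Proof.
  intros Hc. apply Rle_div_l; [exact Hc|]. rewrite Rinv_l; [|lra].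
  generalize (exp_pos (- (c * T))); lra.
Qed.

Lemma log_over_id_small (K e : R) : 0 <= K -> 0 < e -> exists U0, 1 <= U0 /\ forall U, U0 <= U ->
  K * (ln U + 1) / U < e.
Proof.
  (* For U >= 1, ln U + 1 <= 3 sqrt U, so it suffices that sqrt U exceed 3 K / e. *)
  intros HK He. exists (1 + (3 * K / e) * (3 * K / e)).
  assert (P : 0 <= 3 * K / e) by (apply Rle_div_r; lra).
  split; [nra|]. intros U HU.
  assert (HU1 : 1 <= U) by nra.
  assert (s1 := one_le_sqrt U HU1). assert (L := ln_le_sqrt U HU1).
  assert (S : sqrt U * sqrt U = U) by (apply sqrt_sqrt; lra).
  assert (T : 3 * K / e < sqrt U).
  { rewrite -(sqrt_square (3 * K / e)) //. apply sqrt_lt_1; nra. }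
  apply Rlt_div_l; [lra|]. apply Rlt_div_l in T; [|lra].
  apply Rle_lt_trans with (3 * K * sqrt U); [nra|]. nra.
Qed.

Section Moments.

Variable w : C.
Hypothesis hw : 0 < Re w.

Lemma Clog_ratio (u : R) : 0 < u -> Clog (u / w) = (ln u - Clog w)%C.
Proof.
  intros Hu. assert (N := w_neq_0 w hw).
  unfold Cdiv. rewrite Clog_scal //; [rewrite Clog_inv //; ring|].
  intros E. apply (f_equal Cmod) in E. rewrite Cmod_inv // Cmod_0 in E.
  apply Cmod_gt_0 in N. apply Rinv_0_lt_compat in N. lra.
Qed.

Lemma mw_pos (m : nat) : 0 < Re (2 * PI * INR (S m) * w).
Proof.
  rewrite -!RtoC_mult re_scal_l. apply Rmult_lt_0_compat; [|exact hw].
  apply Rmult_lt_0_compat; [generalize PI_RGT_0; lra|apply lt_0_INR; lia].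
Qed.

Lemma denominator_neq_0 (m : nat) (u : R) : (u ^ 2 + (2 * PI * INR (S m) * w) ^ 2)%C <> 0%C.
Proof.
  apply Cmod_gt_0. generalize (Cmod_sqr_plus_ge _ u (mw_pos m)) (mw_pos m); nra.
Qed.

Lemma ex_cderiv_integrand (m : nat) (u : R) : 0 < u ->
  exists l, cderiv (integrand w (S m)) u l.
Proof.
  intros Hu. assert (Nw := w_neq_0 w hw). eexists. unfold integrand. apply cderiv_div.
  - apply denominator_neq_0.
  - apply cderiv_mult.
    + apply cderiv_mult; [apply cderiv_id|apply cderiv_RtoC; auto_derive; auto].
    + apply cderiv_Clog; [left|apply cderiv_div; [exact Nw|apply cderiv_id|apply cderiv_const]].
      unfold Cdiv. rewrite re_scal_l. apply Rmult_lt_0_compat; [exact Hu|now apply Re_inv_pos].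
  - simpl. apply cderiv_plus; [|apply cderiv_const].
    apply cderiv_mult; [apply cderiv_id|apply cderiv_mult; [apply cderiv_id|apply cderiv_const]].
Qed.

Lemma integrand_le (m : nat) : exists K, 0 < K /\ forall u, 0 < u ->
  Cmod (integrand w (S m) u) <= K * (u * Rabs (ln u) + u * Cmod (Clog w)).
Proof.
  assert (P := mw_pos m). set (z := (2 * PI * INR (S m) * w)%C) in *.
  assert (P2 : 0 < Re z * Re z) by nra.
  exists (/ (Re z * Re z)). split; [now apply Rinv_0_lt_compat|].
  intros u Hu. unfold integrand. fold z. rewrite Clog_ratio //.
  assert (L := Cmod_sqr_plus_ge z u P).
  rewrite Cmod_div; [|apply denominator_neq_0].
  rewrite !Cmod_mult !Cmod_R (Rabs_pos_eq u); [|lra].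
  unfold Rdiv. rewrite Rmult_comm.
  apply Rmult_le_compat; [left; apply Rinv_0_lt_compat; lra| | |].
  - apply Rmult_le_pos; [|apply Cmod_ge_0]. apply Rmult_le_pos; [lra|apply Rabs_pos].
  - now apply Rinv_le_contravar.
  - assert (D : Cmod (ln u - Clog w) <= Rabs (ln u) + Cmod (Clog w)).
    { eapply Rle_trans; [apply Cmod_minus_le|]. rewrite Cmod_R; lra. }
    assert (Cb : Rabs (cos u) <= 1) by (apply Rabs_le; apply COS_bound).
    generalize (Cmod_ge_0 (ln u - Clog w)) (Rabs_pos (cos u)). intros.
    apply Rle_trans with (u * 1 * (Rabs (ln u) + Cmod (Clog w))); [|lra].
    apply Rmult_le_compat; try nra.
Qed.

Lemma integrand_near_0 (m : nat) : exists K, 0 <= K /\ forall u, 0 < u <= 1 ->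
  Cmod (integrand w (S m) u) <= K * sqrt u.
Proof.
  destruct (integrand_le m) as [K [PK B]].
  assert (Pl := Cmod_ge_0 (Clog w)).
  exists (K * (2 + Cmod (Clog w))). split; [apply Rmult_le_pos; lra|].
  intros u Hu. eapply Rle_trans; [apply B; lra|].
  rewrite Rmult_assoc. apply Rmult_le_compat_l; [lra|].
  generalize (x_ln_le_sqrt u Hu) (le_sqrt_01 u Hu). nra.
Qed.

(** The boundary factor e^(-k u / w) left by stopping the integral over [x] at [k]. *)
Definition damping (k : nat) (u : R) : C := Cexp (- (INR k * (u / w))).

Lemma Cmod_damping (k : nat) (u : R) : Cmod (damping k u) = exp (- (INR k * Re (/ w) * u)).
Proof.
  unfold damping, Cdiv. rewrite Cmod_Cexp re_opp !re_scal_l. f_equal; ring.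
Qed.

Lemma Cmod_damping_le_1 (k : nat) (u : R) : 0 <= u -> Cmod (damping k u) <= 1.
Proof.
  intros Hu. rewrite Cmod_damping -exp_0. apply exp_le_compat.
  generalize (Re_inv_pos w hw) (pos_INR k). intros.
  assert (0 <= INR k * Re (/ w) * u) by (apply Rmult_le_pos; [apply Rmult_le_pos|]; lra). lra.
Qed.

Lemma ex_cderiv_damping (k : nat) (u : R) : exists l, cderiv (damping k) u l.
Proof.
  assert (Nw := w_neq_0 w hw).
  eexists. apply cderiv_Cexp, cderiv_opp, cderiv_scal, cderiv_div; [exact Nw|apply cderiv_id|apply
    cderiv_const].
Qed.

Lemma is_CInt_integrand (m : nat) (U : R) : 0 <= U ->
  is_CInt (integrand w (S m)) 0 U (CInt (integrand w (S m)) 0 U).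
Proof.
  intros HU. destruct (integrand_near_0 m) as [K [PK B]].
  apply (is_CInt_right_limit _ _ 0 K HU PK).
  - intros t Ht. destruct (ex_cderiv_integrand m t Ht) as [l D]. now apply (cderiv_ccont _ _ l).
  - intros t Ht. replace (integrand w (S m) t - 0)%C with (integrand w (S m) t) by ring. now apply
      B.
Qed.

Definition damped (m k : nat) (u : R) : C := (integrand w (S m) u * (1 - damping k u))%C.

Lemma ccont_damped (m k : nat) (u : R) : 0 < u -> ccont (damped m k) u.
Proof.
  intros Hu. destruct (ex_cderiv_integrand m u Hu) as [l D].
  destruct (ex_cderiv_damping k u) as [l' D'].
  eapply cderiv_ccont, cderiv_mult; [exact D|apply cderiv_minus; [apply cderiv_const|exact D']].
Qed.

Lemma damped_near_0 (m : nat) : exists K, 0 <= K /\ forall k u, 0 < u <= 1 ->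
  Cmod (damped m k u) <= K * sqrt u.
Proof.
  destruct (integrand_near_0 m) as [K [PK B]].
  exists (2 * K). split; [lra|]. intros k u Hu. unfold damped. rewrite Cmod_mult.
  assert (E : Cmod (1 - damping k u) <= 2).
  { eapply Rle_trans; [apply Cmod_minus_le|]. rewrite Cmod_1.
    generalize (Cmod_damping_le_1 k u). lra. }
  replace (2 * K * sqrt u) with (K * sqrt u * 2) by ring.
  apply Rmult_le_compat; try apply Cmod_ge_0; auto.
Qed.

Lemma is_CInt_damped (m k : nat) (U : R) : 0 <= U ->
  is_CInt (damped m k) 0 U (CInt (damped m k) 0 U).
Proof.
  intros HU. destruct (damped_near_0 m) as [K [PK B]].
  apply (is_CInt_right_limit _ _ 0 K HU PK).
  - intros t Ht. now apply ccont_damped.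
  - intros t Ht. replace (damped m k t - 0)%C with (damped m k t) by ring. now apply B.
Qed.

(** * Moments truncated in both variables *)

Definition tail_moment (m k : nat) (U : R) : C :=
  CInt (fun x => kernel_tail w U x * cosine (S m) x)%C 0 (INR k).

Definition kernel_moment (m k : nat) : C :=
  CInt (fun x => kernel w x * cosine (S m) x)%C 0 (INR k).

Lemma ccont_tail_moment (m : nat) (U x : R) : 0 < U -> 0 <= x ->
  ccont (fun x => kernel_tail w U x * cosine (S m) x)%C x.
Proof.
  intros HU Hx. destruct (ex_cderiv_kernel_tail w hw U x HU Hx) as [l D].
  eapply cderiv_ccont, cderiv_mult; [exact D|apply cderiv_cosine].
Qed.

Lemma ccont_kernel_moment (m : nat) (x : R) : 0 <= x ->
  ccont (fun x => kernel w x * cosine (S m) x)%C x.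
Proof.
  intros Hx. destruct (ex_cderiv_kernel w hw x Hx) as [l D].
  eapply cderiv_ccont, cderiv_mult; [exact D|apply cderiv_cosine].
Qed.

Lemma is_CInt_tail_moment (m k : nat) (U : R) : 0 < U ->
  is_CInt (fun x => kernel_tail w U x * cosine (S m) x)%C 0 (INR k) (tail_moment m k U).
Proof.
  intros HU. apply ccont_ex_CInt; [apply pos_INR|].
  intros x Hx; apply ccont_tail_moment; lra.
Qed.

Lemma is_CInt_kernel_moment (m k : nat) :
  is_CInt (fun x => kernel w x * cosine (S m) x)%C 0 (INR k) (kernel_moment m k).
Proof.
  apply ccont_ex_CInt; [apply pos_INR|].
  intros x Hx; apply ccont_kernel_moment; lra.
Qed.

(** With s = U / w and a = 2 PI (m + 1), clearing w^2 turns s / (s^2 + a^2) into the rational factor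
    of [integrand]. *)
Lemma is_CInt_kernel_slope (m k : nat) (U : R) : 0 < U ->
  is_CInt (fun x => kernel_slope w U x * cosine (S m) x)%C 0 (INR k) (2 * damped m k U).
Proof.
  intros HU. assert (Nw := w_neq_0 w hw).
  assert (Hs : 0 < Re (U / w)).
  { unfold Cdiv. rewrite re_scal_l. apply Rmult_lt_0_compat; [exact HU|now apply Re_inv_pos]. }
  assert (I := is_CInt_scal (2 / w * (cos U * (ln U - Clog w)))%C _ _ _ _
    (is_CInt_exp_cos (U / w) (2 * PI * INR (S m)) (INR k) Hs (pos_INR k) (cos_2PI_nat2 _ _)
      (sin_2PI_nat2 _ _))).
  eapply is_CInt_ext; [apply pos_INR| |eapply is_CInt_eq; [|exact I]].
  - intros x _; cbv beta. unfold kernel_slope, cosine.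
    replace (x * (U / w))%C with (U * (x / w))%C by (field; exact Nw). ring.
  - unfold damped, damping, integrand. rewrite Clog_ratio //.
    assert (N1 := denominator_neq_0 m U).
    assert (Ea : (2 * PI * INR (S m))%C = RtoC (2 * PI * INR (S m))) by now rewrite !RtoC_mult.
    rewrite !Ea in N1 |- *. clear I Ea. generalize dependent (2 * PI * INR (S m)). intros a N1.
    assert (N2 : ((U / w) ^ 2 + a ^ 2)%C <> 0%C).
    { intros E. apply N1.
      replace (U ^ 2 + (a * w) ^ 2)%C
        with (w ^ 2 * ((U / w) ^ 2 + a ^ 2))%C by (field; exact Nw).
      rewrite E; ring. }
    field; auto.
Qed.

Definition kernel_slope_deriv (U x : R) : C :=
  (2 / w * ((- sin U * (ln U - Clog w) + cos U / U) * Cexp (- (U * (x / w)))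
            - cos U * (ln U - Clog w) * (x / w * Cexp (- (U * (x / w))))))%C.

Lemma cderiv_kernel_slope (U x : R) : 0 < U ->
  cderiv (fun U => kernel_slope w U x) U (kernel_slope_deriv U x).
Proof.
  intros HU. unfold kernel_slope.
  assert (NU : RtoC U <> 0%C) by (apply RtoC_neq_0; lra).
  assert (Nw := w_neq_0 w hw).
  eapply cderiv_eq; [|apply cderiv_mult; [apply cderiv_mult; [apply cderiv_const|
    apply cderiv_mult; [apply cderiv_RtoC; auto_derive; [auto|reflexivity]|
    apply cderiv_minus; [apply cderiv_RtoC, is_derive_ln, HU|apply cderiv_const]]]|
    apply cderiv_Cexp_neg]].
  cbv beta. unfold kernel_slope_deriv.
  rewrite RtoC_mult RtoC_opp RtoC_inv; [|lra]. field; auto.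
Qed.

Lemma Cmod_Cexp_ray_le_1 (U x : R) : 0 <= U -> 0 <= x -> Cmod (Cexp (- (U * (x / w)))) <= 1.
Proof.
  intros HU Hx. rewrite Cmod_Cexp -exp_0. apply exp_le_compat.
  unfold Cdiv. rewrite re_opp !re_scal_l. generalize (Re_inv_pos w hw). intros.
  assert (0 <= U * (x * Re (/ w))) by (apply Rmult_le_pos; [lra|apply Rmult_le_pos; lra]). lra.
Qed.

(** A local bound on the second derivative in [U], uniform in [x], provides the Lipschitz constant
    for differentiating the truncated moment under the integral sign. *)
Lemma kernel_slope_deriv_le (U X : R) : 0 < U -> 0 <= X ->
  exists L, forall V x, Rabs (V - U) < U / 2 -> 0 <= x <= X ->
    Cmod (kernel_slope_deriv V x) <= L.
Proof.
  intros HU HX. assert (Nw := w_neq_0 w hw). assert (Pw := Nw). apply Cmod_gt_0 in Pw.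
  assert (Pl := Cmod_ge_0 (Clog w)).
  (* For |V - U| < U / 2 the point [V] lies between U / 2 and 2 U, so |ln V| is bounded by the
     values at those two ends. *)
  set (B := Rabs (ln (U / 2)) + Rabs (ln (2 * U)) + Cmod (Clog w)).
  exists (2 / Cmod w * ((B + 2 / U) * 1 + B * (X / Cmod w * 1))).
  intros V x HV Hx. apply Rabs_lt_between in HV.
  assert (HB : Cmod (ln V - Clog w) <= B).
  { eapply Rle_trans; [apply Cmod_minus_le|]. rewrite Cmod_R. unfold B.
    apply Rplus_le_compat_r.
    assert (l1 : ln (U / 2) <= ln V) by (apply ln_le; lra).
    assert (l2 : ln V <= ln (2 * U)) by (apply ln_le; lra).
    split_Rabs; lra. }
  assert (PB : 0 <= B) by (unfold B; generalize (Rabs_pos (ln (U / 2))) (Rabs_pos (ln (2 * U)));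
    lra).
  assert (HE := Cmod_Cexp_ray_le_1 V x ltac:(lra) ltac:(lra)).
  assert (PE := Cmod_ge_0 (Cexp (- (V * (x / w))))).
  assert (Hc : Cmod (cos V) <= 1) by (rewrite Cmod_R; apply Rabs_le, COS_bound).
  assert (Hs : Cmod (- sin V) <= 1) by (rewrite Cmod_opp Cmod_R; apply Rabs_le, SIN_bound).
  assert (NV : RtoC V <> 0%C) by (apply RtoC_neq_0; lra).
  unfold kernel_slope_deriv. rewrite Cmod_mult Cmod_div // Cmod_R Rabs_pos_eq; [|lra].
  apply Rmult_le_compat_l; [apply Rle_div_r; lra|].
  eapply Rle_trans; [apply Cmod_minus_le|]. apply Rplus_le_compat; rewrite Cmod_mult.
  - apply Rmult_le_compat; try apply Cmod_ge_0; auto.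
    eapply Rle_trans; [apply Cmod_triangle|]. apply Rplus_le_compat.
    + rewrite Cmod_mult. replace B with (1 * B) by ring.
      apply Rmult_le_compat; try apply Cmod_ge_0; auto.
    + rewrite Cmod_div // (Cmod_R V) Rabs_pos_eq; [|lra].
      replace (2 / U) with (1 * / (U / 2)) by (field; lra).
      apply Rmult_le_compat; [apply Cmod_ge_0|left; apply Rinv_0_lt_compat; lra|exact Hc|].
      apply Rinv_le_contravar; lra.
  - apply Rmult_le_compat; try apply Cmod_ge_0.
    + rewrite Cmod_mult. replace B with (1 * B) by ring.
      apply Rmult_le_compat; try apply Cmod_ge_0; auto.
    + rewrite Cmod_mult Cmod_div // Cmod_R Rabs_pos_eq; [|lra].
      apply Rmult_le_compat; auto.
      * apply Rle_div_r; lra.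
      * apply Rmult_le_compat_r; [left; now apply Rinv_0_lt_compat|lra].
Qed.

Lemma cderiv_tail_moment (m k : nat) (U : R) : 0 < U ->
  cderiv (tail_moment m k) U (2 * damped m k U).
Proof.
  intros HU.
  destruct (kernel_slope_deriv_le U (INR k) HU (pos_INR k)) as [L HL].
  eapply cderiv_eq; [apply is_CInt_unique, is_CInt_kernel_slope, HU|].
  assert (HP : forall V, Rabs (V - U) < U / 2 -> 0 < V) by (intros V HV; apply Rabs_lt_between in
    HV; lra).
  unfold tail_moment.
  apply (cderiv_CInt_param (fun V x => kernel_tail w V x * cosine (S m) x)%C
    (fun V x => kernel_slope w V x * cosine (S m) x)%C 0 (INR k) U (U / 2) L); [apply pos_INR|lra|
      | | |].
  - intros V x HV Hx. eapply cderiv_eq; [|apply cderiv_mult; [apply cderiv_kernel_tail; [exact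
      hw|now apply HP|lra]|apply cderiv_const]].
    cbv beta; ring.
  - intros V x HV Hx.
    replace (kernel_slope w V x * cosine (S m) x - kernel_slope w U x * cosine (S m) x)%C
      with ((kernel_slope w V x - kernel_slope w U x) * cosine (S m) x)%C by ring.
    rewrite Cmod_mult.
    assert (A : Cmod (kernel_slope w V x - kernel_slope w U x) <= L * Rabs (V - U)).
    { apply (cderiv_lipschitz (fun U => kernel_slope w U x) (fun U => kernel_slope_deriv U x) U (U
        / 2)); auto.
      intros t Ht; apply cderiv_kernel_slope; auto. }
    generalize (Cmod_cosine_le (S m) x) (Cmod_ge_0 (cosine (S m) x))
      (Cmod_ge_0 (kernel_slope w V x - kernel_slope w U x)). nra.
  - intros V x HV Hx. apply ccont_tail_moment; [now apply HP|lra].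
  - intros x Hx. assert (Nw := w_neq_0 w hw). eapply cderiv_ccont, cderiv_mult; [|apply
      cderiv_cosine].
    unfold kernel_slope. apply cderiv_scal, cderiv_Cexp, cderiv_opp, cderiv_scal.
    apply cderiv_div; [exact Nw|apply cderiv_id|apply cderiv_const].
Qed.

Lemma tail_moment_near_0 (m k : nat) : exists K, 0 <= K /\ forall U, 0 < U <= 1 ->
  Cmod (tail_moment m k U - kernel_moment m k) <= K * sqrt U.
Proof.
  assert (Nw := w_neq_0 w hw). assert (Pw := Nw). apply Cmod_gt_0 in Pw.
  assert (Pl := Cmod_ge_0 (Clog w)).
  assert (Pi : 0 < / Cmod w) by now apply Rinv_0_lt_compat.
  set (B := 3 + Cmod (Clog w)).
  exists (INR k * (/ Cmod w * (2 * B))). split.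
  { apply Rmult_le_pos; [apply pos_INR|apply Rmult_le_pos; unfold B; lra]. }
  intros U HU.
  apply (is_CInt_norm_le (fun x => (kernel_tail w U x * cosine (S m) x) - kernel w x * cosine (S
    m) x)%C
    (fun _ => / Cmod w * (2 * B) * sqrt U) 0 (INR k)); [apply pos_INR| | |].
  - apply is_CInt_minus; [apply is_CInt_tail_moment; lra|apply is_CInt_kernel_moment].
  - replace (INR k * (/ Cmod w * (2 * B)) * sqrt U) with ((INR k - 0) * (/ Cmod w * (2 * B) * sqrt
      U)) by ring.
    apply is_RInt_Rconst.
  - intros x Hx.
    replace (kernel_tail w U x * cosine (S m) x - kernel w x * cosine (S m) x)%C
      with ((kernel_tail w U x - kernel w x) * cosine (S m) x)%C by ring.
    rewrite Cmod_mult.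
    assert (A := kernel_tail_at_0 w hw U x ltac:(lra) ltac:(lra)).
    apply Rle_trans with (Cmod (kernel_tail w U x - kernel w x) * 1).
    { apply Rmult_le_compat_l; [apply Cmod_ge_0|apply Cmod_cosine_le]. }
    rewrite Rmult_1_r. eapply Rle_trans; [exact A|]. rewrite !Rmult_assoc.
    apply Rmult_le_compat_l; [lra|]. apply Rmult_le_compat_l; [lra|].
    unfold B. generalize (x_ln_le_sqrt U HU) (le_sqrt_01 U HU). nra.
Qed.

(* Fubini on [x < k], [u < U], obtained by differentiating in [U]. *)
Lemma tail_moment_identity (m k : nat) (U : R) : 0 < U ->
  tail_moment m k U = (kernel_moment m k + 2 * CInt (damped m k) 0 U)%C.
Proof.
  intros HU.
  destruct (tail_moment_near_0 m k) as [K1 [P1 B1]].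
  destruct (damped_near_0 m) as [K2 [P2 B2]].
  pose (D := fun U => (tail_moment m k U - 2 * CInt (damped m k) 0 U)%C).
  assert (HD : forall t, 0 < t -> cderiv D t 0).
  { intros t Ht. eapply cderiv_eq; [|apply cderiv_minus; [now apply cderiv_tail_moment|apply
      cderiv_scal, cderiv_CInt_upper;
      [exact Ht|intros; apply is_CInt_damped; lra|now apply ccont_damped]]]. ring. }
  apply Ceq_minus.
  apply (eq_of_small _ (K1 + 2 * K2)); [lra|].
  intros e He.
  (* [D] is constant, so it is evaluated near 0 instead of at [U]. The choice V <= e^2 turns the
     error of order sqrt V there into one of order [e]. *)
  assert (Se : exists V, 0 < V <= 1 /\ V <= U /\ sqrt V <= e /\ V <= e).
  { exists (Rmin (e * e) U). assert (0 < Rmin (e * e) U) by (apply Rmin_pos; nra).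
    generalize (Rmin_l (e * e) U) (Rmin_r (e * e) U). intros.
    repeat split; try nra.
    apply Rle_trans with (sqrt (e * e)); [now apply sqrt_le_1_alt|rewrite sqrt_square; lra]. }
  destruct Se as [V [HV [HVU [HVe HVe']]]].
  assert (E : D U = D V).
  { apply (cderiv_zero_const D V U HVU). intros t Ht; apply HD; lra. }
  replace (tail_moment m k U - (kernel_moment m k + 2 * CInt (damped m k) 0 U))%C
    with (D U - kernel_moment m k)%C by (unfold D; ring).
  rewrite E. unfold D.
  replace (tail_moment m k V - 2 * CInt (damped m k) 0 V - kernel_moment m k)%C
    with ((tail_moment m k V - kernel_moment m k) - 2 * CInt (damped m k) 0 V)%C by ring.
  eapply Rle_trans; [apply Cmod_minus_le|]. rewrite Cmod_mult Cmod_R Rabs_pos_eq; [|lra].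
  assert (A1 := B1 V HV).
  assert (A2 : Cmod (CInt (damped m k) 0 V) <= (V - 0) * K2).
  { apply (is_CInt_norm_le (damped m k) (fun _ => K2) 0 V); [lra|apply is_CInt_damped; lra|apply
      is_RInt_Rconst|].
    intros t Ht. eapply Rle_trans; [apply B2; lra|].
    assert (sqrt t <= 1) by (rewrite -sqrt_1; apply sqrt_le_1_alt; lra).
    generalize (sqrt_pos t); nra. }
  assert (K1 * sqrt V <= K1 * e) by now apply Rmult_le_compat_l.
  nra.
Qed.

(** The cosine is bounded by 1 and the exponential of [kernel_tail_le] is integrated over [x], which
    gains 1 / U and makes the bound independent of [m] and [k]. *)
Lemma tail_moment_le : exists K, 0 <= K /\ forall m k U, 1 <= U ->
  Cmod (tail_moment m k U) <= K * (ln U + 1) / U.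
Proof.
  destruct (kernel_tail_le w hw) as [K [PK B]].
  assert (Pc := Re_inv_pos w hw). assert (Pic : 0 < / Re (/ w)) by now apply Rinv_0_lt_compat.
  exists (K * / Re (/ w)). split; [apply Rmult_le_pos; lra|].
  intros m k U HU. assert (L := ln_le_sqrt U HU).
  assert (PUc : 0 < U * Re (/ w)) by (apply Rmult_lt_0_compat; lra).
  eapply Rle_trans; [apply (is_CInt_norm_le _ (fun x => K * (ln U + 1) * exp (- (U * Re (/ w) *
    x))) 0 (INR k) _
     (K * (ln U + 1) * ((1 - exp (- (U * Re (/ w) * INR k))) / (U * Re (/ w)))) (pos_INR k)
     (is_CInt_tail_moment m k U ltac:(lra)))|].
  - apply (@is_RInt_scal R_NormedModule). now apply is_RInt_exp_decay.
  - intros x Hx. rewrite Cmod_mult.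
    apply Rle_trans with (Cmod (kernel_tail w U x) * 1).
    { apply Rmult_le_compat_l; [apply Cmod_ge_0|apply Cmod_cosine_le]. }
    rewrite Rmult_1_r. apply B; lra.
  - replace (K * / Re (/ w) * (ln U + 1) / U) with (K * (ln U + 1) * / (U * Re (/ w))) by (field;
      lra).
    apply Rmult_le_compat_l; [apply Rmult_le_pos; lra|]. now apply exp_decay_integral_le.
Qed.

(** On (0, U) the integrand is bounded by a constant depending on [U], and the modulus of the
    damping factor has integral O(1 / k). *)
Lemma damped_limit (m : nat) (U : R) : 1 <= U -> exists K, 0 <= K /\ forall k,
  Cmod (CInt (damped m (S k)) 0 U - CInt (integrand w (S m)) 0 U) <= K / INR (S k).
Proof.
  intros HU. destruct (integrand_le m) as [K [PK B]].
  assert (Pl := Cmod_ge_0 (Clog w)). assert (L := ln_le_sqrt U HU).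
  assert (Pc := Re_inv_pos w hw). assert (Pic : 0 < / Re (/ w)) by now apply Rinv_0_lt_compat.
  set (M := K * (2 + U * ln U + U * Cmod (Clog w))).
  assert (PM : 0 <= M).
  { apply Rmult_le_pos; [lra|]. assert (0 <= U * ln U) by (apply Rmult_le_pos; lra).
    assert (0 <= U * Cmod (Clog w)) by (apply Rmult_le_pos; lra). lra. }
  assert (BM : forall u, 0 < u < U -> Cmod (integrand w (S m) u) <= M).
  { intros u Hu. eapply Rle_trans; [apply B; lra|]. apply Rmult_le_compat_l; [lra|].
    apply Rplus_le_compat; [|apply Rmult_le_compat_r; lra].
    assert (0 <= U * ln U) by (apply Rmult_le_pos; lra).
    destruct (Rle_or_lt u 1) as [H1|H1].
    - assert (sqrt u <= 1) by (rewrite -sqrt_1; apply sqrt_le_1_alt; lra).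
      generalize (x_ln_le_sqrt u); lra.
    - assert (l1 : 0 <= ln u) by (rewrite -ln_1; apply ln_le; lra).
      assert (l2 : ln u <= ln U) by (apply ln_le; lra).
      rewrite Rabs_pos_eq //. apply Rle_trans with (U * ln U); [apply Rmult_le_compat; lra|lra]. }
  exists (M * / Re (/ w)). split; [apply Rmult_le_pos; lra|].
  intros k. assert (Pk : 0 < INR (S k)) by (apply lt_0_INR; lia).
  assert (Pkc : 0 < INR (S k) * Re (/ w)) by (apply Rmult_lt_0_compat; lra).
  eapply Rle_trans; [apply (is_CInt_norm_le _ (fun u => M * exp (- (INR (S k) * Re (/ w) * u))) 0
    U _
     (M * ((1 - exp (- (INR (S k) * Re (/ w) * U))) / (INR (S k) * Re (/ w)))) ltac:(lra)
     (is_CInt_minus _ _ _ _ _ _ (is_CInt_damped m (S k) U ltac:(lra)) (is_CInt_integrand m U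
       ltac:(lra))))|].
  - apply (@is_RInt_scal R_NormedModule). now apply is_RInt_exp_decay.
  - intros u Hu. unfold damped.
    replace (integrand w (S m) u * (1 - damping (S k) u) - integrand w (S m) u)%C
      with (- (integrand w (S m) u * damping (S k) u))%C by ring.
    rewrite Cmod_opp Cmod_mult Cmod_damping.
    apply Rmult_le_compat_r; [left; apply exp_pos|now apply BM].
  - replace (M * / Re (/ w) / INR (S k)) with (M * / (INR (S k) * Re (/ w))) by (field; split;
      apply Rgt_not_eq; assumption).
    apply Rmult_le_compat_l; [lra|]. now apply exp_decay_integral_le.
Qed.

(* The first error term is uniform in [k] and the second vanishes as [k -> oo]
   for fixed [U]; this is how conditional convergence is handled. *)
Lemma moment_estimate : exists K, 0 <= K /\ forall m U, 1 <= U -> exists K', 0 <= K' /\ forall k,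
  Cmod (kernel_moment m (S k) + 2 * CInt (integrand w (S m)) 0 U) <= K * (ln U + 1) / U + K' / INR
    (S k).
Proof.
  destruct tail_moment_le as [K [PK B]]. exists K; split; [exact PK|].
  intros m U HU. destruct (damped_limit m U HU) as [K' [PK' B']].
  exists (2 * K'). split; [lra|]. intros k.
  replace (kernel_moment m (S k) + 2 * CInt (integrand w (S m)) 0 U)%C
    with (tail_moment m (S k) U - 2 * (CInt (damped m (S k)) 0 U - CInt (integrand w (S m)) 0 U))%C
    by (rewrite tail_moment_identity; [ring|lra]).
  eapply Rle_trans; [apply Cmod_minus_le|]. rewrite Cmod_mult Cmod_R Rabs_pos_eq; [|lra].
  generalize (B m (S k) U HU) (B' k). unfold Rdiv. nra.
Qed.

Lemma kernel_moment_converges : exists K, 0 <= K /\ forall m, exists s : C,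
  clim (kernel_moment m) s /\
  forall U, 1 <= U -> Cmod (s + 2 * CInt (integrand w (S m)) 0 U) <= K * (ln U + 1) / U.
Proof.
  destruct moment_estimate as [K [PK B]]. exists K; split; [exact PK|]. intros m.
  assert (HC : exists l, clim (fun k => kernel_moment m (S k)) l).
  (* [U] is chosen first, from the error uniform in [k], and only then the rank from the other
     error. The truncated integral is common to both moments and cancels; four errors below e / 4
     remain. *)
  { apply clim_cauchy. intros e. destruct (log_over_id_small K (e / 4) PK) as [U [HU LU]].
    { generalize (cond_pos e); lra. }
    destruct (B m U HU) as [K' [PK' B']].
    assert (Lim := is_lim_seq_inv_S K'). apply is_lim_seq_spec in Lim.
    destruct (Lim (mkposreal (e / 4) ltac:(generalize (cond_pos e); lra))) as [N HN].
    exists N. intros n p Hn Hp.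
    set (c := (2 * CInt (integrand w (S m)) 0 U)%C) in *.
    replace (kernel_moment m (S n) - kernel_moment m (S p))%C with
      ((kernel_moment m (S n) + c) - (kernel_moment m (S p) + c))%C by ring.
    eapply Rle_lt_trans; [apply Cmod_minus_le|].
    generalize (LU U (Rle_refl U)) (B' n) (B' p) (HN n Hn) (HN p Hp). simpl.
    intros A1 A2 A3 A4 A5. rewrite Rminus_0_r in A4 A5.
    apply (Rle_lt_trans _ _ _ (Rle_abs _)) in A4. apply (Rle_lt_trans _ _ _ (Rle_abs _)) in A5.
    fold (INR (S n)) in *. fold (INR (S p)) in *. lra. }
  destruct HC as [l Hl]. exists l. split; [now apply clim_unshift|].
  intros U HU. destruct (B m U HU) as [K' [PK' B']].
  set (c := (2 * CInt (integrand w (S m)) 0 U)%C) in *.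
  assert (LL := clim_plus _ _ _ _ Hl (clim_const c)).
  assert (Q : Rbar_le (Cmod (l + c)) (K * (ln U + 1) / U + 0 + 0)).
  { eapply (is_lim_seq_le (fun _ => Cmod (l + c)) (fun k => K * (ln U + 1) / U + K' / INR (S k) +
        Cmod (kernel_moment m (S k) + c - (l + c)))).
    - intros k. generalize (B' k) (Cmod_minus_le (kernel_moment m (S k) + c)
        (kernel_moment m (S k) + c - (l + c))).
      replace (kernel_moment m (S k) + c - (kernel_moment m (S k) + c - (l + c)))%C
        with (l + c)%C by ring. lra.
    - apply is_lim_seq_const.
    - apply is_lim_seq_plus'; [|exact LL].
      apply is_lim_seq_plus'; [apply is_lim_seq_const|apply is_lim_seq_inv_S]. }
  simpl in Q. lra.
Qed.

Lemma is_RInt_gen_integrand (m : nat) (s : C) (K : R) : 0 <= K ->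
  (forall U, 1 <= U -> Cmod (s + 2 * CInt (integrand w (S m)) 0 U) <= K * (ln U + 1) / U) ->
  @is_RInt_gen C_R_NormedModule (integrand w (S m)) (at_point 0) (Rbar_locally p_infty) (- s /
    2)%C.
Proof.
  intros PK H P [eps HP].
  destruct (log_over_id_small K eps PK (cond_pos eps)) as [U0 [HU0 LU]].
  apply (Filter_prod _ _ _ (fun x => x = 0) (fun y => U0 < y)).
  - reflexivity.
  - now exists U0.
  - intros x y -> Hy. exists (CInt (integrand w (S m)) 0 y). split.
    + destruct (is_CInt_integrand m y) as [I1 I2]; [lra|].
      apply (is_RInt_fct_extend_pair (U := R_NormedModule) (V := R_NormedModule)); [exact I1|exact
        I2].
    + apply HP. apply C_NormedModule_mixin_compat1.
      change (Cmod (CInt (integrand w (S m)) 0 y - - s / 2) < eps).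
      replace (CInt (integrand w (S m)) 0 y - - s / 2)%C
        with ((s + 2 * CInt (integrand w (S m)) 0 y) / 2)%C by (field).
      rewrite Cmod_div; [|apply RtoC_neq_0; lra]. rewrite (Cmod_R 2) Rabs_pos_eq; [|lra].
      generalize (H y ltac:(lra)) (LU y ltac:(lra)) (Cmod_ge_0 (s + 2 * CInt (integrand w (S m)) 0
        y)). lra.
Qed.

Lemma improper_int_integrand (m : nat) (s : C) (K : R) : 0 <= K ->
  (forall U, 1 <= U -> Cmod (s + 2 * CInt (integrand w (S m)) 0 U) <= K * (ln U + 1) / U) ->
  ex_improper_int (integrand w (S m)) /\
  improper_int (integrand w (S m)) = (- s / 2)%C.
Proof.
  intros PK H. assert (I := is_RInt_gen_integrand m s K PK H). split.
  - now exists (- s / 2)%C.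
  - unfold improper_int.
    apply (@is_RInt_gen_unique C_R_CompleteNormedModule (at_point 0) (Rbar_locally p_infty) _ _
      (integrand w (S m)) (- s / 2)%C I).
Qed.

End Moments.

(** * Poisson summation on a half-line *)

(** The Dirichlet kernel of period 1: integrating against it adds the plain integral and twice the
    first [M] cosine moments. *)
Fixpoint dirichlet (M : nat) (x : R) : R :=
  match M with
  | O => 1
  | S p => dirichlet p x + 2 * cos (2 * PI * INR (S p) * x)
  end.

(** The primitive of [dirichlet M] that vanishes at 1 / 2. On (0, 1) it is x - 1 / 2 minus its
    Fourier partial sum, hence small away from the integers. *)
Fixpoint sawtooth (M : nat) (x : R) : R :=
  match M with
  | O => x - 1 / 2
  | S p => sawtooth p x + sin (2 * PI * INR (S p) * x) / (PI * INR (S p))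
  end.

Lemma INR_S_pos (n : nat) : 0 < INR (S n).
Proof. apply lt_0_INR; lia. Qed.

Lemma is_derive_sawtooth (M : nat) (x : R) : is_derive (sawtooth M) x (dirichlet M x).
Proof.
  induction M as [|M IH]; cbn [sawtooth dirichlet].
  - auto_derive; auto; ring.
  - apply is_derive_Rplus; [exact IH|].
    generalize (INR_S_pos M). generalize (INR (S M)). intros c Hc.
    assert (P := PI_RGT_0). auto_derive; auto. field; lra.
Qed.

Lemma ex_derive_dirichlet (M : nat) (x : R) : ex_derive (dirichlet M) x.
Proof.
  induction M as [|M IH]; cbn [dirichlet].
  - auto_derive; auto.
  - apply (@ex_derive_plus R_AbsRing R_NormedModule); [exact IH|].
    generalize (INR (S M)). intros c. auto_derive; auto.
Qed.

Lemma dirichlet_closed (M : nat) (x : R) :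
  dirichlet M x * sin (PI * x) = sin (INR (2 * M + 1) * (PI * x)).
Proof.
  induction M as [|M IH]; cbn [dirichlet].
  - rewrite Rmult_1_l. f_equal. simpl. ring.
  - rewrite Rmult_plus_distr_r IH.
    set (y := 2 * PI * INR (S M) * x).
    replace (INR (2 * S M + 1) * (PI * x)) with (y + PI * x).
    2:{ unfold y. rewrite plus_INR mult_INR. simpl (INR 2). simpl (INR 1). ring. }
    replace (INR (2 * M + 1) * (PI * x)) with (y - PI * x).
    2:{ unfold y. rewrite plus_INR mult_INR S_INR. simpl (INR 2). simpl (INR 1). ring. }
    rewrite sin_plus sin_minus. ring.
Qed.

Lemma dirichlet_le (M : nat) (x : R) : Rabs (dirichlet M x) <= INR (2 * M + 1).
Proof.
  induction M as [|M IH]; cbn [dirichlet].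
  - simpl. rewrite Rabs_R1; lra.
  - replace (2 * S M + 1)%nat with (S (S (2 * M + 1))) by lia.
    assert (B : Rabs (cos (2 * PI * INR (S M) * x)) <= 1) by apply Rabs_le, COS_bound.
    revert B. generalize (cos (2 * PI * INR (S M) * x)). intros c B.
    rewrite !S_INR. eapply Rle_trans; [apply Rabs_triang|].
    rewrite Rabs_mult (Rabs_pos_eq 2); lra.
Qed.

Lemma sawtooth_0 (M : nat) : sawtooth M 0 = - (1 / 2).
Proof.
  induction M as [|M IH]; cbn [sawtooth]; [lra|].
  rewrite IH Rmult_0_r sin_0. lra.
Qed.

Lemma sin_nat_PI (n : nat) : sin (INR n * PI) = 0.
Proof.
  induction n as [|n IH]; [simpl; now rewrite Rmult_0_l sin_0|].
  rewrite S_INR Rmult_plus_distr_r Rmult_1_l neg_sin IH. ring.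
Qed.

Lemma sawtooth_half (M : nat) : sawtooth M (1 / 2) = 0.
Proof.
  induction M as [|M IH]; cbn [sawtooth]; [lra|].
  rewrite IH. replace (2 * PI * INR (S M) * (1 / 2)) with (INR (S M) * PI) by field.
  rewrite sin_nat_PI. lra.
Qed.

Lemma real_increment_le (f f' b b' : R -> R) (x y : R) : x <= y ->
  (forall t, x <= t <= y -> is_derive f t (f' t)) ->
  (forall t, x <= t <= y -> is_derive b t (b' t)) ->
  (forall t, x <= t <= y -> Rabs (f' t) <= b' t) ->
  Rabs (f y - f x) <= b y - b x.
Proof.
  intros Hxy Hf Hb Hle. rewrite -Cmod_R RtoC_minus.
  apply (cderiv_increment_le (fun t => RtoC (f t)) (fun t => RtoC (f' t)) b b'); auto.
  - intros t Ht; apply cderiv_RtoC; auto.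
  - intros t Ht; rewrite Cmod_R; auto.
Qed.

(** Obtained from the trivial bound on [dirichlet]; meant for x below 1 / (2 M + 1), where
    [sawtooth_le] blows up. *)
Lemma sawtooth_small (M : nat) (x : R) : 0 <= x -> Rabs (sawtooth M x) <= 1 / 2 + INR (2 * M + 1)
  * x.
Proof.
  intros Hx.
  assert (E : Rabs (sawtooth M x - sawtooth M 0) <= INR (2 * M + 1) * x - INR (2 * M + 1) * 0).
  { apply (real_increment_le (sawtooth M) (dirichlet M) (fun t => INR (2 * M + 1) * t) (fun _ =>
      INR (2 * M + 1))); auto.
    - intros t _; apply is_derive_sawtooth.
    - intros t _. generalize (INR (2 * M + 1)). intros c. auto_derive; auto; ring.
    - intros t _; apply dirichlet_le. }
  rewrite sawtooth_0 in E. revert E. split_Rabs; lra.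
Qed.

(** With t = y / 2 <= PI / 4, sin y = 2 sin t cos t >= 2 t cos^2 t >= t, using t cos t <= sin t and
    cos^2 t >= 1 / 2. *)
Lemma sin_ge_half (y : R) : 0 <= y <= PI / 2 -> y / 2 <= sin y.
Proof.
  intros Hy. assert (P := PI_RGT_0). set (t := y / 2).
  assert (Ht : 0 <= t <= PI / 4) by (unfold t; lra).
  assert (A : 0 * cos 0 - sin 0 >= t * cos t - sin t).
  { assert (E : - (0 * cos 0 - sin 0) <= - (t * cos t - sin t)).
    { apply (MVT_le (fun t => - (t * cos t - sin t)) (fun t => t * sin t)); [lra| |].
      - intros s _. auto_derive; auto; ring.
      - intros s Hs. apply Rmult_le_pos; [lra|]. apply sin_ge_0; lra. }
    lra. }
  rewrite sin_0 in A.
  replace (sin y) with (sin (2 * t)) by (f_equal; unfold t; field). rewrite sin_2a.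
  assert (C4 : 1 / sqrt 2 <= cos t).
  { rewrite -cos_PI4. apply cos_decr_1; lra. }
  assert (S2 : sqrt 2 * sqrt 2 = 2) by (apply sqrt_sqrt; lra).
  assert (P2 : 0 < sqrt 2) by (apply sqrt_lt_R0; lra).
  assert (C5 : 1 / 2 <= cos t * cos t).
  { replace (1 / 2) with ((1 / sqrt 2) * (1 / sqrt 2)).
    2:{ transitivity (1 / (sqrt 2 * sqrt 2)); [field; lra|now rewrite S2]. }
    assert (0 < 1 / sqrt 2) by (apply Rdiv_lt_0_compat; lra).
    apply Rmult_le_compat; lra. }
  assert (0 < 1 / sqrt 2) by (apply Rdiv_lt_0_compat; lra).
  nra.
Qed.

Lemma cos_odd_PI2 (M : nat) : cos (INR (2 * M + 1) * (PI * (1 / 2))) = 0.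
Proof.
  replace (INR (2 * M + 1) * (PI * (1 / 2))) with (INR M * PI + PI / 2).
  2:{ rewrite plus_INR mult_INR. simpl (INR 2). simpl (INR 1). field. }
  rewrite cos_plus sin_nat_PI cos_PI2. ring.
Qed.

(* Integrating the closed form [sin (N PI x) / sin (PI x)] of the derivative by
   parts from [x] to [1 / 2] gains the factor [1 / N]. *)
Lemma sawtooth_le (M : nat) (x : R) : 0 < x <= 1 / 2 ->
  Rabs (sawtooth M x) <= 1 / (INR (2 * M + 1) * x).
Proof.
  intros Hx. assert (P := PI_RGT_0). assert (P2 := PI2_1). unfold PI2 in *.
  set (N := INR (2 * M + 1)).
  assert (PN : 0 < N) by (apply lt_0_INR; lia).
  assert (Sp : forall t, x <= t <= 1 / 2 -> 0 < sin (PI * t)).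
  { intros t Ht. apply sin_gt_0; nra. }
  (* [v] adds to [sawtooth] the boundary term of the integration by parts. Both parts vanish at 1 /
     2, and |v'| is dominated by the derivative of the explicit function [b]. *)
  pose (v := fun t => sawtooth M t + cos (N * (PI * t)) / (N * PI * sin (PI * t))).
  pose (v' := fun t => - cos (N * (PI * t)) * cos (PI * t) / (N * (sin (PI * t) * sin (PI * t)))).
  pose (b := fun t => - (1 / (N * PI * sin (PI * t)))).
  pose (b' := fun t => cos (PI * t) / (N * (sin (PI * t) * sin (PI * t)))).
  assert (E : Rabs (v (1 / 2) - v x) <= b (1 / 2) - b x).
  { apply (real_increment_le v v' b b'); [lra| | |].
    - intros t Ht. assert (S0 := Sp t Ht).
      apply (is_derive_eq _ _ (dirichlet M t +
        (- sin (N * (PI * t)) * (N * PI) * (N * PI * sin (PI * t)) - cos (N * (PI * t)) * (N * PI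
          * (PI * cos (PI * t))))
         / ((N * PI * sin (PI * t)) * (N * PI * sin (PI * t))))).
      + unfold v'. rewrite -dirichlet_closed. field. repeat split; lra.
      + apply is_derive_Rplus; [apply is_derive_sawtooth|].
        auto_derive.
        * apply Rgt_not_eq, Rmult_lt_0_compat; [nra|exact S0].
        * field. repeat split; lra.
    - intros t Ht. assert (S0 := Sp t Ht). unfold b, b'. auto_derive.
      + apply Rgt_not_eq, Rmult_lt_0_compat; [nra|exact S0].
      + field. repeat split; lra.
    - intros t Ht. assert (S0 := Sp t Ht). unfold v', b'.
      assert (0 <= cos (PI * t)) by (apply cos_ge_0; nra).
      unfold Rdiv. rewrite !Rabs_mult Rabs_Ropp (Rabs_pos_eq (cos (PI * t))) //.
      assert (Q : 0 < / (N * (sin (PI * t) * sin (PI * t)))).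
      { apply Rinv_0_lt_compat, Rmult_lt_0_compat; [exact PN|nra]. }
      rewrite (Rabs_pos_eq (/ _)); [|lra].
      apply Rmult_le_compat_r; [lra|].
      assert (Rabs (cos (N * (PI * t))) <= 1) by (apply Rabs_le, COS_bound).
      nra. }
  assert (S0 := Sp x ltac:(lra)).
  assert (V0 : v (1 / 2) = 0).
  { unfold v. rewrite sawtooth_half. unfold N. rewrite cos_odd_PI2. unfold Rdiv; ring. }
  assert (Hs : PI * x / 2 <= sin (PI * x)) by (apply sin_ge_half; nra).
  assert (PS : 0 < N * PI * sin (PI * x)) by (apply Rmult_lt_0_compat; [nra|exact S0]).
  set (D := N * PI * sin (PI * x)) in *.
  assert (Hb : b (1 / 2) - b x <= 1 / D).
  { unfold b. fold D.
    assert (0 < 1 / (N * PI * sin (PI * (1 / 2)))).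
    { apply Rdiv_lt_0_compat; [lra|]. apply Rmult_lt_0_compat; [nra|apply Sp; lra]. }
    lra. }
  assert (Hc : Rabs (cos (N * (PI * x)) / D) <= 1 / D).
  { unfold Rdiv. rewrite Rabs_mult (Rabs_pos_eq (/ D)); [|left; now apply Rinv_0_lt_compat].
    apply Rmult_le_compat_r; [left; now apply Rinv_0_lt_compat|]. apply Rabs_le, COS_bound. }
  (* By [sin_ge_half], D >= N PI^2 x / 2, and PI >= 2. *)
  assert (Hf : 2 / D <= 1 / (N * x)).
  { assert (PNx : 0 < N * x) by nra.
    apply Rle_div_l; [exact PS|].
    replace (1 / (N * x) * D) with (PI * sin (PI * x) / x) by (unfold D; field; lra).
    apply Rle_div_r; [lra|]. nra. }
  unfold v at 2 in E. fold D in E. rewrite V0 in E.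
  assert (T : Rabs (sawtooth M x) <= 1 / D + 1 / D).
  { revert E Hc. split_Rabs; lra. }
  lra.
Qed.

(** * Trapezoidal sums against the Dirichlet kernel *)

Lemma ccont_mult (f g : R -> C) (x : R) : ccont f x -> ccont g x -> ccont (fun t => f t * g t)%C x.
Proof.
  intros [F1 F2] [G1 G2]; split.
  - apply (@continuous_minus R_UniformSpace R_AbsRing R_NormedModule); apply @continuous_mult;
      assumption.
  - apply (@continuous_plus R_UniformSpace R_AbsRing R_NormedModule); apply @continuous_mult;
      assumption.
Qed.

Lemma ccont_RtoC (f : R -> R) (x : R) : continuous f x -> ccont (fun t => RtoC (f t)) x.
Proof. intros H; split; [exact H|apply @continuous_const]. Qed.

Lemma ccont_plus (f g : R -> C) (x : R) : ccont f x -> ccont g x -> ccont (fun t => f t + g t)%C x.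
Proof.
  intros [F1 F2] [G1 G2]; split;
    apply (@continuous_plus R_UniformSpace R_AbsRing R_NormedModule); assumption.
Qed.

Lemma continuous_sawtooth (M : nat) (x : R) : continuous (sawtooth M) x.
Proof. apply @ex_derive_continuous. eexists. apply is_derive_sawtooth. Qed.

Lemma continuous_dirichlet (M : nat) (x : R) : continuous (dirichlet M) x.
Proof. apply @ex_derive_continuous, ex_derive_dirichlet. Qed.

(** The left side majorizes the [L1] norm of [sawtooth] over [0, 1 / 2]: with N = 2 (M + 1) + 1, the
    first term comes from [sawtooth_small] on [0, 1 / N] and the second from [sawtooth_le]
    beyond. *)
Lemma sawtooth_L1_le (M : nat) :
  3 / (2 * INR (2 * S M + 1)) + (ln (1 / 2) - ln (/ INR (2 * S M + 1))) / INR (2 * S M + 1)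
  <= 4 / sqrt (INR (S M) + 1).
Proof.
  set (N := INR (2 * S M + 1)).
  assert (EN : N = 2 * INR (S M) + 1).
  { unfold N. rewrite plus_INR mult_INR. simpl (INR 2). simpl (INR 1). ring. }
  assert (PM := INR_S_pos M).
  assert (PM1 : 1 <= INR (S M)) by (rewrite S_INR; generalize (pos_INR M); lra).
  assert (HN : 1 <= N) by lra.
  assert (L := ln_le_sqrt N HN). assert (s1 := one_le_sqrt N HN).
  assert (SN : sqrt N * sqrt N = N) by (apply sqrt_sqrt; lra).
  assert (lh : ln (1 / 2) <= 0).
  { rewrite -ln_1. apply ln_le; lra. }
  rewrite ln_Rinv; [|lra].
  apply Rle_trans with (4 / sqrt N).
  - replace (3 / (2 * N) + (ln (1 / 2) - - ln N) / N) with ((3 / 2 + ln (1 / 2) + ln N) / N) by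
      (field; lra).
    apply Rle_div_l; [lra|].
    replace (4 / sqrt N * N) with (4 * sqrt N) by (rewrite -{3}SN; field; lra). lra.
  - apply Rmult_le_compat_l; [lra|]. apply Rinv_le_contravar; [apply sqrt_lt_R0; lra|].
    apply sqrt_le_1_alt; lra.
Qed.

(* Integration by parts against [sawtooth], whose [L1] norm tends to [0]. *)
Lemma half_period_estimate (g g' : R -> C) (B : R) (M : nat) (J : C) : 0 <= B ->
  (forall t, 0 <= t <= 1 / 2 -> cderiv g t (g' t)) ->
  (forall t, 0 <= t <= 1 / 2 -> ccont g' t) ->
  (forall t, 0 <= t <= 1 / 2 -> Cmod (g' t) <= B) ->
  is_CInt (fun t => g t * dirichlet (S M) t)%C 0 (1 / 2) J ->
  Cmod (1 / 2 * g 0 - J) <= B * (4 / sqrt (INR (S M) + 1)).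
Proof.
  intros HB Hg Hc Hb HJ.
  set (N := INR (2 * S M + 1)).
  (* The index [S M] ensures 1 / N <= 1 / 2, so that the interval can be split at 1 / N. *)
  assert (HN : 3 <= N).
  { unfold N. replace 3 with (INR 3) by (simpl; ring). apply le_INR; lia. }
  assert (HiN : 0 < / N <= 1 / 2).
  { split; [apply Rinv_0_lt_compat; lra|]. replace (1 / 2) with (/ 2) by field. apply
      Rinv_le_contravar; lra. }
  assert (CS : forall t, 0 <= t <= 1 / 2 -> ccont (fun t => g' t * sawtooth (S M) t)%C t).
  { intros t Ht. apply ccont_mult; [now apply Hc|apply ccont_RtoC, continuous_sawtooth]. }
  (* [sawtooth] equals - 1 / 2 at 0 and vanishes at 1 / 2, so the boundary terms reduce to half the
     endpoint value. *)
  assert (I0 : is_CInt (fun t => g' t * sawtooth (S M) t + g t * dirichlet (S M) t)%C 0 (1 / 2)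
     (1 / 2 * g 0)).
  { eapply is_CInt_eq; [|apply (is_CInt_FTC (fun t => g t * sawtooth (S M) t)%C); [lra| |]].
    - cbv beta. rewrite sawtooth_half sawtooth_0 RtoC_opp RtoC_div; [|lra]. ring.
    - intros t Ht. exact (cderiv_mult _ _ _ _ _ (Hg t Ht) (cderiv_RtoC _ _ _ (is_derive_sawtooth
        (S M) t))).
    - intros t Ht. apply ccont_plus; [now apply CS|].
      apply ccont_mult; [eapply cderiv_ccont; now apply Hg|apply ccont_RtoC,
        continuous_dirichlet]. }
  assert (I : is_CInt (fun t => g' t * sawtooth (S M) t)%C 0 (1 / 2) (1 / 2 * g 0 - J)).
  { eapply is_CInt_ext; [lra| |apply (is_CInt_minus _ _ _ _ _ _ I0 HJ)]. intros t _; cbv beta;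
      ring. }
  assert (I1 : is_CInt (fun t => g' t * sawtooth (S M) t)%C 0 (/ N) (CInt (fun t => g' t *
    sawtooth (S M) t)%C 0 (/ N))).
  { apply ccont_ex_CInt; [lra|]. intros t Ht; apply CS; lra. }
  assert (I2 : is_CInt (fun t => g' t * sawtooth (S M) t)%C (/ N) (1 / 2) (CInt (fun t => g' t *
    sawtooth (S M) t)%C (/ N) (1 / 2))).
  { apply ccont_ex_CInt; [lra|]. intros t Ht; apply CS; lra. }
  rewrite -(is_CInt_unique _ _ _ _ I) (is_CInt_unique _ _ _ _ (is_CInt_Chasles _ _ _ _ _ _ I1 I2)).
  assert (E1 : Cmod (CInt (fun t => g' t * sawtooth (S M) t)%C 0 (/ N)) <= (/ N - 0) * (B * (3 /
    2))).
  { apply (is_CInt_norm_le _ (fun _ => B * (3 / 2)) 0 (/ N) _ _ ltac:(lra) I1 (is_RInt_Rconst _ _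
      _)).
    intros t Ht. rewrite Cmod_mult Cmod_R.
    apply Rmult_le_compat; [apply Cmod_ge_0|apply Rabs_pos|apply Hb; lra|].
    eapply Rle_trans; [apply sawtooth_small; lra|]. fold N.
    assert (N * t <= N * / N) by (apply Rmult_le_compat_l; lra). rewrite Rinv_r in H; lra. }
  assert (E2 : Cmod (CInt (fun t => g' t * sawtooth (S M) t)%C (/ N) (1 / 2)) <= B / N * (ln (1 /
    2) - ln (/ N))).
  { apply (is_CInt_norm_le _ (fun t => B / N * / t) (/ N) (1 / 2) _ _ ltac:(lra) I2).
    - apply (@is_RInt_scal R_NormedModule). apply (@is_RInt_derive R_CompleteNormedModule ln).
      + rewrite Rmin_left; [|lra]. intros t Ht. apply is_derive_ln; lra.
      + rewrite Rmin_left; [|lra]. intros t Ht. apply @ex_derive_continuous. auto_derive; lra.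
    - intros t Ht. rewrite Cmod_mult Cmod_R.
      replace (B / N * / t) with (B * (1 / (N * t))) by (field; lra).
      apply Rmult_le_compat; [apply Cmod_ge_0|apply Rabs_pos|apply Hb; lra|].
      apply sawtooth_le; lra. }
  eapply Rle_trans; [apply Cmod_triangle|].
  eapply Rle_trans; [apply Rplus_le_compat; [exact E1|exact E2]|].
  replace ((/ N - 0) * (B * (3 / 2)) + B / N * (ln (1 / 2) - ln (/ N)))
    with (B * (3 / (2 * N) + (ln (1 / 2) - ln (/ N)) / N)) by (field; lra).
  apply Rmult_le_compat_l; [exact HB|]. apply sawtooth_L1_le.
Qed.

Lemma dirichlet_shift (M n : nat) (y : R) : dirichlet M (INR n + y) = dirichlet M y.
Proof.
  induction M as [|M IH]; cbn [dirichlet]; [reflexivity|].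
  rewrite IH.
  replace (2 * PI * INR (S M) * (INR n + y)) with (2 * PI * INR (S M) * y + 2 * INR (S M * n) * PI)
    by (rewrite mult_INR; ring).
  now rewrite cos_period.
Qed.

Lemma dirichlet_opp (M : nat) (y : R) : dirichlet M (- y) = dirichlet M y.
Proof.
  induction M as [|M IH]; cbn [dirichlet]; [reflexivity|].
  rewrite IH. replace (2 * PI * INR (S M) * - y) with (- (2 * PI * INR (S M) * y)) by ring.
  now rewrite cos_neg.
Qed.

Lemma is_CInt_shift (f : R -> C) (v a b : R) (l : C) :
  is_CInt f (v + a) (v + b) l -> is_CInt (fun y => f (v + y)) a b l.
Proof.
  intros [H1 H2].
  assert (K : forall (h : R -> R) (m : R), is_RInt h (v + a) (v + b) m -> is_RInt (fun y => h (v +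
    y)) a b m).
  { intros h m Hh. apply (is_RInt_ext (fun y => scal 1 (h (1 * y + v)))).
    - intros y _. rewrite (@scal_one R_AbsRing R_NormedModule). f_equal; ring.
    - apply (@is_RInt_comp_lin R_NormedModule). rewrite !Rmult_1_l !(Rplus_comm _ v). exact Hh. }
  split; [exact (K _ _ H1)|exact (K _ _ H2)].
Qed.

Lemma is_CInt_reflect (f : R -> C) (v a b : R) (l : C) :
  is_CInt f (v - b) (v - a) l -> is_CInt (fun y => f (v - y)) a b l.
Proof.
  intros [H1 H2].
  assert (K : forall (h : R -> R) (m : R), is_RInt h (v - b) (v - a) m -> is_RInt (fun y => h (v -
    y)) a b m).
  { intros h m Hh. apply (is_RInt_ext (fun y => opp (scal (- 1) (h (- 1 * y + v))))).
    - intros y _. unfold opp, scal; simpl; unfold mult; simpl.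
      replace (- 1 * y + v) with (v - y) by ring. ring.
    - rewrite -(opp_opp m). apply (@is_RInt_opp R_NormedModule).
      apply (@is_RInt_comp_lin R_NormedModule).
      apply (@is_RInt_swap R_NormedModule).
      replace (- 1 * a + v) with (v - a) by ring. replace (- 1 * b + v) with (v - b) by ring.
      exact Hh. }
  split; [exact (K _ _ H1)|exact (K _ _ H2)].
Qed.

(** The right half of the period is reflected about its midpoint onto the situation of the left
    half, [dirichlet] being even and 1-periodic. The two half weights are those of the trapezoidal
    rule. *)
Lemma period_estimate (f f' : R -> C) (B : R) (M n : nat) (J : C) : 0 <= B ->
  (forall t, INR n <= t <= INR n + 1 -> cderiv f t (f' t)) ->
  (forall t, INR n <= t <= INR n + 1 -> ccont f' t) ->
  (forall t, INR n <= t <= INR n + 1 -> Cmod (f' t) <= B) ->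
  is_CInt (fun t => f t * dirichlet (S M) t)%C (INR n) (INR n + 1) J ->
  Cmod (1 / 2 * f (INR n) + 1 / 2 * f (INR (S n)) - J) <= B * (8 / sqrt (INR (S M) + 1)).
Proof.
  intros HB Hf Hc Hb HJ.
  assert (CI : forall t, INR n <= t <= INR n + 1 -> ccont (fun t => f t * dirichlet (S M) t)%C t).
  { intros t Ht. apply ccont_mult; [eapply cderiv_ccont; now apply Hf|apply ccont_RtoC,
      continuous_dirichlet]. }
  assert (I1 := ccont_ex_CInt (fun t => f t * dirichlet (S M) t)%C (INR n + 0) (INR n + 1 / 2)
    ltac:(lra)
     (fun t Ht => CI t ltac:(lra))).
  assert (I2 := ccont_ex_CInt (fun t => f t * dirichlet (S M) t)%C (INR n + 1 - 1 / 2) (INR n + 1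
    - 0) ltac:(lra)
     (fun t Ht => CI t ltac:(lra))).
  set (J1 := CInt (fun t => f t * dirichlet (S M) t)%C (INR n + 0) (INR n + 1 / 2)) in *.
  set (J2 := CInt (fun t => f t * dirichlet (S M) t)%C (INR n + 1 - 1 / 2) (INR n + 1 - 0)) in *.
  assert (EJ : J = (J1 + J2)%C).
  { rewrite -(is_CInt_unique _ _ _ _ HJ). apply is_CInt_unique.
    replace (INR n + 0) with (INR n) in I1 by ring. replace (INR n + 1 - 0) with (INR n + 1) in I2
      by ring.
    replace (INR n + 1 - 1 / 2) with (INR n + 1 / 2) in I2 by field.
    eapply is_CInt_Chasles; eassumption. }
  assert (E1 : Cmod (1 / 2 * f (INR n + 0)%R - J1) <= B * (4 / sqrt (INR (S M) + 1))).
  { apply (half_period_estimate (fun y => f (INR n + y)) (fun y => f' (INR n + y))); [exact HB| |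
      | |].
    - intros t Ht. destruct (Hf (INR n + t) ltac:(lra)) as [D1 D2].
      assert (Da : is_derive (fun y => INR n + y) t 1) by (auto_derive; auto; ring).
      split.
      + eapply is_derive_eq; [|exact (is_derive_Rcomp _ _ _ _ _ D1 Da)]. ring.
      + eapply is_derive_eq; [|exact (is_derive_Rcomp _ _ _ _ _ D2 Da)]. ring.
    - intros t Ht. destruct (Hc (INR n + t) ltac:(lra)) as [D1 D2].
      assert (Da : continuous (fun y => INR n + y) t) by (apply @ex_derive_continuous;
        auto_derive; auto).
      split; [exact (continuous_comp _ _ _ Da D1)|exact (continuous_comp _ _ _ Da D2)].
    - intros t Ht; apply Hb; lra.
    - eapply is_CInt_ext; [lra| |exact (is_CInt_shift _ _ _ _ _ I1)].
      intros t _; cbv beta. now rewrite dirichlet_shift. }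
  assert (E2 : Cmod (1 / 2 * f (INR n + 1 - 0)%R - J2) <= B * (4 / sqrt (INR (S M) + 1))).
  { apply (half_period_estimate (fun y => f (INR n + 1 - y)) (fun y => - f' (INR n + 1 - y)%R)%C);
      [exact HB| | | |].
    - intros t Ht. destruct (Hf (INR n + 1 - t) ltac:(lra)) as [D1 D2].
      assert (Da : is_derive (fun y => INR n + 1 - y) t (- 1)) by (auto_derive; auto; ring).
      split.
      + eapply is_derive_eq; [|exact (is_derive_Rcomp _ _ _ _ _ D1 Da)]. rewrite re_opp; ring.
      + eapply is_derive_eq; [|exact (is_derive_Rcomp _ _ _ _ _ D2 Da)]. rewrite im_opp; ring.
    - intros t Ht. destruct (Hc (INR n + 1 - t) ltac:(lra)) as [D1 D2].
      assert (Da : continuous (fun y => INR n + 1 - y) t) by (apply @ex_derive_continuous;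
        auto_derive; auto).
      split.
      + apply (@continuous_opp R_UniformSpace R_AbsRing R_NormedModule). exact (continuous_comp _
          _ _ Da D1).
      + apply (@continuous_opp R_UniformSpace R_AbsRing R_NormedModule). exact (continuous_comp _
          _ _ Da D2).
    - intros t Ht; rewrite Cmod_opp; apply Hb; lra.
    - eapply is_CInt_ext; [lra| |exact (is_CInt_reflect _ _ _ _ _ I2)].
      intros t _; cbv beta.
      replace (INR n + 1 - t) with (INR (S n) + - t) by (rewrite S_INR; ring).
      now rewrite dirichlet_shift dirichlet_opp. }
  rewrite EJ S_INR. rewrite Rplus_0_r in E1. rewrite Rminus_0_r in E2.
  replace (1 / 2 * f (INR n) + 1 / 2 * f (INR n + 1)%R - (J1 + J2))%C
    with ((1 / 2 * f (INR n) - J1) + (1 / 2 * f (INR n + 1)%R - J2))%C by ring.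
  eapply Rle_trans; [apply Cmod_triangle|].
  replace (B * (8 / sqrt (INR (S M) + 1))) with (B * (4 / sqrt (INR (S M) + 1)) + B * (4 / sqrt
    (INR (S M) + 1))).
  - lra.
  - unfold Rdiv; ring.
Qed.

(** Trapezoidal sum against the integral with the Dirichlet kernel, period by period; the constants
    of the periods telescope. The bound is free of [k], which lets [k] tend to infinity before
    [M]. *)
Lemma poisson_estimate (f f' : R -> C) (K : R) (J : nat -> C) (mom : nat -> nat -> C) : 0 <= K ->
  (forall t, 0 <= t -> cderiv f t (f' t)) ->
  (forall t, 0 <= t -> ccont f' t) ->
  (forall t, 0 <= t -> Cmod (f' t) <= K / ((t + 1) * sqrt (t + 1))) ->
  (forall k, is_CInt f 0 (INR k) (J k)) ->
  (forall m k, is_CInt (fun x => f x * cosine (S m) x)%C 0 (INR k) (mom m k)) ->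
  forall M k,
  Cmod (csum (fun n => f (INR n)) k - 1 / 2 * f 0 + 1 / 2 * f (INR k)
        - (J k + 2 * csum (fun m => mom m k) (S M))) <= 4 * K * (8 / sqrt (INR (S M) + 1)).
Proof.
  intros HK Hf Hc Hb HJ Hm M k.
  set (e := 8 / sqrt (INR (S M) + 1)).
  assert (He : 0 <= e).
  { apply Rle_div_r; [apply sqrt_lt_R0; generalize (pos_INR (S M)); lra|lra]. }
  assert (HD : is_CInt (fun t => f t * dirichlet (S M) t)%C 0 (INR k)
     (J k + 2 * csum (fun m => mom m k) (S M))).
  { generalize (S M). clear M e He. intros M. induction M as [|M IH].
    - eapply is_CInt_ext; [apply pos_INR| |eapply is_CInt_eq; [|apply HJ]].
      + intros t _; cbn [dirichlet]. ring.
      + simpl. ring.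
    - eapply is_CInt_ext; [apply pos_INR| |eapply is_CInt_eq; [|apply is_CInt_plus; [exact
        IH|apply is_CInt_scal, (Hm M k)]]].
      + intros t _; cbn [dirichlet]. unfold cosine. rewrite RtoC_plus RtoC_mult. instantiate (1 :=
          2%C). ring.
      + cbn [csum]. ring. }
  assert (CI : forall t, 0 <= t -> ccont (fun t => f t * dirichlet (S M) t)%C t).
  { intros t Ht. apply ccont_mult; [eapply cderiv_ccont; now apply Hf|apply ccont_RtoC,
      continuous_dirichlet]. }
  pose (Jn := fun n => CInt (fun t => f t * dirichlet (S M) t)%C (INR n) (INR n + 1)).
  assert (HJn : forall n, is_CInt (fun t => f t * dirichlet (S M) t)%C (INR n) (INR n + 1) (Jn n)).
  { intros n. apply ccont_ex_CInt; [lra|]. intros t Ht; apply CI. generalize (pos_INR n); lra. }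
  assert (HJs : (J k + 2 * csum (fun m => mom m k) (S M))%C = csum Jn k).
  { rewrite -(is_CInt_unique _ _ _ _ HD). apply is_CInt_unique. clear HD. induction k as [|k IH].
    - simpl. split; simpl; apply @is_RInt_point.
    - cbn [csum]. eapply is_CInt_Chasles; [exact IH|]. rewrite S_INR. apply HJn. }
  rewrite HJs.
  assert (HT : (csum (fun n => f (INR n)) k - 1 / 2 * f 0 + 1 / 2 * f (INR k))%C
     = csum (fun n => 1 / 2 * f (INR n) + 1 / 2 * f (INR (S n)))%C k).
  { clear HD HJs. induction k as [|k IH]; [simpl; ring|].
    cbn [csum]. rewrite -IH. field. }
  rewrite HT -csum_minus.
  pose (bb := fun n => 4 * K * e / sqrt (INR n + 1)).
  eapply Rle_trans; [apply (csum_norm_le _ bb)|].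
  - intros n _. assert (Pn := pos_INR n).
    destruct (decay_on_period f' K n HK Hb) as [B [PB [D Q]]].
    eapply Rle_trans; [apply (period_estimate f f' B M n (Jn n))|].
    + exact PB.
    + intros t Ht; apply Hf; lra.
    + intros t Ht; apply Hc; lra.
    + exact D.
    + apply HJn.
    + fold e. unfold bb. rewrite S_INR.
      replace (4 * K * e / sqrt (INR n + 1) - 4 * K * e / sqrt (INR n + 1 + 1))
        with (K * (4 / sqrt (INR n + 1) - 4 / sqrt (INR n + 1 + 1)) * e) by (unfold Rdiv; ring).
      now apply Rmult_le_compat_r.
  - unfold bb. simpl (INR 0). rewrite Rplus_0_l sqrt_1.
    assert (0 <= 4 * K * e / sqrt (INR k + 1)).
    { apply Rle_div_r; [apply sqrt_lt_R0; generalize (pos_INR k); lra|].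
      rewrite Rmult_0_l. apply Rmult_le_pos; lra. }
    lra.
Qed.

(** * The digamma function *)

(** A logarithm of the [n]-th term of Euler's limit. As a sum of principal logarithms, in general
    not the principal logarithm of the product, it can be differentiated term by term. *)
Definition log_gamma_seq (z : C) (n : nat) : C :=
  (z * ln (INR n) + csum (fun j => RtoC (ln (INR (S j)))) n
   - csum (fun j => Clog (INR j + z)) (S n))%C.

Lemma Cexp_csum_ln (n : nat) :
  Cexp (csum (fun j => RtoC (ln (INR (S j)))) n) = INR (fact n).
Proof.
  induction n as [|n IH]; [apply Cexp_0|].
  cbn [csum]. rewrite Cexp_plus IH Cexp_RtoC exp_ln; [|apply INR_S_pos].
  rewrite -RtoC_mult -mult_INR. do 2 f_equal. simpl; lia.
Qed.

Lemma Cexp_csum_Clog (z : C) (n : nat) : slit z ->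
  Cexp (csum (fun j => Clog (INR j + z)) (S n)) = Cprod (fun k => z + INR k)%C n.
Proof.
  intros H.
  assert (E : forall j, Cexp (Clog (INR j + z)) = (z + INR j)%C).
  { intros j. rewrite Cexp_Clog; [ring|]. apply slit_neq_0, slit_add; [exact H|apply pos_INR]. }
  induction n as [|n IH].
  - cbn [csum Cprod]. rewrite Cexp_plus Cexp_0 E. ring.
  - change (csum (fun j => Clog (INR j + z)) (S (S n))) with
      (csum (fun j => Clog (INR j + z)) (S n) + Clog (INR (S n) + z))%C.
    now rewrite Cexp_plus IH E.
Qed.

Lemma Cexp_log_gamma_seq (z : C) (n : nat) : slit z ->
  Cexp (log_gamma_seq z n)
  = (INR (fact n) * Cexp (z * ln (INR n)) / Cprod (fun k => z + INR k) n)%C.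
Proof.
  intros H. unfold log_gamma_seq, Cminus. rewrite !Cexp_plus Cexp_opp Cexp_csum_ln Cexp_csum_Clog
    //.
  unfold Cdiv. ring.
Qed.

Lemma ln_step (t : R) : 1 < t -> / t <= ln t - ln (t - 1) <= / (t - 1).
Proof.
  intros Ht.
  assert (E : ln t - ln (t - 1) = ln (t / (t - 1))).
  { unfold Rdiv. rewrite ln_mult; [|lra|apply Rinv_0_lt_compat; lra]. rewrite ln_Rinv; lra. }
  assert (A : forall x, 0 < x -> ln x <= x - 1).
  { intros x Hx. generalize (exp_ineq1_le (ln x)). rewrite exp_ln //. lra. }
  split.
  - assert (B : ln ((t - 1) / t) <= (t - 1) / t - 1) by (apply A, Rdiv_lt_0_compat; lra).
    unfold Rdiv in B at 1. rewrite ln_mult in B; [|lra|apply Rinv_0_lt_compat; lra].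
    rewrite ln_Rinv in B; [|lra]. replace ((t - 1) / t - 1) with (- / t) in B by (field; lra). lra.
  - rewrite E. eapply Rle_trans; [apply A, Rdiv_lt_0_compat; lra|]. right; field; lra.
Qed.

(** Up to sign, the quantity is the step of [log_gamma_seq] from index t - 1 to t, bounded here by a
    telescoping majorant. *)
Lemma log_gamma_step_le (z : C) : slit z -> exists K, 0 <= K /\ forall t, 2 <= t ->
  Cmod (Clog (t + z) - ln t - z * (ln t - ln (t - 1))) <= K / (t - 1) - K / t.
Proof.
  intros H. destruct (slit_cone_lower z H) as [c [[Hc1 Hc2] B]].
  assert (Pz := Cmod_ge_0 z).
  set (K := Cmod z * Cmod z / c + Cmod z).
  assert (PK : 0 <= Cmod z * Cmod z / c) by (apply Rle_div_r; nra).
  exists K. split; [unfold K; lra|]. intros t Ht.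
  assert (N : forall s, 0 <= s -> slit (t + s * z)) by (intros; apply slit_cone; auto; lra).
  set (d := ln t - ln (t - 1)).
  assert (Nt : RtoC t <> 0%C) by (apply RtoC_neq_0; lra).
  pose (g := fun s : R => (Clog (t + s * z) - s * (z * d))%C).
  assert (Q : 0 < / (t * (t - 1))) by (apply Rinv_0_lt_compat; nra).
  assert (E : Cmod (g 1 - g 0) <= K * / (t * (t - 1)) * 1 - K * / (t * (t - 1)) * 0).
  { apply (cderiv_increment_le g (fun s => z / (t + s * z) - z * d)%C
      (fun s => K * / (t * (t - 1)) * s) (fun _ => K * / (t * (t - 1)))); [lra| | |].
    - intros s Hs. apply cderiv_minus.
      + apply cderiv_Clog; [apply N; lra|].
        eapply cderiv_eq; [|apply cderiv_plus; [apply cderiv_const|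
          apply cderiv_mult; [apply cderiv_id|apply cderiv_const]]]. cbv beta; ring.
      + eapply cderiv_eq; [|apply cderiv_mult; [apply cderiv_id|apply cderiv_const]]. cbv beta;
          ring.
    - intros s _; auto_derive; auto; ring.
    - intros s Hs. assert (Ns := slit_neq_0 _ (N s ltac:(lra))).
      (* Both pieces are O(1 / (t (t - 1))): the first by [slit_cone_lower], the second because
         [ln_step] places [d] between 1 / t and 1 / (t - 1). They account for the two terms of
         [K]. *)
      replace (z / (t + s * z) - z * d)%C with (- (s * (z * z) / (t * (t + s * z))) + z * (/ t -
        d)%R)%C
        by (rewrite RtoC_minus RtoC_inv; [field; auto|lra]).
      eapply Rle_trans; [apply Cmod_triangle|]. unfold K. rewrite Rmult_plus_distr_r.
      apply Rplus_le_compat.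
      + rewrite Cmod_opp Cmod_div; [|now apply Cmult_neq_0].
        rewrite !Cmod_mult !Cmod_R !Rabs_pos_eq; [|lra|lra].
        assert (L := B t s ltac:(lra) ltac:(lra)).
        replace (Cmod z * Cmod z / c * / (t * (t - 1))) with (Cmod z * Cmod z * / (t * (c * (t -
          1)))) by (field; lra).
        assert (P1 : 0 < t * (c * (t - 1))) by (apply Rmult_lt_0_compat; nra).
        assert (P2 : c * (t - 1) <= Cmod (t + s * z)) by nra.
        assert (P3 : 0 < c * (t - 1)) by nra.
        apply Rmult_le_compat.
        * apply Rmult_le_pos; nra.
        * left; apply Rinv_0_lt_compat, Rmult_lt_0_compat; lra.
        * assert (0 <= Cmod z * Cmod z) by nra. nra.
        * apply Rinv_le_contravar; [exact P1|]. apply Rmult_le_compat_l; lra.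
      + rewrite Cmod_mult Cmod_R. apply Rmult_le_compat_l; [exact Pz|].
        destruct (ln_step t) as [l1 l2]; [lra|]. fold d in l1, l2.
        rewrite Rabs_left1; [|lra].
        apply Rle_trans with (/ (t - 1) - / t); [lra|]. right; field; lra. }
  unfold g in E.
  replace (Clog (t + 1 * z) - 1 * (z * d) - (Clog (t + 0 * z) - 0 * (z * d)))%C
    with (Clog (t + z) - ln t - z * d)%C in E.
  2:{ replace (t + 1 * z)%C with (t + z)%C by ring. replace (t + 0 * z)%C with (RtoC t) by ring.
      rewrite (Clog_RtoC t); [ring|lra]. }
  unfold d in E. rewrite RtoC_minus in E.
  eapply Rle_trans; [exact E|]. right; field; lra.
Qed.

Lemma log_gamma_seq_converges (z : C) : slit z -> exists l, clim (log_gamma_seq z) l.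
Proof.
  intros H. destruct (log_gamma_step_le z H) as [K [PK B]].
  destruct (clim_telescope (fun n => log_gamma_seq z (S n)) (fun n => K / INR (S n))) as [l Hl].
  - apply is_lim_seq_inv_S.
  - intros n. apply Rle_div_r; [apply INR_S_pos|lra].
  - intros n.
    assert (P := pos_INR n).
    assert (A := B (INR (S (S n))) ltac:(rewrite !S_INR; lra)).
    replace (log_gamma_seq z (S (S n)) - log_gamma_seq z (S n))%C
      with (- (Clog (INR (S (S n)) + z) - ln (INR (S (S n))) - z * (ln (INR (S (S n))) - ln (INR
        (S n)))))%C.
    + rewrite Cmod_opp.
      replace (INR (S (S n)) - 1) with (INR (S n)) in A by (rewrite !S_INR; ring). exact A.
    + unfold log_gamma_seq. cbn [csum]. ring.
  - exists l. now apply clim_unshift.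
Qed.

Lemma CGamma_exp (z l : C) : slit z -> clim (log_gamma_seq z) l -> CGamma z = Cexp l.
Proof.
  intros H Hl. apply clim_CLim_seq. eapply clim_ext; [|apply (clim_Cexp _ _ Hl)].
  intros n; cbv beta. now apply Cexp_log_gamma_seq.
Qed.

Definition digamma_seq (z : C) (n : nat) : C :=
  (ln (INR n) - csum (fun j => / (INR j + z)) (S n))%C.

Lemma slit_real_shift (z : C) (t : R) : Im z <> 0 -> slit (t + z).
Proof. intros H; right. rewrite im_plus im_RtoC. lra. Qed.

(** The remainder is O(h^2 / (j + 1)^2), majorized by the telescoping 1 / ((j + 1)(j + 2)) at the
    cost of a factor 2. The radius is half the constant of [slit_add_lower], so j + z + t keeps half
    of its lower bound, and [Im z <> 0] admits increments of either sign. *)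
Lemma Clog_real_taylor (z : C) : Im z <> 0 -> exists c, 0 < c /\ exists K, 0 <= K /\
  forall (j : nat) (h : R), Rabs h < c ->
    Cmod (Clog (INR j + (h + z)) - Clog (INR j + z) - h * / (INR j + z))
    <= K * (h * h) / (INR j + 1) - K * (h * h) / (INR (S j) + 1).
Proof.
  intros H. destruct (slit_add_lower z (or_intror H)) as [c [[Hc1 Hc2] B]].
  exists (c / 2). split; [lra|]. exists (4 / (c * c)). split; [apply Rle_div_r; nra|].
  intros j h Hh. assert (Pj := pos_INR j). assert (L := B _ Pj).
  set (L0 := 2 / (c * c) / ((INR j + 1) * (INR j + 1))).
  assert (Lt : forall t, Rabs t <= Rabs h -> c / 2 * (1 + INR j) <= Cmod (INR j + z + t)).
  { intros t Ht. assert (A := Cmod_minus_ge (INR j + z) t). rewrite Cmod_R in A. nra. }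
  assert (T := cderiv_taylor2 (fun s => Clog (s + (INR j + z)))%C (fun s => / (s + (INR j + z)))%C
    0 h L0).
  cbv beta in T. rewrite Rplus_0_l in T.
  replace (0 + (INR j + z))%C with (INR j + z)%C in T by ring.
  replace (h + (INR j + z))%C with (INR j + (h + z))%C in T by ring.
  eapply Rle_trans; [apply T|].
  - intros t _. apply cderiv_Clog_add. replace (t + (INR j + z))%C with ((t + INR j)%R + z)%C by
      (rewrite RtoC_plus; ring).
    now apply slit_real_shift.
  - intros t Ht. rewrite Rminus_0_r in Ht |- *. assert (Q := Lt t Ht).
    assert (Pc : 0 < c / 2 * (1 + INR j)) by (apply Rmult_lt_0_compat; lra).
    assert (N1 : (INR j + z + t)%C <> 0%C) by (apply Cmod_gt_0; lra).
    assert (N2 : (INR j + z)%C <> 0%C) by (apply Cmod_gt_0; nra).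
    replace (t + (INR j + z))%C with (INR j + z + t)%C by ring.
    replace (/ (INR j + z + t) - / (INR j + z))%C with (- t / ((INR j + z + t) * (INR j + z)))%C
      by (field; auto).
    rewrite Cmod_div; [|now apply Cmult_neq_0]. rewrite Cmod_opp Cmod_R Cmod_mult. unfold L0.
    unfold Rdiv at 1. rewrite Rmult_comm. apply Rmult_le_compat_r; [apply Rabs_pos|].
    replace (2 / (c * c) / ((INR j + 1) * (INR j + 1)))
      with (/ (c / 2 * (1 + INR j) * (c * (1 + INR j)))) by (field; lra).
    apply Rinv_le_contravar; [apply Rmult_lt_0_compat; nra|].
    apply Rmult_le_compat; nra.
  - rewrite S_INR. unfold L0.
    apply Rle_trans with (4 / (c * c) * (h * h) * / ((INR j + 1) * (INR j + 1 + 1))).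
    + replace (2 / (c * c) / ((INR j + 1) * (INR j + 1)) * (h * h))
        with (4 / (c * c) * (h * h) * / ((INR j + 1) * (2 * (INR j + 1)))) by (field; lra).
      apply Rmult_le_compat_l.
      * apply Rmult_le_pos; [apply Rle_div_r; nra|nra].
      * apply Rinv_le_contravar; nra.
    + right; field; lra.
Qed.

(** The constant does not depend on [n], so the quadratic remainder passes to the limit and
    identifies the derivative of the limit with the limit of [digamma_seq]. *)
Lemma log_gamma_seq_taylor (z : C) : Im z <> 0 -> exists c, 0 < c /\ exists K, 0 <= K /\
  forall (n : nat) (h : R), Rabs h < c ->
    Cmod (log_gamma_seq (h + z) n - log_gamma_seq z n - h * digamma_seq z n) <= K * (h * h).
Proof.
  intros H. destruct (Clog_real_taylor z H) as [c [Pc [K [PK B]]]].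
  exists c. split; [exact Pc|]. exists K. split; [exact PK|]. intros n h Hh.
  unfold log_gamma_seq, digamma_seq.
  replace ((h + z) * ln (INR n) + csum (fun j => RtoC (ln (INR (S j)))) n - csum (fun j => Clog
    (INR j + (h + z))) (S n)
    - (z * ln (INR n) + csum (fun j => RtoC (ln (INR (S j)))) n - csum (fun j => Clog (INR j + z))
        (S n))
    - h * (ln (INR n) - csum (fun j => / (INR j + z)) (S n)))%C
   with (- (csum (fun j => Clog (INR j + (h + z))) (S n) - csum (fun j => Clog (INR j + z)) (S n)
        - h * csum (fun j => / (INR j + z)) (S n)))%C by ring.
  rewrite Cmod_opp -csum_scal -!csum_minus.
  eapply Rle_trans; [apply (csum_norm_le _ (fun j => K * (h * h) / (INR j + 1)))|].
  - intros j _. now apply B.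
  - simpl (INR 0). rewrite Rplus_0_l.
    assert (0 <= K * (h * h) / (INR (S n) + 1)).
    { apply Rle_div_r; [generalize (pos_INR (S n)); lra|]. rewrite Rmult_0_l. apply Rmult_le_pos;
        nra. }
    lra.
Qed.

Lemma digamma_seq_clim (z : C) : slit z ->
  exists l, clim (digamma_seq z) l /\
  clim (fun n => csum (fun j => / (INR j + z))%C n - Clog (INR n + z))%C (- l).
Proof.
  intros H. destruct (harmonic_add_converges z H) as [l Hl].
  exists (- l)%C. split; [|eapply clim_eq; [|exact Hl]; ring].
  destruct (slit_add_lower z H) as [c [[Hc1 Hc2] B]].
  assert (D : clim (fun n => / (INR n + z))%C 0).
  { apply clim_unshift. eapply clim_squeeze; [|apply (is_lim_seq_inv_S (/ c))]. intros n; cbv beta.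
    assert (P := INR_S_pos n).
    replace (/ (INR (S n) + z) - 0)%C with (/ (INR (S n) + z))%C by ring.
    rewrite Cmod_inv; [|apply slit_neq_0, slit_add; [exact H|lra]].
    unfold Rdiv. rewrite -Rinv_mult. generalize (B (INR (S n)) ltac:(lra)). intros.
    apply Rinv_le_contravar; nra. }
  eapply clim_ext; [|eapply clim_eq; [|apply (clim_opp _ _ (clim_plus _ _ _ _ (clim_plus _ _ _ _
    Hl (Clog_add_asymp z H)) D))]].
  - intros n; cbv beta. unfold digamma_seq. cbn [csum]. ring.
  - ring.
Qed.

Lemma is_lim_difference_quotient (g : R -> R) (x l : R) : is_derive g x l ->
  is_lim (fun y => (g y - g x) / (y - x)) x l.
Proof.
  intros H. apply is_derive_Reals in H. apply is_lim_spec. intros eps.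
  destruct (H eps (cond_pos eps)) as [d Hd]. exists d. intros y Hy Ny.
  assert (Hh : y - x <> 0) by lra.
  generalize (Hd (y - x) Hh Hy).
  assert (E : forall a b : R, a + (b - a) = b) by (intros; ring). rewrite E. exact (fun h => h).
Qed.

(* [C_derive] is a limit over real increments only. *)
Lemma C_derive_cderiv (f : C -> C) (z l : C) :
  cderiv (fun x => f (x, Im z)) (Re z) l -> C_derive f z = l.
Proof.
  intros [H1 H2]. unfold C_derive, C_lim.
  assert (Ez : (Re z, Im z) = z) by now destruct z.
  assert (Q : forall x : R, x <> Re z -> ((f (x, Im z) - f z) / ((x, Im z) - z))%C =
     ((Re (f (x, Im z)) - Re (f (Re z, Im z))) / (x - Re z), (Im (f (x, Im z)) - Im (f (Re z, Im
       z))) / (x - Re z))).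
  { intros x Hx. rewrite Ez.
    replace ((x, Im z) - z)%C with (RtoC (x - Re z)) by (apply C_eq; simpl; unfold Re, Im; ring).
    unfold Cdiv. rewrite -RtoC_inv; [|lra].
    apply C_eq; rewrite ?re_scal_r ?im_scal_r; simpl; unfold Re, Im, Rdiv; ring. }
  assert (L : forall (g1 g2 : R -> R) (m : R), is_lim g1 (Re z) m -> (forall x, x <> Re z -> g1 x
    = g2 x) -> real (Lim g2 (Re z)) = m).
  { intros g1 g2 m Hg E. rewrite (is_lim_unique g2 (Re z) m); [reflexivity|].
    apply (is_lim_ext_loc g1); [|exact Hg]. exists (mkposreal 1 Rlt_0_1). intros y _ Hy. now apply
      E. }
  apply C_eq; simpl.
  - apply (L _ _ _ (is_lim_difference_quotient _ _ _ H1)). intros x Hx. exact (eq_sym (f_equal Re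
      (Q x Hx))).
  - apply (L _ _ _ (is_lim_difference_quotient _ _ _ H2)). intros x Hx. exact (eq_sym (f_equal Im
      (Q x Hx))).
Qed.

(** Along the horizontal line through [z], which lies in the slit plane, Gamma is the exponential of
    the limit [Lam] of [log_gamma_seq]; its logarithmic derivative is therefore the derivative of
    [Lam]. *)
Lemma digamma_clim (z : C) : Im z <> 0 ->
  clim (fun n => csum (fun j => / (INR j + z))%C n - Clog (INR n + z))%C (- digamma z).
Proof.
  intros H. assert (S0 : slit z) by now right.
  destruct (digamma_seq_clim z S0) as [l [Hl1 Hl2]].
  replace (digamma z) with l; [exact Hl2|].
  destruct (log_gamma_seq_converges z S0) as [G HG].
  assert (EG := CGamma_exp z G S0 HG).
  destruct (log_gamma_seq_taylor z H) as [c [Pc [K [PK B]]]].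
  unfold digamma. rewrite (C_derive_cderiv CGamma z (l * Cexp G)).
  { rewrite EG. field. apply Cexp_neq_0. }
  assert (Sx : forall x, slit (x, Im z)) by (intros x; now right).
  assert (LG : forall x, clim (log_gamma_seq (x, Im z)) (CLim_seq (log_gamma_seq (x, Im z)))).
  { intros x. destruct (log_gamma_seq_converges _ (Sx x)) as [m Hm].
    now rewrite (clim_CLim_seq _ _ Hm). }
  pose (Lam := fun x : R => CLim_seq (log_gamma_seq (x, Im z))).
  assert (EL : Lam (Re z) = G).
  { apply clim_CLim_seq. replace (Re z, Im z) with z by now destruct z. exact HG. }
  apply (cderiv_ext (fun x => Cexp (Lam x))).
  { intros x. symmetry. apply CGamma_exp; [apply Sx|apply LG]. }
  rewrite -EL. apply cderiv_Cexp.
  apply (cderiv_quadratic _ _ _ c K Pc). intros h Hh.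
  eapply (clim_Cmod_le (fun n => log_gamma_seq (h + z) n - log_gamma_seq z n - h * digamma_seq z
    n)%C).
  - apply clim_minus; [apply clim_minus|apply clim_scal, Hl1].
    + replace (h + z)%C with ((Re z + h, Im z) : C) by (apply C_eq; simpl; unfold Re, Im; ring).
        apply LG.
    + rewrite EL. exact HG.
  - intros n. now apply B.
Qed.

(** * Assembly *)

Definition branch (z : C) (t : R) : C := ((Clog (t + z) + euler_gamma) / (t + z))%C.

Definition branch_deriv (z : C) (t : R) : C :=
  ((1 - Clog (t + z)) / ((t + z) * (t + z))
   + euler_gamma * (- (1) / ((t + z) * (t + z))))%C.

Definition branch_primitive (z : C) (t : R) : C :=
  (1 / 2 * (Clog (t + z) * Clog (t + z)) + euler_gamma * Clog (t + z))%C.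

Lemma branch_split (z : C) (t : R) :
  branch z t = (Clog (t + z) / (t + z) + euler_gamma * / (t + z))%C.
Proof. unfold branch, Cdiv. ring. Qed.

Lemma cderiv_branch (z : C) (t : R) : slit z -> 0 <= t -> cderiv (branch z) t (branch_deriv z t).
Proof.
  intros H Ht. assert (S0 := slit_add z t H Ht).
  apply (cderiv_ext (fun t => Clog (t + z) / (t + z) + euler_gamma * / (t + z))%C).
  { intros u; now rewrite branch_split. }
  apply cderiv_plus; [now apply cderiv_Clog_div_add|now apply cderiv_scal, cderiv_inv_add].
Qed.

Lemma cderiv_branch_primitive (z : C) (t : R) : slit z -> 0 <= t ->
  cderiv (branch_primitive z) t (branch z t).
Proof.
  intros H Ht. assert (S0 := slit_add z t H Ht). rewrite branch_split.
  apply cderiv_plus; [now apply cderiv_Clog_sqr_add|now apply cderiv_scal, cderiv_Clog_add].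
Qed.

Lemma ccont_branch_deriv (z : C) (t : R) : slit z -> 0 <= t -> ccont (branch_deriv z) t.
Proof.
  intros H Ht. assert (S0 := slit_add z t H Ht). assert (N := slit_neq_0 _ S0).
  assert (N2 : ((t + z) * (t + z))%C <> 0%C) by now apply Cmult_neq_0.
  eapply cderiv_ccont. unfold branch_deriv. apply cderiv_plus.
  - apply cderiv_div; [exact N2| |apply cderiv_mult; apply cderiv_shift].
    apply cderiv_minus; [apply cderiv_const|now apply cderiv_Clog_add].
  - apply cderiv_scal, cderiv_div; [exact N2|apply cderiv_const|apply cderiv_mult; apply
      cderiv_shift].
Qed.

Lemma branch_deriv_decay (z : C) : slit z -> exists K, 0 <= K /\ forall t, 0 <= t ->
  Cmod (branch_deriv z t) <= K / ((t + 1) * sqrt (t + 1)).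
Proof.
  intros H. destruct (inv_add_decay z H) as [K [PK B]].
  assert (Pg := Rabs_pos euler_gamma).
  exists (K + Rabs euler_gamma * K). split; [nra|]. intros t Ht. destruct (B t Ht) as [B1 B2].
  eapply Rle_trans; [apply Cmod_triangle|]. rewrite Cmod_mult Cmod_R.
  unfold Rdiv at 1. rewrite Rmult_plus_distr_r Rmult_assoc. apply Rplus_le_compat; [exact B2|].
  now apply Rmult_le_compat_l.
Qed.

Lemma branch_sum_clim (z : C) : Im z <> 0 ->
  clim (fun k => csum (fun n => branch z (INR n)) k - branch_primitive z (INR k))%C
    (- psi1 z - euler_gamma * digamma z).
Proof.
  intros H. assert (S0 : slit z) by now right.
  eapply clim_ext; [|eapply clim_eq; [|apply (clim_plus _ _ _ _ (psi1_clim z S0)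
    (clim_scal euler_gamma _ _ (digamma_clim z H)))]].
  - intros k; cbv beta. unfold branch_primitive.
    rewrite (csum_ext (fun n => branch z (INR n)) (fun n => Clog (INR n + z) / (INR n + z) +
      euler_gamma * / (INR n + z))%C).
    + rewrite csum_plus csum_scal. ring.
    + intros j _. apply branch_split.
  - ring.
Qed.

Lemma branch_clim_0 (z : C) : slit z -> clim (fun k => branch z (INR k)) 0.
Proof.
  intros H.
  destruct (Clog_growth z H) as [K [HK B]]. destruct (slit_add_lower z H) as [c [[Hc1 Hc2] L]].
  assert (Pg := Rabs_pos euler_gamma).
  eapply clim_squeeze; [|apply (is_lim_seq_inv_sqrt ((K + Rabs euler_gamma) / c))]. intros n; cbv
    beta.
  assert (Pn := pos_INR n).
  replace (branch z (INR n) - 0)%C with (branch z (INR n)) by ring.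
  unfold branch. rewrite Cmod_div; [|now apply slit_neq_0, slit_add].
  assert (s1 := one_le_sqrt (INR n + 1) ltac:(lra)).
  assert (Sx : sqrt (INR n + 1) * sqrt (INR n + 1) = INR n + 1) by (apply sqrt_sqrt; lra).
  assert (Ln := L _ Pn). assert (Pc : 0 < c * (1 + INR n)) by nra.
  apply Rle_trans with ((K + Rabs euler_gamma) * sqrt (INR n + 1) / (c * (1 + INR n))).
  - apply Rmult_le_compat; [apply Cmod_ge_0|left; apply Rinv_0_lt_compat; lra| |apply
      Rinv_le_contravar; lra].
    eapply Rle_trans; [apply Cmod_triangle|]. rewrite Cmod_R. generalize (B _ Pn). nra.
  - right. rewrite (Rplus_comm 1) -{2}Sx. field; lra.
Qed.

Lemma kernel_branch (w : C) (x : R) :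
  kernel w x = (branch (Ci * w) x + branch (- Ci * w) x)%C.
Proof. reflexivity. Qed.

(* Limit of the trapezoidal sum of [kernel w] over [0, k] minus its integral. *)
Definition trapezoid_limit (w : C) : C :=
  (- psi1 (Ci * w) - euler_gamma * digamma (Ci * w) + branch_primitive (Ci * w) 0
   + (- psi1 (- Ci * w) - euler_gamma * digamma (- Ci * w) + branch_primitive (- Ci * w) 0)
   - 1 / 2 * kernel w 0)%C.

Lemma moment_sum_clim (w : C) (mom : nat -> C) : 0 < Re w ->
  (forall m, clim (kernel_moment w m) (mom m)) ->
  clim (csum (fun m => 2 * mom m)%C) (trapezoid_limit w).
Proof.
  intros hw Hmom.
  assert (I1 : Im (Ci * w) <> 0) by (rewrite im_mult; simpl; lra).
  assert (I2 : Im (- Ci * w) <> 0) by (rewrite im_mult; simpl; lra).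
  assert (S1 : slit (Ci * w)) by now right. assert (S2 : slit (- Ci * w)) by now right.
  destruct (branch_deriv_decay _ S1) as [K1 [PK1 B1]].
  destruct (branch_deriv_decay _ S2) as [K2 [PK2 B2]].
  pose (P := fun t => (branch_primitive (Ci * w) t + branch_primitive (- Ci * w) t)%C).
  pose (J := fun k => (P (INR k) - P 0)%C).
  assert (Dk : forall t, 0 <= t -> cderiv (kernel w) t (branch_deriv (Ci * w) t + branch_deriv (-
    Ci * w) t)%C).
  { intros t Ht. apply (cderiv_plus (branch (Ci * w)) (branch (- Ci * w))); now apply
      cderiv_branch. }
  assert (HJ : forall k, is_CInt (kernel w) 0 (INR k) (J k)).
  { intros k. apply (is_CInt_FTC P); [apply pos_INR| |].
    - intros t Ht. apply cderiv_plus; apply cderiv_branch_primitive; try assumption; lra.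
    - intros t Ht. eapply cderiv_ccont, Dk; lra. }
  assert (Est := poisson_estimate (kernel w) _ (K1 + K2) J (kernel_moment w) ltac:(lra) Dk
    (fun t Ht => ccont_plus _ _ t (ccont_branch_deriv _ t S1 Ht) (ccont_branch_deriv _ t S2 Ht))).
  specialize (Est ltac:(intros t Ht; eapply Rle_trans; [apply Cmod_triangle|];
    unfold Rdiv; rewrite Rmult_plus_distr_r; apply Rplus_le_compat; [now apply B1|now apply B2])
    HJ (is_CInt_kernel_moment w hw)).
  (* The endpoint at 0 keeps its half weight, whereas the half weight at [k] disappears because the
     kernel tends to 0. *)
  assert (HE : clim (fun k => csum (fun n => kernel w (INR n)) k - 1 / 2 * kernel w 0 + 1 / 2 *
    kernel w (INR k) - J k)%C
    (trapezoid_limit w)).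
  { eapply clim_ext; [|eapply clim_eq; [|apply (clim_plus _ _ _ _
      (clim_plus _ _ _ _ (branch_sum_clim _ I1) (branch_sum_clim _ I2))
      (clim_plus _ _ _ _ (clim_const (P 0 - 1 / 2 * kernel w 0)%C)
       (clim_scal (1 / 2) _ _ (clim_plus _ _ _ _ (branch_clim_0 _ S1) (branch_clim_0 _ S2)))))]].
    - intros k; cbv beta. unfold J.
      rewrite (csum_ext (fun n => kernel w (INR n)) (fun n => branch (Ci * w) (INR n) + branch (-
        Ci * w) (INR n))%C);
        [|intros; apply kernel_branch].
      rewrite csum_plus !kernel_branch. unfold P. ring.
    - unfold trapezoid_limit, P. ring. }
  apply clim_unshift.
  eapply clim_squeeze; [|apply (is_lim_seq_scal_0 (4 * (K1 + K2)) _
    (proj1 (is_lim_seq_incr_1 _ _) (is_lim_seq_inv_sqrt 8)))].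
  intros M; cbv beta. rewrite Cmod_minus_sym csum_scal.
  (* [M] is fixed and the estimate is uniform in [k]: the limit in [k] replaces the truncated
     moments by the full ones and preserves the bound, which then tends to 0 with [M]. *)
  eapply clim_Cmod_le; [|intros k; apply (Est M k)].
  eapply clim_ext; [|apply (clim_minus _ _ _ _ HE (clim_scal 2 _ _
    (csum_clim (fun m k => kernel_moment w m k) mom (S M) (fun j _ => Hmom j))))].
  intros k; cbv beta. ring.
Qed.

Lemma Clog_Ci_mult (w : C) : 0 < Re w -> Clog (Ci * w) = (Clog w + Ci * (PI / 2)%R)%C.
Proof.
  intros hw. rewrite Clog_rot_up; [|rewrite im_mult; simpl; lra].
  replace (- Ci * (Ci * w))%C with (- (Ci * Ci) * w)%C by ring. rewrite Ci_sqr.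
  replace (- - (1) * w)%C with w by ring. f_equal. apply C_eq; simpl; ring.
Qed.

Lemma Clog_opp_Ci_mult (w : C) : 0 < Re w -> Clog (- (Ci * w)) = (Clog w - Ci * (PI / 2)%R)%C.
Proof.
  intros hw. rewrite Clog_rot_down; [|rewrite im_opp im_mult; simpl; lra].
  replace (Ci * - (Ci * w))%C with (- (Ci * Ci) * w)%C by ring. rewrite Ci_sqr.
  replace (- - (1) * w)%C with w by ring. unfold Cminus. f_equal. apply C_eq; simpl; ring.
Qed.

(** The term PI / (2 w) is half the kernel at 0: there gamma cancels and log(i w) - log(- i w) = i
    PI remains, divided by 2 i w. The sum of the same two logarithms, 2 log w, gives the last
    term. *)
Lemma opp_trapezoid_limit (w : C) : 0 < Re w ->
  (- trapezoid_limit w)%C =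
  (psi1 (Ci * w) - 1 / 2 * Clog (Ci * w) ^ 2
    + psi1 (- (Ci * w)) - 1 / 2 * Clog (- (Ci * w)) ^ 2
    + PI / (2 * w)
    + euler_gamma * (digamma (Ci * w) + digamma (- (Ci * w)) - 2 * Clog w))%C.
Proof.
  intros hw. assert (Nw := w_neq_0 w hw). assert (NCi := Ci_nz).
  unfold trapezoid_limit, branch_primitive, kernel.
  replace (- Ci * w)%C with (- (Ci * w))%C by ring.
  replace (0 + Ci * w)%C with (Ci * w)%C by ring.
  replace (0 + - (Ci * w))%C with (- (Ci * w))%C by ring.
  set (a := psi1 (Ci * w)). set (b := psi1 (- (Ci * w))).
  set (d := digamma (Ci * w)). set (e := digamma (- (Ci * w))).
  rewrite Clog_Ci_mult // Clog_opp_Ci_mult //. set (L := Clog w).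
  rewrite RtoC_div; [|lra].
  field. split; assumption.
Qed.

Open Scope C_scope.

Theorem theorem3p4 (w : C) (hw : (0 < Re w)%R) :
  (forall m : nat, (1 <= m)%nat -> ex_improper_int (integrand w m)) /\
  @ex_series C_AbsRing C_NormedModule
    (fun k : nat => improper_int (integrand w (S k))) /\
  4 * CSeries (fun k : nat => improper_int (integrand w (S k)))
  = psi1 (Ci * w) - 1 / 2 * Clog (Ci * w) ^ 2
    + psi1 (- (Ci * w)) - 1 / 2 * Clog (- (Ci * w)) ^ 2
    + PI / (2 * w)
    + euler_gamma * (digamma (Ci * w) + digamma (- (Ci * w)) - 2 * Clog w).
Proof.
  destruct (kernel_moment_converges w hw) as [K [PK HK]].
  assert (Hm : forall m, ex_improper_int (integrand w (S m)) /\
    clim (kernel_moment w m) (- (2) * improper_int (integrand w (S m)))).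
  { intros m. destruct (HK m) as [s [Hs Bs]].
    destruct (improper_int_integrand w hw m s K PK Bs) as [E1 E2]. split; [exact E1|].
    rewrite E2. eapply clim_eq; [|exact Hs]. field. }
  (* Each moment is -2 times the integral and enters Poisson summation twice, whence the factor - 1
     / 4. *)
  assert (Hsum : clim (csum (fun k => improper_int (integrand w (S k)))) (- (1 / 4) *
    trapezoid_limit w)).
  { eapply clim_ext; [|apply (clim_scal (- (1 / 4)) _ _ (moment_sum_clim w _ hw (fun m => proj2
      (Hm m))))].
    intros n; cbv beta. rewrite -csum_scal. apply csum_ext. intros j _. field. }
  split; [|split].
  - intros [|m] Hm1; [lia|]. apply Hm.
  - eapply clim_ex_series; exact Hsum.
  - rewrite (clim_CSeries _ _ Hsum) -opp_trapezoid_limit //. field.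
Qed.
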